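(* Let $E$ be associated to a representation $\lambda$ with $N=4$, with parameters $k,\ell,p$ as described in the context, so that $w_1=k>w_2=\ell-p>w_3=1-\frac n2-\ell>w_4=-k+p+1-n$. If $\xi$ is a nonvanishing section in the kernel of one of the elliptic operators $P_1$, $P_3$ or $P_2+P_4$, then $\bigl|d|\xi|\bigr|\le k_I|\nabla\xi|$ with $k_I$ given as follows. (i) For $P_1$, $$k_{\{1\}}^2=1-\frac{(w_1+\frac{n-2}2)(w_1+w_4+n-1)}{(w_1-w_2)(w_1-w_3)}=\frac{(k+\frac{n-2}2)(k-\ell)+\ell(k-\ell+p)}{(k-\ell+p)(k+\ell+\frac{n-2}2)},$$ and equality holds iff $\nabla\xi=(\Pi_2+\Pi_3)(\alpha\otimes\xi)$ for a $1$-form $\alpha$ with $\Pi_4(\alpha\otimes\xi)=0$. (ii) For $P_3$, $$k_{\{3\}}^2=1-\frac{(w_3+\frac{n-2}2)(w_3+w_2+n-1)}{(w_3-w_4)(w_3-w_1)}=1-\frac{\ell(\frac n2-p)}{(k-\ell+\frac n2-p)(k+\ell+\frac{n-2}2)},$$ and equality holds iff $\nabla\xi=(\Pi_1+\Pi_4)(\alpha\otimes\xi)$ for a $1$-form $\alpha$ with $\Pi_2(\alpha\otimes\xi)=0$. (iii) For $P_2+P_4$, $$k_{\{2,4\}}^2=1-\min\left\{\frac{(w_4+\frac{n-2}2)(w_2+w_4+n-1)}{(w_4-w_1)(w_4-w_3)},\ \frac{(w_2+\frac{n-2}2)(w_2+w_4+n-1)}{(w_2-w_1)(w_2-w_3)}\right\}$$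 $$=1-\min\left\{\frac{(k+\frac n2-p)(k-\ell)}{(2k+n-p-1)(k-\ell+\frac n2-p)},\ \frac{(\ell+\frac n2-p-1)(k-\ell)}{(k-\ell+p)(2\ell+\frac n2-p-1)}\right\},$$ and equality holds iff $\nabla\xi=(\Pi_1+\Pi_3)(\alpha\otimes\xi)$ for a $1$-form $\alpha$ with $\Pi_2(\alpha\otimes\xi)=0$ or $\Pi_4(\alpha\otimes\xi)=0$, according to whether the first or the second term is the minimum.
   Context: Let $n=2m$ or $n=2m+1$, and let $\lambda$ be an irreducible representation of $\mathrm{SO}(n)$ or $\mathrm{Spin}(n)$ on a vector space $V$ ($V$ is complex, or real with irreducible complexification) with an invariant real inner product (the real part of an invariant Hermitian product if $V$ is complex); $d\lambda$ is the induced representation of $\mathfrak{so}(n)$, and $\lambda=(\lambda_1,\dots,\lambda_m)$ also denotes the highest weight in standard coordinates. Identify $\mathfrak{so}(n)=\Lambda^2\mathbb R^n$ acting on $\mathbb R^n$ by $(\alpha\wedge\beta)x=\langle\alpha,x\rangle\beta-\langle\beta,x\rangle\alpha$. On the real tensor product $\mathbb R^n\otimes V$ define the symmetric equivariant endomorphism $B(\alpha\otimes v)=\sum_{i=1}^n e_i\otimes d\lambda(e_i\wedge\alpha)v$, with $(e_i)$ an orthonormal basis. Its distinct eigenvalues are written $w_1>\dots>w_N$ (conformal weights), with eigenspaces $W_j$ and orthogonal projections $\Pi_j$. $N=4$ occurs in the following cases: (a) $n=2m$ and $\lambda=(k,\dots,k,\ell,\dots,\ell,\pm\ell)$ with $k$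 repeated $p$ times, $0<p<m$, where $k>\ell>0$ are simultaneously integers or half-integers; (b) $n=2m+1$ and $\lambda=(k,\dots,k,\frac12,\dots,\frac12)$ with $k>\frac12$ a half-integer repeated $p$ times, $0<p<m$; here put $\ell=\frac12$. In both cases $w_1=k>w_2=\ell-p>w_3=1-\frac n2-\ell>w_4=-k+p+1-n$. $(M,g)$ is an oriented Riemannian (spin, if needed) manifold of dimension $n$, $E\to M$ is the vector bundle associated to $\lambda$, and $\nabla$ is an arbitrary metric connection on $E$. The decomposition of $\mathbb R^n\otimes V$ induces one of $T^*M\otimes E$ with projections again denoted $\Pi_j$; $P_j=\Pi_j\circ\nabla$. Equality statements are pointwise.
   Formalization: In (iii), when the two terms in the minimum are equal (e.g. always for n=4, p=1), the extra condition Π₂(α⊗ξ)=0 or Π₄(α⊗ξ)=0 is not necessary for equality; there the criterion is only ∇ξ=(Π₁+Π₃)(α⊗ξ) for some α. *)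

(* Defs.v *)
From HB Require Import structures.
From mathcomp Require Import all_boot all_order all_algebra.
From mathcomp Require Import complex.
From mathcomp Require Import all_classical all_reals all_analysis.

Set Implicit Arguments.
Unset Strict Implicit.
Unset Printing Implicit Defensive.

Import Order.TTheory GRing.Theory Num.Theory.
Import numFieldNormedType.Exports.

Local Open Scope classical_set_scope.
Local Open Scope complex_scope.
Local Open Scope ring_scope.

(** * Linear algebra: R^n, so(n), R^n (x) V *)

Section LinearAlgebra.
Variable R : realType.
Local Notation C := R[i].

Definition basis_vec (n : nat) (i : 'I_n) : 'cV[R]_n := delta_mx i 0.

Definition wedge (n : nat) (a b : 'cV[R]_n) : 'M[R]_n := b *m a^T - a *m b^T.

Definition so_mem (n : nat) (X : 'M[R]_n) : Prop := X^T = - X.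

(* The real tensor product R^n (x) C^d is 'M[C]_(d, n): column i of T is the
   coefficient of e_i. *)
Definition tens (n d : nat) (a : 'cV[R]_n) (v : 'cV[C]_d) : 'M[C]_(d, n) :=
  v *m (map_mx (real_complex R) a)^T.

(* real part of the standard Hermitian product *)
Definition rdot (m n : nat) (S T : 'M[C]_(m, n)) : R :=
  \sum_i \sum_j (complex.Re (S i j) * complex.Re (T i j)
               + complex.Im (S i j) * complex.Im (T i j)).

Definition rnorm (m n : nat) (T : 'M[C]_(m, n)) : R := Num.sqrt (rdot T T).

Definition euclid_norm (n : nat) (a : 'cV[R]_n) : R :=
  Num.sqrt (\sum_i a i 0 ^+ 2).

Definition real_mx (m n : nat) (T : 'M[C]_(m, n)) : Prop :=
  forall i j, complex.Im (T i j) = 0.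

End LinearAlgebra.

(** * The groups SO(n) and Spin(n) *)

Section Groups.
Variable R : realType.

Definition SO_mem (n : nat) (A : 'M[R]_n) : Prop :=
  A *m A^T = 1%:M /\ \det A = 1.

(* Left multiplication by e_i on the Clifford algebra of R^n (v^2 = -|v|^2), in
   the basis e_S = e_{s1} ... e_{sr}, S = {s1 < ... < sr}; the basis is
   enumerated by [enum_val]. *)
Definition clifford_dim (n : nat) : nat := #|{: {set 'I_n}}|.

Definition clifford_gen (n : nat) (i : 'I_n) : 'M[R]_(clifford_dim n) :=
  \matrix_(a, b)
    let S : {set 'I_n} := enum_val b in
    let S' : {set 'I_n} := if i \in S then S :\ i else i |: S in
    if enum_val a == S'
    then (-1) ^+ (#|[set j in S | (j < i)%N]| + (i \in S)) else 0.

Definition clifford_vec (n : nat) (v : 'cV[R]_n) : 'M[R]_(clifford_dim n) :=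
  \sum_i v i 0 *: clifford_gen i.

(* products of an even number of unit vectors *)
Definition Spin_mem (n : nat) (g : 'M[R]_(clifford_dim n)) : Prop :=
  exists s : seq ('cV[R]_n * 'cV[R]_n),
    (forall p, p \in s -> euclid_norm p.1 = 1 /\ euclid_norm p.2 = 1) /\
    g = foldr (fun p h => clifford_vec p.1 *m clifford_vec p.2 *m h) 1%:M s.

(* A matrix group together with its (special orthogonal) action on R^n, given
   as a relation. *)
Record struct_group (n : nat) := StructGroup {
  gdim : nat;
  gmem : 'M[R]_gdim -> Prop;
  gcover : 'M[R]_gdim -> 'M[R]_n -> Prop }.

Definition SO_group (n : nat) : struct_group n :=
  @StructGroup n n (@SO_mem n) (fun g A => A = g).

(* g v g^-1 = A v in the Clifford algebra *)
Definition Spin_group (n : nat) : struct_group n :=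
  @StructGroup n (clifford_dim n) (@Spin_mem n)
    (fun g A => SO_mem A /\
       forall v : 'cV[R]_n, g *m clifford_vec v = clifford_vec (A *m v) *m g).

End Groups.

(** * Representations *)

(* A representation space is C^d with its standard Hermitian product (no loss:
   choose a unitary basis).  A real representation, [RealRep], is given by its
   complexification: V is the set of real points R^d of C^d, and the group acts
   by real matrices. *)
Variant rep_kind := RealRep | ComplexRep.

Section Representations.
Variables (R : realType) (n : nat).
Local Notation C := R[i].
Local Notation e_ i := (basis_vec R i).

Definition in_kind (K : rep_kind) (p q : nat) (T : 'M[C]_(p, q)) : Prop :=
  match K with RealRep => real_mx T | ComplexRep => True end.

(* X is the derivative at 0 of the curve c *)
Definition curve_derive (p q : nat) (c : R -> 'M[R]_(p, q)) (X : 'M[R]_(p, q)) :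
    Prop :=
  forall i j, is_derive (0 : R) (1 : R) (fun t : R => c t i j) (X i j).

(* dl is the derivative of rho at the identity, along every curve g in G through
   the identity, so(n) being identified with the Lie algebra of G through the
   action A of g on R^n. *)
Definition induced_rep (G : struct_group R n) (d : nat)
    (rho : 'M[R]_(gdim G) -> 'M[C]_d) (dl : 'M[R]_n -> 'M[C]_d) : Prop :=
  forall (g : R -> 'M[R]_(gdim G)) (A : R -> 'M[R]_n)
         (Y : 'M[R]_(gdim G)) (X : 'M[R]_n),
    (forall t, gmem (g t)) -> (forall t, gcover (g t) (A t)) -> g 0 = 1%:M ->
    curve_derive g Y -> curve_derive A X ->
    curve_derive (fun t => map_mx (@complex.Re R) (rho (g t)))
                 (map_mx (@complex.Re R) (dl X)) /\
    curve_derive (fun t => map_mx (@complex.Im R) (rho (g t)))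
                 (map_mx (@complex.Im R) (dl X)).

(* rho is an orthogonal (unitary, if V is complex) representation of G on V, with
   induced Lie algebra representation dl *)
Record is_representation (K : rep_kind) (G : struct_group R n) (d : nat)
    (rho : 'M[R]_(gdim G) -> 'M[C]_d) (dl : 'M[R]_n -> 'M[C]_d) : Prop :=
  IsRepresentation {
  rep1 : rho 1%:M = 1%:M;
  repM : forall g h, gmem g -> gmem h -> rho (g *m h) = rho g *m rho h;
  rep_kindP : forall g, gmem g -> in_kind K (rho g);
  rep_dot : forall g (u v : 'cV[C]_d), gmem g ->
    rdot (rho g *m u) (rho g *m v) = rdot u v;
  rep_derive : induced_rep rho dl;
  drepD : forall X Y, so_mem X -> so_mem Y -> dl (X + Y) = dl X + dl Y;
  drepZ : forall (a : R) X, so_mem X -> dl (a *: X) = a%:C *: dl X;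
  drep_bracket : forall X Y, so_mem X -> so_mem Y ->
    dl (X *m Y - Y *m X) = dl X *m dl Y - dl Y *m dl X }.

(* Irreducibility over C, that is, of V if V is complex and of its
   complexification if V is real.  The row space of U stands for a subspace of
   C^d, whence the transposes. *)
Definition complex_irreducible (G : struct_group R n) (d : nat)
    (rho : 'M[R]_(gdim G) -> 'M[C]_d) : Prop :=
  (0 < d)%N /\
  forall U : 'M[C]_d,
    (forall g, gmem g -> (U *m (rho g)^T <= U)%MS) -> U = 0 \/ row_full U.

(** Highest weights, with respect to the Cartan subalgebra spanned by
   h_j = e_(2j) /\ e_(2j+1), 0 <= j < n./2.  In C^n, the vector
   z_j = e_(2j) - i e_(2j+1) has weight +eps_j (h_j z_j = i z_j), and its conjugate
   has weight -eps_j; the positive root vectors are z_j /\ zbar_k and z_j /\ z_k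
   (j < k), and z_j /\ e_(n-1) if n is odd. *)
Definition nat_vec (a : nat) : 'cV[R]_n := \col_i (val i == a)%:R.

Definition cartan (j : nat) : 'M[R]_n := wedge (nat_vec j.*2) (nat_vec j.*2.+1).

Definition zvec (j : nat) : 'cV[C]_n :=
  map_mx (real_complex R) (nat_vec j.*2)
  - 'i%C *: map_mx (real_complex R) (nat_vec j.*2.+1).

Definition zbar (j : nat) : 'cV[C]_n :=
  map_mx (real_complex R) (nat_vec j.*2)
  + 'i%C *: map_mx (real_complex R) (nat_vec j.*2.+1).

(* complex bilinear extension of (a, b) |-> dl (a /\ b) *)
Definition dl_wedge (d : nat) (dl : 'M[R]_n -> 'M[C]_d) (z w : 'cV[C]_n) :
    'M[C]_d :=
  \sum_a \sum_b (z a 0 * w b 0) *: dl (wedge (e_ a) (e_ b)).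

Definition is_highest_weight (d : nat) (dl : 'M[R]_n -> 'M[C]_d)
    (mu : nat -> R) : Prop :=
  exists v : 'cV[C]_d, v != 0 /\
  [/\ forall j, (j < n./2)%N ->
        dl (cartan j) *m v = ('i%C * (mu j)%:C) *: v,
      forall j k, (j < k)%N -> (k < n./2)%N ->
        dl_wedge dl (zvec j) (zbar k) *m v = 0 /\
        dl_wedge dl (zvec j) (zvec k) *m v = 0
    & odd n -> forall j, (j < n./2)%N ->
        dl_wedge dl (zvec j) (map_mx (real_complex R) (nat_vec n.-1)) *m v = 0].

(** Conformal weights. *)
Definition conf_op (d : nat) (dl : 'M[R]_n -> 'M[C]_d) (T : 'M[C]_(d, n)) :
    'M[C]_(d, n) :=
  \sum_i \sum_j tens (e_ i) (dl (wedge (e_ i) (e_ j)) *m col j T).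

Definition conf_eigen (d : nat) (dl : 'M[R]_n -> 'M[C]_d) (w : R)
    (T : 'M[C]_(d, n)) : Prop :=
  conf_op dl T = w%:C *: T.

(* ws is the decreasing list of the distinct eigenvalues of B; hence N = size ws.
   For a real V these are also the eigenvalues on R^n (x) V, since B is real. *)
Definition conformal_weights (d : nat) (dl : 'M[R]_n -> 'M[C]_d) (ws : seq R) :
    Prop :=
  sorted >%O ws /\
  forall w : R, w \in ws <-> exists2 T : 'M[C]_(d, n), T != 0 & conf_eigen dl w T.

(* Orthogonal projection onto the w-eigenspace of B.  For a real V it preserves
   R^n (x) V and restricts to the corresponding projection there. *)
Definition conf_proj (d : nat) (dl : 'M[R]_n -> 'M[C]_d) (w : R)
    (T : 'M[C]_(d, n)) : 'M[C]_(d, n) :=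
  xget 0 [set S | conf_eigen dl w S /\
                  forall U, conf_eigen dl w U -> rdot (T - S) U = 0].

(** The two families with N = 4; weights are indexed from 0. *)
Definition half_int (x : R) : Prop := x + 2^-1 \is a Num.int.

Definition weight_even (m p : nat) (k l : R) (mu : nat -> R) : Prop :=
  [/\ n = m.*2, (0 < p < m)%N, 0 < l < k,
      (k \is a Num.int /\ l \is a Num.int) \/ (half_int k /\ half_int l)
    & exists s : bool, forall j, (j < m)%N ->
        mu j = if (j < p)%N then k
               else if (j == m.-1)%N then (-1) ^+ s * l else l].

Definition weight_odd (m p : nat) (k l : R) (mu : nat -> R) : Prop :=
  [/\ n = m.*2.+1, (0 < p < m)%N, l = 2^-1 /\ l < k, half_int k
    & forall j, (j < m)%N -> mu j = if (j < p)%N then k else l].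

End Representations.

(** * Oriented Riemannian manifolds *)

Section Manifolds.
Variable R : realType.

Fixpoint Ck_on (n k : nat) (U : set 'cV[R]_n) (f : 'cV[R]_n -> R) : Prop :=
  match k with
  | 0%N => forall x, U x -> {for x, continuous f}
  | k'.+1 => (forall x, U x -> differentiable f x) /\
             forall v, Ck_on k' U (fun x => 'D_v f x)
  end.

Definition smooth_on (n : nat) (U : set 'cV[R]_n) (f : 'cV[R]_n -> R) : Prop :=
  forall k, Ck_on k U f.

Definition jacobian (n : nat) (f : 'cV[R]_n -> 'cV[R]_n) (y : 'cV[R]_n) :
    'M[R]_n :=
  \matrix_(i, j) 'D_(basis_vec R j) (fun z => f z i 0) y.

(* Tangent vectors are represented by their components in the charts; [metric a x]
   is the matrix of the metric at x in the chart a.  Functions given on the domain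
   of a chart are total, their values elsewhere being irrelevant. *)
Record riem_manifold (n : nat) := RiemManifold {
  point :> topologicalType;
  hausdorff_ax : hausdorff_space point;
  second_countable_ax : @second_countable point;
  chart_ix : Type;
  dom : chart_ix -> set point;
  chart : chart_ix -> point -> 'cV[R]_n;
  chart_inv : chart_ix -> 'cV[R]_n -> point;
  metric : chart_ix -> point -> 'M[R]_n;
  dom_open : forall a, open (dom a);
  dom_cover : forall x, exists a, dom a x;
  img_open : forall a, open (chart a @` dom a);
  chartK : forall a x, dom a x -> chart_inv a (chart a x) = x;
  chart_cont : forall a x, dom a x -> {for x, continuous (chart a)};
  chart_inv_cont : forall a y, (chart a @` dom a) y ->
    {for y, continuous (chart_inv a)};
  transition_smooth : forall a b i,
    smooth_on (chart a @` (dom a `&` dom b))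
              (fun y => chart b (chart_inv a y) i 0);
  oriented_ax : forall a b x, dom a x -> dom b x ->
    0 < \det (jacobian (chart b \o chart_inv a) (chart a x));
  metric_sym : forall a x, dom a x -> (metric a x)^T = metric a x;
  metric_pos : forall a x (v : 'cV[R]_n), dom a x -> v != 0 ->
    0 < (v^T *m metric a x *m v) 0 0;
  metric_smooth : forall a i j,
    smooth_on (chart a @` dom a) (fun y => metric a (chart_inv a y) i j);
  metric_change : forall a b x, dom a x -> dom b x ->
    let J := jacobian (chart b \o chart_inv a) (chart a x) in
    metric a x = J^T *m metric b x *m J }.

(* An SO(n)-structure, resp. spin structure, compatible with the metric and the
   orientation: local oriented orthonormal frames (the columns of [frame a x], in
   the chart a) and transition functions in G lifting the change of frames.  The
   atlas is assumed to trivialise the principal G-bundle, which is achieved by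
   shrinking charts. *)
Record frame_structure (n : nat) (G : struct_group R n) (M : riem_manifold n) :=
  FrameStructure {
  frame : chart_ix M -> M -> 'M[R]_n;
  trans : chart_ix M -> chart_ix M -> M -> 'M[R]_(gdim G);
  frame_smooth : forall a i j,
    smooth_on (chart a @` dom a) (fun y => frame a (chart_inv a y) i j);
  frame_ortho : forall a x, dom a x ->
    (frame a x)^T *m metric a x *m frame a x = 1%:M;
  frame_oriented : forall a x, dom a x -> 0 < \det (frame a x);
  trans_mem : forall a b x, dom a x -> dom b x -> gmem (trans a b x);
  trans_smooth : forall a b i j,
    smooth_on (chart a @` (dom a `&` dom b))
              (fun y => trans a b (chart_inv a y) i j);
  trans_cocycle : forall a b c x, dom a x -> dom b x -> dom c x ->
    trans a b x *m trans b c x = trans a c x;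
  trans_cover : forall a b x, dom a x -> dom b x ->
    exists2 A : 'M[R]_n, gcover (trans a b x) A &
      jacobian (chart a \o chart_inv b) (chart b x) *m frame b x
      = frame a x *m A }.

Definition smooth_fun (n : nat) (M : riem_manifold n) (f : M -> R) : Prop :=
  forall a, smooth_on (chart a @` dom a) (f \o chart_inv a).

(* components, in the frame a, of the differential at x of a function f defined
   near x *)
Definition diff_in (n : nat) (G : struct_group R n) (M : riem_manifold n)
    (F : frame_structure G M) (a : chart_ix M) (f : M -> R) (x : M) : 'cV[R]_n :=
  \col_i 'D_(col i (frame F a x)) (f \o chart_inv a) (chart a x).

End Manifolds.

(** * The associated bundle E and its metric connections *)

Section Bundles.
Variables (R : realType) (n : nat) (G : struct_group R n) (M : riem_manifold R n).
Variables (F : frame_structure G M) (K : rep_kind) (d : nat).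
Variable rho : 'M[R]_(gdim G) -> 'M[R[i]]_d.
Local Notation C := R[i].

(* local expressions of sections of E and of T*M (x) E; the i-th column of the
   latter is the coefficient of the i-th element of the dual frame *)
Definition local_sections : Type := chart_ix M -> M -> 'cV[C]_d.
Definition local_tsections : Type := chart_ix M -> M -> 'M[C]_(d, n).

Definition smooth_local (q : nat) (xi : chart_ix M -> M -> 'M[C]_(d, q)) : Prop :=
  forall a i j,
    smooth_on (chart a @` dom a)
              (fun y => complex.Re (xi a (chart_inv a y) i j)) /\
    smooth_on (chart a @` dom a)
              (fun y => complex.Im (xi a (chart_inv a y) i j)).

Definition is_section (xi : local_sections) : Prop :=
  [/\ forall a x, dom a x -> in_kind K (xi a x),
      forall a b x, dom a x -> dom b x -> xi a x = rho (trans F a b x) *m xi b x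
    & smooth_local xi].

(* with e^b_j = sum_i A_ij e^a_i *)
Definition is_tsection (S : local_tsections) : Prop :=
  [/\ forall a x, dom a x -> in_kind K (S a x),
      forall a b x (A : 'M[R]_n), dom a x -> dom b x ->
        gcover (trans F a b x) A ->
        S a x *m map_mx (real_complex R) A = rho (trans F a b x) *m S b x
    & smooth_local S].

(* nab need only be real linear, and compatible with the real inner product. *)
Record metric_connection (nab : local_sections -> local_tsections) : Prop :=
  MetricConnection {
  conn_section : forall xi, is_section xi -> is_tsection (nab xi);
  conn_ext : forall xi eta, is_section xi -> is_section eta ->
    (forall a x, dom a x -> xi a x = eta a x) ->
    forall a x, dom a x -> nab xi a x = nab eta a x;
  connD : forall xi eta, is_section xi -> is_section eta ->
    forall a x, dom a x ->
      nab (fun b y => xi b y + eta b y) a x = nab xi a x + nab eta a x;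
  conn_leibniz : forall (f : M -> R) xi, smooth_fun f -> is_section xi ->
    forall a x, dom a x ->
      nab (fun b y => (f y)%:C *: xi b y) a x
      = tens (diff_in F a f x) (xi a x) + (f x)%:C *: nab xi a x;
  conn_metric : forall xi eta, is_section xi -> is_section eta ->
    forall a x, dom a x -> forall i,
      diff_in F a (fun y => rdot (xi a y) (eta a y)) x i 0
      = rdot (col i (nab xi a x)) (eta a x) +
        rdot (xi a x) (col i (nab eta a x)) }.

Definition nonvanishing (xi : local_sections) : Prop :=
  forall a x, dom a x -> xi a x != 0.

(* |nab xi| and |d|xi|| at x; both are computed in the orthonormal frame a, and do
   not depend on it *)
Definition norm_nab (nab : local_sections -> local_tsections)
    (xi : local_sections) (a : chart_ix M) (x : M) : R := rnorm (nab xi a x).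

Definition norm_dnorm (xi : local_sections) (a : chart_ix M) (x : M) : R :=
  euclid_norm (diff_in F a (fun y => rnorm (xi a y)) x).

(* P_j xi at x, for w = w_j *)
Definition conf_diff (dl : 'M[R]_n -> 'M[C]_d)
    (nab : local_sections -> local_tsections) (w : R) (xi : local_sections)
    (a : chart_ix M) (x : M) : 'M[C]_(d, n) := conf_proj dl w (nab xi a x).

End Bundles.

(* Main.v *)
(* Put q_j = |Pi_j (alpha (x) v)|^2. When the projection Pi_I of nabla xi vanishes,
   Cauchy-Schwarz applied to <nabla xi, d|xi| (x) xi> reduces the Kato constant to
   the infimum of the sum of the q_j over I. The q_j satisfy three linear
   relations: their sum is |alpha|^2 |v|^2; their mean is
   <B (alpha (x) v), alpha (x) v> = 0; and comparing B^3, as an n x n matrix over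
   End V, with its transpose relates the third and second moments (the Casimir,
   a scalar by Schur's lemma, enters here). So all the q_j are affine in one of
   them, and q_j >= 0 yields the constants and the equality cases.
   Transposing the quartic equation of B gives a second quartic with the same
   roots, hence two relations between the conformal weights. Two weights, k and
   l - p, come from explicit eigenvectors built on the highest weight vector,
   and the relations give the other two. *)
Require Import Defs.
From HB Require Import structures.
From mathcomp Require Import all_boot all_order all_algebra.
From mathcomp Require Import complex.
From mathcomp Require Import all_classical all_reals all_analysis.
From mathcomp Require Import spectral ring lra zify.

Set Implicit Arguments.
Unset Strict Implicit.
Unset Printing Implicit Defensive.

Import Order.TTheory GRing.Theory Num.Theory.
Import numFieldNormedType.Exports.

Local Open Scope classical_set_scope.
Local Open Scope complex_scope.
Local Open Scope ring_scope.

(** * The conformal operator and its quartic equations *)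

(** Why transposition gives relations at all: exchanging the two block indices does not reverse
    products of noncommuting entries, so the transpose of $B^s$ is not $(-B)^s$; the defect is a
    combination of lower powers, of the Casimir and of block traces. Applied to the quartic it gives
    another monic quartic killing $B$. Comparing coefficients, degrees 3 and 1 give the two
    relations, while degrees 2 and 0 repeat the first. The weight list speaks of real eigenvalues
    only. Self-adjointness of $B$ excludes nonreal ones and makes the product of the factors $B-w_j$
    vanish. The group enters through curves: skewness of [dl] and invariance of the Casimir are
    obtained by differentiating [rho]. The curves are products of two reflections, because the same
    two unit vectors multiply to an element of $\mathrm{Spin}(n)$, so both groups are treated alike.
    The shift $w+\frac{n-2}2$ in the constants comes from the third root of the cubic used to
    eliminate two masses: the sum of the weights rewrites it through the fourth weight. *)

Section BlockPowers.
Variables (F : numFieldType) (n d : nat) (D : 'I_n -> 'I_n -> 'M[F]_d).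

(** The $(i,j)$ block of $B^s$, with $B$ read as an $n\times n$ matrix with entries in
    $\mathrm{End}(V)$. Blocks are kept separate so that the two indices can be exchanged without
    touching the entries. *)
Fixpoint bpow (s : nat) (i j : 'I_n) : 'M[F]_d :=
  if s is s'.+1 then \sum_a D i a *m bpow s' a j else (i == j)%:R%:M.

Lemma bpow1 i j : bpow 1 i j = D i j.
Proof.
rewrite /= (bigD1 j) //= eqxx mulmx1 big1 ?addr0 // => a /negPf ->.
by rewrite raddf0 mulmx0.
Qed.

Lemma bpowSr s i j : bpow s.+1 i j = \sum_a bpow s i a *m D a j.
Proof.
elim: s i j => [|s IHs] i j.
  rewrite bpow1 /= (bigD1 i) //= eqxx mul1mx big1 ?addr0 // => a.
  by rewrite eq_sym => /negPf ->; rewrite raddf0 mul0mx.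
rewrite [LHS]/=.
under eq_bigr => a _ do rewrite -/(bpow s.+1 a j) IHs mulmx_sumr.
rewrite exchange_big /=; apply: eq_bigr => b _; rewrite mulmx_suml.
by apply: eq_bigr => a _; rewrite mulmxA.
Qed.

Hypothesis Danti : forall i j, D j i = - D i j.
Hypothesis Dcomm : forall i j k l,
  D i j *m D k l - D k l *m D i j =
  (i == k)%:R *: D j l - (j == k)%:R *: D i l
  + (i == l)%:R *: D k j - (j == l)%:R *: D k i.

Lemma sum_delta (T : finType) (V : lmodType F) (x : T) (f : T -> V) :
  \sum_b (x == b)%:R *: f b = f x.
Proof.
rewrite (bigD1 x) //= eqxx scale1r big1 ?addr0 // => b.
by rewrite eq_sym => /negPf ->; rewrite scale0r.
Qed.

(** Equivariance of $B^s$: commuting with [D a b] rotates the two block indices. In the induction,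
    the terms that [Dcomm] and the induction hypothesis produce at the summation index cancel. *)
Lemma bpow_comm s a b i j :
  D a b *m bpow s i j - bpow s i j *m D a b =
  (a == i)%:R *: bpow s b j - (b == i)%:R *: bpow s a j
  + (a == j)%:R *: bpow s i b - (b == j)%:R *: bpow s i a.
Proof.
elim: s i j => [|s IHs] i j.
  rewrite /= scalar_mxC subrr !scale_scalar_mx -!raddfB -!raddfD -!raddfB /=.
  suff -> : (a == i)%:R * (b == j)%:R - (b == i)%:R * (a == j)%:R +
    (a == j)%:R * (i == b)%:R - (b == j)%:R * (i == a)%:R = 0 :> F by rewrite raddf0.
  by rewrite (eq_sym i b) (eq_sym i a); ring.
have E : D a b *m bpow s.+1 i j - bpow s.+1 i j *m D a b =
  \sum_c ((D a b *m D i c - D i c *m D a b) *m bpow s c j +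
          D i c *m (D a b *m bpow s c j - bpow s c j *m D a b)).
  rewrite /= mulmx_sumr mulmx_suml -sumrB; apply: eq_bigr => c _.
  by rewrite mulmxBl mulmxBr !mulmxA addrA subrK.
rewrite E => {E}.
under eq_bigr => c _.
  rewrite Dcomm IHs !(mulmxDl, mulmxDr, mulmxBl, mulmxBr, mulNmx, mulmxN).
  rewrite -!scalemxAl -!scalemxAr.
  over.
rewrite !(big_split, sumrN) /= -!scaler_sumr !sum_delta.
move: (D i b *m bpow s a j) (D i a *m bpow s b j) => X Y.
move: (\sum_c D b c *m _) (\sum_c D a c *m _) (\sum_c D i c *m bpow s c a)
  (\sum_c D i c *m bpow s c b) => A B P Q.
by apply/matrixP => x y; rewrite !mxE; ring.
Qed.

(* Moving [D a i] to the left of [bpow s j a] expresses the transpose of the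
   block matrix B^(s+1) through lower powers. *)
Lemma bpow_transS s i j :
  bpow s.+1 j i = - (\sum_a D i a *m bpow s j a) - (n%:R - 1) *: bpow s j i
    - bpow s i j + (i == j)%:R *: \sum_a bpow s a a.
Proof.
rewrite bpowSr.
have E a : bpow s j a *m D a i = - (D i a *m bpow s j a) -
   ((a == j)%:R *: bpow s i a - (i == j)%:R *: bpow s a a
    + bpow s j i - (i == a)%:R *: bpow s j a).
  have := bpow_comm s a i j a; rewrite eqxx scale1r => <-.
  by rewrite (Danti a i) mulNmx opprK opprB addrC subrK.
under eq_bigr do rewrite E.
rewrite !(big_split, sumrN) /=.
under [X in - (X + _ + _ + _)]eq_bigr => a _ do rewrite eq_sym.
rewrite !sum_delta -scaler_sumr sumr_const card_ord -[bpow s j i *+ n]scaler_nat.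
set P := \sum_c _; set Q := \sum_c _.
by apply/matrixP => x y; rewrite !mxE; ring.
Qed.

Local Arguments bpow : simpl never.
Variable c : F.
Hypothesis Dcas : \sum_i \sum_j D i j *m D j i = c%:M.
Local Notation N := (n%:R : F).

Lemma bpow_tr1 : \sum_a bpow 1 a a = 0.
Proof.
apply: big1 => a _; rewrite bpow1.
have /eqP := Danti a a; rewrite -addr_eq0 -mulr2n -scaler_nat scaler_eq0.
by rewrite pnatr_eq0 /= => /eqP.
Qed.

Lemma bpow_tr2 : \sum_a bpow 2 a a = c%:M.
Proof.
rewrite -Dcas; apply: eq_bigr => i _; apply: eq_bigr => j _.
by rewrite -/(bpow 1 j i) bpow1.
Qed.

Lemma bpow_mulD s i j : \sum_a D i a *m bpow s a j = bpow s.+1 i j.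
Proof. by []. Qed.

Lemma sumD_delta i j (x : F) : \sum_a D i a *m ((a == j)%:R *: x%:M) = x *: D i j.
Proof.
rewrite (bigD1 j) //= eqxx scale1r mul_mx_scalar big1 ?addr0 // => a /negPf ->.
by rewrite scale0r mulmx0.
Qed.

Lemma bpow_trans2 i j : bpow 2 j i = bpow 2 i j + (N - 2) *: bpow 1 i j.
Proof.
rewrite bpow_transS bpow_tr1 scaler0 addr0 -[bpow 2 i j]bpow_mulD.
under eq_bigr => a _ do rewrite bpow1 (Danti a j) mulmxN.
under [in RHS]eq_bigr => a _ do rewrite bpow1.
rewrite sumrN opprK !bpow1 (Danti i j).
set P := \sum_a _.
by apply/matrixP => x y; rewrite !mxE; ring.
Qed.

Lemma bpow_trans3 i j : bpow 3 j i = - bpow 3 i j - (2 * N - 2) *: bpow 2 i j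
   - ((N - 1) * (N - 2)) *: bpow 1 i j + (i == j)%:R *: c%:M.
Proof.
rewrite bpow_transS bpow_tr2.
under eq_bigr => a _ do rewrite (bpow_trans2 a j) mulmxDr -scalemxAr.
rewrite big_split /= -scaler_sumr !bpow_mulD (bpow_trans2 i j).
move: (bpow 1 i j) (bpow 2 i j) (bpow 3 i j) => X1 X2 X3.
by apply/matrixP => x y; rewrite !mxE; ring.
Qed.

(** On the diagonal, [bpow_trans3] contains the block trace on both sides with opposite signs, which
    determines twice the trace. *)
Lemma bpow_tr3 : \sum_a bpow 3 a a = ((1 - N / 2) * c)%:M.
Proof.
set t := \sum_a _.
have E : t = - t - (2 * N - 2) *: c%:M + N *: c%:M.
  rewrite {1}/t; under eq_bigr => a _ do rewrite bpow_trans3 eqxx scale1r.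
  rewrite !(big_split, sumrN) /= -!scaler_sumr.
  rewrite bpow_tr1 bpow_tr2 scaler0 subr0 sumr_const card_ord.
  by rewrite [in RHS]scaler_nat.
apply/matrixP => x y; have := congr1 (fun A : 'M[F]_d => A x y) E.
rewrite !mxE; move: (t x y) => z; case: (x == y); rewrite ?mulr1n ?mulr0n => Hz.
  apply: (mulfI (x := 2)); first by rewrite pnatr_eq0.
  transitivity (z + (- z - (2 * N - 2) * c + N * c)); first by rewrite -Hz; ring.
  by field.
apply: (mulfI (x := 2)); first by rewrite pnatr_eq0.
transitivity (z + (- z - (2 * N - 2) * 0 + N * 0)); first by rewrite -Hz; ring.
by ring.
Qed.

Lemma bpow_trans4 i j : bpow 4 j i = bpow 4 i j + (3 * N - 4) *: bpow 3 i j
   + ((N - 1) * (3 * N - 4)) *: bpow 2 i j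
   + ((N - 1) ^+ 2 * (N - 2) - c) *: bpow 1 i j
   - ((3 * N / 2 - 2) * c) *: ((i == j)%:R *: 1%:M).
Proof.
rewrite bpow_transS bpow_tr3.
under eq_bigr => a _ do
  rewrite (bpow_trans3 a j) mulmxDr !mulmxBr mulmxN -!scalemxAr.
rewrite !(big_split, sumrN) /= -!scaler_sumr !bpow_mulD.
have -> : \sum_a (a == j)%:R *: (D i a *m c%:M) = c *: bpow 1 i j.
  rewrite bpow1 -sumD_delta; apply: eq_bigr => a _; by rewrite scalemxAr.
rewrite (bpow_trans3 i j).
have -> : ((1 - N / 2) * c)%:M = ((1 - N / 2) * c) *: 1%:M :> 'M[F]_d by rewrite scalemx1.
have -> : c%:M = c *: 1%:M :> 'M[F]_d by rewrite scalemx1.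
move: (1%:M : 'M[F]_d) (bpow 1 i j) (bpow 2 i j) (bpow 3 i j) (bpow 4 i j) => I1 X1 X2 X3 X4.
by apply/matrixP => x y; rewrite !mxE; field.
Qed.

(** An even power keeps its leading sign under transposition, so a monic quartic relation stays
    monic; an odd power changes sign, so [e1] and [e3] reappear with the opposite sign. *)
Lemma bpow_quartic_trans (e1 e2 e3 e4 : F) i j :
  bpow 4 j i + - e1 *: bpow 3 j i + e2 *: bpow 2 j i + - e3 *: bpow 1 j i
    + e4 *: bpow 0 j i = 0 ->
  bpow 4 i j + (3 * N - 4 + e1) *: bpow 3 i j
    + ((N - 1) * (3 * N - 4) + e1 * (2 * N - 2) + e2) *: bpow 2 i j
    + ((N - 1) ^+ 2 * (N - 2) - c + e1 * (N - 1) * (N - 2) + e2 * (N - 2) + e3) *: bpow 1 i j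
    + (- (3 * N / 2 - 2) * c - e1 * c + e4) *: bpow 0 i j = 0.
Proof.
move=> <-; rewrite (bpow_trans4 i j) (bpow_trans3 i j) (bpow_trans2 i j).
rewrite !bpow1 (Danti i j) /bpow (eq_sym j i) -/(bpow 2 i j) -/(bpow 3 i j) -/(bpow 4 i j).
rewrite -[c%:M]scalemx1 -[(i == j)%:R%:M]scalemx1.
move: (bpow 4 i j) (bpow 3 i j) (bpow 2 i j) (1%:M : 'M[F]_d) => X4 X3 X2 X0.
by apply/matrixP => x y; rewrite !mxE; field.
Qed.

End BlockPowers.
Arguments bpow : simpl never.

(** * The real inner product and the diagonalization of $B$ *)

Section RealComplex.
Variable R : realType.

Lemma realCD (x y : R) : (x + y)%:C = x%:C + y%:C. Proof. exact: rmorphD. Qed.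
Lemma realCB (x y : R) : (x - y)%:C = x%:C - y%:C. Proof. exact: rmorphB. Qed.
Lemma realCN (x : R) : (- x)%:C = - x%:C. Proof. exact: rmorphN. Qed.
Lemma realCM (x y : R) : (x * y)%:C = x%:C * y%:C. Proof. exact: rmorphM. Qed.
Lemma realCX (x : R) k : (x ^+ k)%:C = x%:C ^+ k. Proof. exact: rmorphXn. Qed.
Lemma realCV (x : R) : (x^-1)%:C = x%:C^-1. Proof. exact: fmorphV. Qed.
Lemma realC_nat k : (k%:R : R)%:C = k%:R. Proof. exact: rmorph_nat. Qed.
Lemma realC1 : (1 : R)%:C = 1. Proof. exact: rmorph1. Qed.
Lemma realC0 : (0 : R)%:C = 0. Proof. exact: rmorph0. Qed.
Definition realCE := (realCD, realCB, realCN, realCM, realCX, realCV, realC_nat, realC1, realC0).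

End RealComplex.

Section Rdot.
Variable R : realType.
Local Notation C := R[i].
Variables m n : nat.
Implicit Types S T U : 'M[C]_(m, n).

Lemma rdotC S T : rdot S T = rdot T S.
Proof.
by apply: eq_bigr => i _; apply: eq_bigr => j _; rewrite mulrC [in X in _ + X]mulrC.
Qed.

Lemma rdotDl S T U : rdot (S + T) U = rdot S U + rdot T U.
Proof.
rewrite -big_split; apply: eq_bigr => i _; rewrite -big_split; apply: eq_bigr => j _ /=.
by rewrite mxE; case: (S i j) (T i j) => a b [x y] /=; ring.
Qed.

Lemma rdotZC (c : C) S T : rdot (c *: S) T = rdot S (c^* *: T).
Proof.
apply: eq_bigr => i _; apply: eq_bigr => j _ /=; rewrite !mxE.
by case: c (S i j) (T i j) => a b [x y] [z t] /=; ring.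
Qed.

Lemma rdotZl (a : R) S T : rdot (a%:C *: S) T = a * rdot S T.
Proof.
rewrite /rdot mulr_sumr; apply: eq_bigr => i _; rewrite mulr_sumr.
apply: eq_bigr => j _; rewrite !mxE.
by case: (S i j) (T i j) => x y [z t] /=; ring.
Qed.

Lemma rdotDr S T U : rdot U (S + T) = rdot U S + rdot U T.
Proof. by rewrite rdotC rdotDl !(rdotC U). Qed.

Lemma rdotZr (a : R) S T : rdot S (a%:C *: T) = a * rdot S T.
Proof. by rewrite rdotC rdotZl rdotC. Qed.

Lemma rdotNl S T : rdot (- S) T = - rdot S T.
Proof. by rewrite -scaleN1r -(rmorphN1 (real_complex R)) rdotZl mulN1r. Qed.

Lemma rdotNr S T : rdot T (- S) = - rdot T S.
Proof. by rewrite rdotC rdotNl rdotC. Qed.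

Lemma rdot0l T : rdot 0 T = 0.
Proof. by rewrite -(scale0r T) -(rmorph0 (real_complex R)) rdotZl mul0r. Qed.

Lemma rdot0r T : rdot T 0 = 0.
Proof. by rewrite rdotC rdot0l. Qed.

Lemma rdot_suml (I : finType) (P : pred I) (F : I -> 'M[C]_(m, n)) T :
  rdot (\sum_(i | P i) F i) T = \sum_(i | P i) rdot (F i) T.
Proof.
by elim/big_rec2: _ => [|i x S _ <-]; rewrite ?rdot0l ?rdotDl.
Qed.

Lemma rdot_sumr (I : finType) (P : pred I) (F : I -> 'M[C]_(m, n)) T :
  rdot T (\sum_(i | P i) F i) = \sum_(i | P i) rdot T (F i).
Proof. by rewrite rdotC rdot_suml; apply: eq_bigr => i _; rewrite rdotC. Qed.

Lemma rdot_ge0 T : 0 <= rdot T T.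
Proof.
by apply: sumr_ge0 => i _; apply: sumr_ge0 => j _; rewrite addr_ge0 // -expr2 sqr_ge0.
Qed.

Lemma rdot_eq0 T : (rdot T T == 0) = (T == 0).
Proof.
apply/eqP/eqP => [H|->]; last exact: rdot0l.
apply/matrixP => i j; rewrite mxE.
have P0 i' j' : 0 <= complex.Re (T i' j') * complex.Re (T i' j')
               + complex.Im (T i' j') * complex.Im (T i' j').
  by rewrite addr_ge0 // -expr2 sqr_ge0.
have /eqP := H; rewrite psumr_eq0 => [/allP/(_ i)|i' _]; last exact: sumr_ge0.
rewrite mem_index_enum /= => /(_ isT); rewrite psumr_eq0 // => /allP/(_ j).
rewrite mem_index_enum /= => /(_ isT).
rewrite -!expr2 paddr_eq0 ?sqr_ge0 // !sqrf_eq0 => /andP[/eqP x /eqP y].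
by apply/eqP; rewrite eq_complex /= x y !eqxx.
Qed.

Lemma rdot_gt0 T : T != 0 -> 0 < rdot T T.
Proof. by rewrite lt0r rdot_ge0 andbT rdot_eq0. Qed.

Lemma rdot_CauchySchwarz S T : rdot S T ^+ 2 <= rdot S S * rdot T T.
Proof.
have [->|T0] := eqVneq T 0; first by rewrite !rdot0r mulr0 expr0n.
have := rdot_ge0 ((rdot T T)%:C *: S - (rdot S T)%:C *: T).
rewrite !(rdotDl, rdotDr, rdotNl, rdotNr, rdotZl, rdotZr) (rdotC T S).
have := rdot_gt0 T0; move: (rdot T T) (rdot S T) (rdot S S) => t x s t0.
rewrite [X in 0 <= X](_ : _ = t * (s * t - x ^+ 2)); last by ring.
by rewrite pmulr_rge0 // subr_ge0.
Qed.

Lemma rdotiS T : rdot ('i *: T) T = 0.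
Proof.
apply: big1 => i _; apply: big1 => j _; rewrite mxE.
by case: (T i j) => x y /=; ring.
Qed.

(** The real product forgets the imaginary part of the Hermitian product; testing against $iT$
    recovers it. Reality of eigenvalues is proved this way. *)
Lemma rdotZ_i (c : C) T : rdot (c *: T) ('i *: T) = complex.Im c * rdot T T.
Proof.
rewrite /rdot mulr_sumr; apply: eq_bigr => i _; rewrite mulr_sumr; apply: eq_bigr => j _.
by rewrite !mxE; case: c (T i j) => a b [x y] /=; ring.
Qed.

Lemma rdot_col S T : rdot S T = \sum_j rdot (col j S) (col j T).
Proof.
rewrite /rdot exchange_big; apply: eq_bigr => j _; apply: eq_bigr => i _.
by rewrite big_ord1 !mxE.
Qed.

End Rdot.

Section StableEigenvector.
Variable F : numClosedFieldType.

(** In a basis of the stable subspace, [A] becomes a square matrix of size $\mathrm{rank}\,V>0$,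
    which has an eigenvector over a closed field. *)
Lemma stable_eigenvector (N : nat) (V A : 'M[F]_N) : V != 0 ->
  (V *m A <= V)%MS ->
  exists2 v : 'rV[F]_N, v != 0 /\ (v <= V)%MS & exists a, v *m A = a *: v.
Proof.
move=> V0 VA; have rV : (0 < \rank V)%N by rewrite lt0n mxrank_eq0.
have WV := eq_row_base V; have fW := row_base_free V.
move: (\rank V) rV (row_base V) WV fW => r r0 W WV fW.
have WA : (W *m A <= W)%MS by rewrite WV (submx_trans _ VA) // submxMr // WV.
have [a /eigenvalueP[u uf u0]] := eigenvalue_closed (W *m A *m pinvmx W) r0.
exists (u *m W); last first.
  by exists a; rewrite scalemxAl -uf -[in RHS](mulmxA u) (mulmxKpV WA) mulmxA.
split; last by rewrite (submx_trans (submxMl _ _)) // WV.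
apply: contra u0 => /eqP E; apply/eqP/(row_free_inj fW).
by rewrite E mul0mx.
Qed.
End StableEigenvector.

Section ConformalOperator.
Variables (R : realType) (n d : nat) (dl : 'M[R]_n -> 'M[R[i]]_d).
Local Notation C := R[i].
Local Notation B := (conf_op dl).
Implicit Types S T U : 'M[C]_(d, n).

Definition basis_rep (i j : 'I_n) : 'M[C]_d :=
  dl (wedge (basis_vec R i) (basis_vec R j)).
Local Notation D := basis_rep.

Lemma col_tens (a : 'cV[R]_n) (v : 'cV[C]_d) i : col i (tens a v) = (a i 0)%:C *: v.
Proof.
by apply/colP => x; rewrite !mxE big_ord1 !mxE mulrC.
Qed.

Lemma col_conf_op T i : col i (B T) = \sum_j D i j *m col j T.
Proof.
rewrite /conf_op linear_sum /= (bigD1 i) //= [X in _ + X]big1 ?addr0 => [|k ki].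
  rewrite linear_sum; apply: eq_bigr => j _ /=.
  by rewrite col_tens mxE !eqxx scale1r.
rewrite linear_sum big1 // => j _; rewrite /= col_tens mxE eqxx andbT.
by rewrite eq_sym (negPf ki) scale0r.
Qed.

Opaque conf_op.

Lemma col_eqP S T : (forall i, col i S = col i T) -> S = T.
Proof.
by move=> H; apply/matrixP => x i; have := congr1 (fun v : 'cV_d => v x 0) (H i); rewrite !mxE.
Qed.

Lemma conf_op_linear : linear B.
Proof.
move=> a S T; apply: col_eqP => i; rewrite linearP /= !col_conf_op scaler_sumr -big_split.
by apply: eq_bigr => j _ /=; rewrite linearP mulmxDr /= -scalemxAr.
Qed.

HB.instance Definition _ := GRing.isLinear.Build C 'M[C]_(d, n) 'M[C]_(d, n) _ B conf_op_linear.

Lemma conf_opD S T : B (S + T) = B S + B T.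
Proof. exact: linearD. Qed.

Lemma conf_opN S : B (- S) = - B S.
Proof. exact: linearN. Qed.

Lemma conf_opB S T : B (S - T) = B S - B T.
Proof. exact: linearB. Qed.

Lemma conf_opZ a S : B (a *: S) = a *: B S.
Proof. exact: linearZ. Qed.

Lemma col_iter_conf_op s T i : col i (iter s B T) = \sum_j bpow D s i j *m col j T.
Proof.
elim: s i => [|s IHs] i.
  rewrite /bpow (bigD1 i) //= eqxx mul1mx big1 ?addr0 // => j.
  by rewrite eq_sym => /negPf ->; rewrite raddf0 mul0mx.
rewrite iterS col_conf_op; under eq_bigr do rewrite IHs mulmx_sumr.
rewrite exchange_big; apply: eq_bigr => j _ /=; rewrite mulmx_suml.
by apply: eq_bigr => a _; rewrite mulmxA.
Qed.

Hypothesis Danti : forall i j, D j i = - D i j.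
Hypothesis Dskew : forall i j (u v : 'cV[C]_d), rdot (D i j *m u) v = - rdot u (D i j *m v).
Hypothesis Dcomm : forall i j k l,
  D i j *m D k l - D k l *m D i j =
  (i == k)%:R *: D j l - (j == k)%:R *: D i l
  + (i == l)%:R *: D k j - (j == l)%:R *: D k i.
Variable c : R.
Hypothesis Dcas : \sum_i \sum_j D i j *m D j i = (c%:C)%:M.

(** Two signs cancel: [D i j] is skew for the inner product and antisymmetric in its indices. *)
Lemma conf_op_sym S T : rdot (B S) T = rdot S (B T).
Proof.
rewrite !rdot_col.
under eq_bigr do rewrite col_conf_op rdot_suml.
under [RHS]eq_bigr do rewrite col_conf_op rdot_sumr.
rewrite exchange_big; apply: eq_bigr => i _; apply: eq_bigr => j _ /=.
by rewrite Dskew (Danti i j) mulNmx rdotNr opprK.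
Qed.

(** Being complex linear and symmetric, $B$ makes $\langle BT,iT\rangle$ equal to its opposite. This
    matters because [conformal_weights] lists real eigenvalues only. *)
Lemma eigen_real (a : C) T : T != 0 -> B T = a *: T -> complex.Im a = 0.
Proof.
move=> T0 E.
have H : rdot (B T) ('i *: T) = 0.
  have: rdot (B T) ('i *: T) = - rdot (B T) ('i *: T).
    rewrite {1}conf_op_sym conf_opZ rdotC rdotZC -rdotNr; congr rdot; rewrite -scaleNr; congr (_ *: _).
    by apply/eqP; rewrite eq_complex /= oppr0 !eqxx.
  by lra.
move: H; rewrite E rdotZ_i => /eqP; rewrite mulf_eq0 rdot_eq0 (negPf T0) orbF.
by move/eqP.
Qed.

Lemma eigen_ortho w w' S T : w != w' -> conf_eigen dl w S -> conf_eigen dl w' T ->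
  rdot S T = 0.
Proof.
rewrite /conf_eigen => ww' ES ET; have := conf_op_sym S T; rewrite ES ET rdotZl rdotZr => /eqP.
by rewrite -subr_eq0 -mulrBl mulf_eq0 subr_eq0 (negPf ww') => /eqP.
Qed.

Lemma eigenD w S T : conf_eigen dl w S -> conf_eigen dl w T -> conf_eigen dl w (S + T).
Proof. by rewrite /conf_eigen conf_opD => -> ->; rewrite scalerDr. Qed.

Lemma eigenN w S : conf_eigen dl w S -> conf_eigen dl w (- S).
Proof. by rewrite /conf_eigen conf_opN => ->; rewrite scalerN. Qed.

Fixpoint eigen_prod (ws : seq R) T :=
  if ws is w :: ws' then B (eigen_prod ws' T) - w%:C *: eigen_prod ws' T else T.

Lemma eigen_prod_sym ws S T : rdot (eigen_prod ws S) T = rdot S (eigen_prod ws T).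
Proof.
elim: ws S T => //= w ws IHs S T.
have comm U : B (eigen_prod ws U) - w%:C *: eigen_prod ws U =
              eigen_prod ws (B U - w%:C *: U).
  elim: ws {IHs} U => //= w' ws IHw U.
  rewrite -IHw !(conf_opB, conf_opZ) !scalerBr !scalerA.
  move: (eigen_prod ws U) (B (eigen_prod ws U)) (B (B (eigen_prod ws U))) (w%:C) (w'%:C) => X Y Z s t.
  by apply/matrixP => x y; rewrite !mxE; ring.
rewrite comm IHs rdotDl rdotNl rdotZl conf_op_sym.
by rewrite rdotDr rdotNr rdotZr.
Qed.

Lemma eigen_prodE ws w T : conf_eigen dl w T ->
  eigen_prod ws T = (\prod_(x <- ws) (w - x))%:C *: T.
Proof.
rewrite /conf_eigen => ET; elim: ws => [|x ws' IH]; first by rewrite big_nil scale1r.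
rewrite /= IH big_cons conf_opZ ET !scalerA -scalerBl; congr (_ *: _).
by rewrite !(rmorphM, rmorphB) /=; ring.
Qed.

Lemma eigen_prod_eq0 ws w T : w \in ws -> conf_eigen dl w T -> eigen_prod ws T = 0.
Proof.
move=> wws /eigen_prodE ->; rewrite (_ : \prod_(x <- ws) (w - x) = 0) ?scale0r //.
by apply/eqP; rewrite prodf_seq_eq0; apply/hasP; exists w; rewrite // subrr eqxx.
Qed.

Lemma eigen_prodB ws S T : eigen_prod ws (S - T) = eigen_prod ws S - eigen_prod ws T.
Proof.
elim: ws => //= w ws ->; rewrite conf_opB scalerBr /= !opprD !opprK.
by rewrite -!addrA; congr (_ + _); rewrite addrCA.
Qed.

(** As in Lagrange interpolation, the component at the head [w] is the product over the tail applied
    to [T], divided by $\prod_x(w-x)$; subtracting it leaves a vector killed by the tail. *)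
Lemma eigen_decomposition ws T : uniq ws -> eigen_prod ws T = 0 ->
  exists2 f : R -> 'M[C]_(d, n), (forall w, w \in ws -> conf_eigen dl w (f w))
    & T = \sum_(w <- ws) f w.
Proof.
elim: ws T => [|w ws IHws] T /=; first by exists (fun=> 0); rewrite ?big_nil.
case/andP=> wws uws /eqP; rewrite subr_eq0 => /eqP EU.
set U := eigen_prod ws T in EU.
pose a := \prod_(x <- ws) (w - x).
have a0 : a != 0.
  rewrite /a prodf_seq_neq0; apply/allP => x xws /=; rewrite subr_eq0.
  by apply: contraNneq wws => ->.
have EaU : conf_eigen dl w ((a^-1)%:C *: U).
  by rewrite /conf_eigen conf_opZ EU !scalerA mulrC.
have [|f Ef Tf] := IHws (T - (a^-1)%:C *: U) uws.
  rewrite eigen_prodB (eigen_prodE ws EaU) scalerA -rmorphM /= mulfV //.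
  by rewrite scale1r subrr.
exists (fun x => if x == w then (a^-1)%:C *: U else f x) => [x|].
  by rewrite inE; have [->|_] := eqVneq x w; [move=> _; exact: EaU|exact: Ef].
rewrite big_cons eqxx (_ : \sum_(x <- ws) _ = \sum_(x <- ws) f x); last first.
  by apply: eq_big_seq => x xws; rewrite ifN //; apply: contraNneq wws => <-.
by rewrite -Tf [RHS]addrC subrK.
Qed.

(** Were the product $P$ nonzero, its image would be $B$-stable and contain an eigenvector $Y=Pu$.
    Its eigenvalue is real, hence listed, so $PY=0$ and $|Y|^2=\langle u,PY\rangle=0$. *)
Lemma eigen_prod0 ws T :
  (forall w S, S != 0 -> conf_eigen dl w S -> w \in ws) -> eigen_prod ws T = 0.
Proof.
move=> H; pose A := lin_mx B.
pose P := foldr (fun w P => P *m (A - (w%:C)%:M)) 1%:M ws.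
have PE S : mxvec (eigen_prod ws S) = mxvec S *m P.
  rewrite /P; elim: ws {H P} => [|w ws IH] /=; first by rewrite mulmx1.
  by rewrite mulmxA -IH mulmxBr mul_vec_lin mul_mx_scalar linearB linearZ.
have PA : P *m A = A *m P.
  rewrite /P; elim: ws {H P PE} => [|w ws IH] /=; first by rewrite mulmx1 mul1mx.
  rewrite mulmxA -IH -!mulmxA; congr (_ *m _).
  by rewrite mulmxBl mulmxBr scalar_mxC.
have [P0|P0] := eqVneq P 0.
  by apply: (can_inj mxvecK); rewrite PE P0 mulmx0 linear0.
have [|v [v0 /submxP[u uP]] [a va]] := @stable_eigenvector _ _ P A P0.
  by rewrite PA submxMl.
pose Y := eigen_prod ws (vec_mx u).
have YE : mxvec Y = v by rewrite PE vec_mxK uP.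
have Y0 : Y != 0 by rewrite -(inj_eq (can_inj mxvecK)) YE linear0.
have BY : B Y = a *: Y.
  by apply: (can_inj mxvecK); rewrite -mul_vec_lin YE linearZ /= YE.
have Ea : a = (complex.Re a)%:C by rewrite [LHS]complexE (eigen_real Y0 BY) mulr0 addr0.
have CY : conf_eigen dl (complex.Re a) Y by rewrite /conf_eigen BY -Ea.
have := rdot_gt0 Y0; rewrite {1}/Y eigen_prod_sym (eigen_prod_eq0 (H _ _ Y0 CY) CY).
by rewrite rdot0r ltxx.
Qed.

End ConformalOperator.

(** Four distinct roots exceed the degree. It is applied to the difference of two monic quartics
    that share the four weights as roots. *)
Lemma cubic_eq0 (K : idomainType) (a b c d : K) (s : seq K) :
  uniq s -> size s = 4%N ->
  (forall x, x \in s -> a * x ^+ 3 + b * x ^+ 2 + c * x + d = 0) ->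
  [/\ a = 0, b = 0, c = 0 & d = 0].
Proof.
move=> us ss H; pose p := Poly [:: d; c; b; a].
have p0 : p = 0.
  apply: (@roots_geq_poly_eq0 _ _ s) => //.
    apply/allP => x /H Hx; rewrite /root horner_Poly /=.
    by apply/eqP; rewrite -[RHS]Hx; ring.
  by rewrite ss size_Poly.
have E i : nth 0 [:: d; c; b; a] i = 0 by rewrite -coef_Poly -/p p0 coef0.
by split; [exact: (E 3%N)|exact: (E 2%N)|exact: (E 1%N)|exact: (E 0%N)].
Qed.

Lemma quartic_expand (F : comNzRingType) d n (f : {linear 'M[F]_(d, n) -> 'M[F]_(d, n)})
    (x1 x2 x3 x4 : F) (T : 'M[F]_(d, n)) :
  let P x U := f U - x *: U in
  P x1 (P x2 (P x3 (P x4 T))) =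
  iter 4 f T + - (x1 + x2 + x3 + x4) *: iter 3 f T
  + (x1 * x2 + x1 * x3 + x1 * x4 + x2 * x3 + x2 * x4 + x3 * x4) *: iter 2 f T
  + - (x1 * x2 * x3 + x1 * x2 * x4 + x1 * x3 * x4 + x2 * x3 * x4) *: iter 1 f T
  + (x1 * x2 * x3 * x4) *: iter 0 f T.
Proof.
rewrite /= !(linearB, linearZ) /=.
move: (f (f (f (f T)))) (f (f (f T))) (f (f T)) (f T) => X4 X3 X2 X1.
by apply/matrixP => i j; rewrite !mxE; ring.
Qed.

Lemma col_comb5 (F : comNzRingType) d n (a b c e : F) (X4 X3 X2 X1 X0 : 'M[F]_(d, n)) i :
  col i (X4 + a *: X3 + b *: X2 + c *: X1 + e *: X0) =
  col i X4 + a *: col i X3 + b *: col i X2 + c *: col i X1 + e *: col i X0.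
Proof. by apply/colP => x; rewrite !mxE. Qed.

Lemma mul_comb5 (F : comNzRingType) d n q (a b c e : F) (X4 X3 X2 X1 X0 : 'M[F]_(d, n))
    (v : 'M[F]_(n, q)) :
  (X4 + a *: X3 + b *: X2 + c *: X1 + e *: X0) *m v =
  X4 *m v + a *: (X3 *m v) + b *: (X2 *m v) + c *: (X1 *m v) + e *: (X0 *m v).
Proof. by rewrite !mulmxDl -!scalemxAl. Qed.

Lemma sum_comb5 (F : comNzRingType) d n (a b c e : F) (X4 X3 X2 X1 X0 : 'I_n -> 'M[F]_d)
    (v : 'I_n -> 'cV[F]_d) :
  \sum_j X4 j *m v j + a *: (\sum_j X3 j *m v j) + b *: (\sum_j X2 j *m v j)
  + c *: (\sum_j X1 j *m v j) + e *: (\sum_j X0 j *m v j) =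
  \sum_j (X4 j + a *: X3 j + b *: X2 j + c *: X1 j + e *: X0 j) *m v j.
Proof.
rewrite !scaler_sumr -!big_split; apply: eq_bigr => j _.
by rewrite mul_comb5.
Qed.

Lemma scale_comb5 (F : comNzRingType) d n (a b c e x4 x3 x2 x1 x0 : F) (S : 'M[F]_(d, n)) :
  x4 *: S + a *: (x3 *: S) + b *: (x2 *: S) + c *: (x1 *: S) + e *: (x0 *: S) =
  (x4 + a * x3 + b * x2 + c * x1 + e * x0) *: S.
Proof. by rewrite !scalerA -!scalerDl. Qed.

Lemma mulmx_cV_eq0 (F : comNzRingType) p q (X : 'M[F]_(p, q)) :
  (forall v : 'cV_q, X *m v = 0) -> X = 0.
Proof.
move=> H; apply/matrixP => i j; have /colP/(_ i) := H (delta_mx j 0).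
by rewrite -colE !mxE.
Qed.

(** * Moments of a decomposable tensor and relations between the weights *)

Section FourWeights.
Variables (R : realType) (n d : nat) (dl : 'M[R]_n -> 'M[R[i]]_d).
Local Notation C := R[i].
Local Notation B := (conf_op dl).
Local Notation D := (basis_rep dl).
Implicit Types S T U : 'M[C]_(d, n).

Hypothesis Danti : forall i j, D j i = - D i j.
Hypothesis Dskew : forall i j (u v : 'cV[C]_d), rdot (D i j *m u) v = - rdot u (D i j *m v).
Hypothesis Dcomm : forall i j k l,
  D i j *m D k l - D k l *m D i j =
  (i == k)%:R *: D j l - (j == k)%:R *: D i l
  + (i == l)%:R *: D k j - (j == l)%:R *: D k i.
Variable c : R.
Hypothesis Dcas : \sum_i \sum_j D i j *m D j i = (c%:C)%:M.

(** Two candidates for the choice made by [xget] differ by an eigenvector orthogonal to itself, so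
    the projection is any vector with the two defining properties. *)
Lemma conf_projE w S T : conf_eigen dl w S ->
  (forall U, conf_eigen dl w U -> rdot (T - S) U = 0) -> conf_proj dl w T = S.
Proof.
move=> ES HS; rewrite /conf_proj; apply: xget_unique => // S' [ES' HS'].
apply/eqP; rewrite -subr_eq0 -rdot_eq0.
have EU : conf_eigen dl w (S' - S) by apply: eigenD => //; apply: eigenN.
rewrite {1}(_ : S' - S = (T - S) - (T - S')).
  by rewrite rdotDl rdotNl (HS _ EU) (HS' _ EU) subrr.
by apply/matrixP => x y; rewrite !mxE; ring.
Qed.

Lemma rdot_iter_tens s (a : 'cV[R]_n) (v : 'cV[C]_d) :
  rdot (iter s B (tens a v)) (tens a v) =
  \sum_i \sum_j a i 0 * a j 0 * rdot (bpow D s i j *m v) v.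
Proof.
rewrite rdot_col; apply: eq_bigr => i _; rewrite col_iter_conf_op rdot_suml.
apply: eq_bigr => j _; rewrite !col_tens -scalemxAr rdotZl rdotZr; ring.
Qed.

Lemma sum_transpose (a : 'cV[R]_n) (f : 'I_n -> 'I_n -> R) :
  2 * (\sum_i \sum_j a i 0 * a j 0 * f i j) =
  \sum_i \sum_j a i 0 * a j 0 * (f i j + f j i).
Proof.
rewrite mulr_natl mulr2n {2}exchange_big -big_split; apply: eq_bigr => i _.
by rewrite -big_split; apply: eq_bigr => j _ /=; ring.
Qed.

Lemma moment1 (a : 'cV[R]_n) (v : 'cV[C]_d) : rdot (B (tens a v)) (tens a v) = 0.
Proof.
rewrite -[B _]/(iter 1 B _) rdot_iter_tens.
apply: (mulfI (x := 2)); rewrite ?pnatr_eq0 // mulr0 sum_transpose.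
apply: big1 => i _; apply: big1 => j _.
by rewrite !bpow1 (Danti i j) mulNmx rdotNl subrr mulr0.
Qed.

(** Against the symmetric coefficients $\alpha_i\alpha_j$ only the sum of a block and its transpose
    counts, and [bpow_trans3] gives that sum for $B^3$; its first-order term dies by [moment1]. *)
Lemma moment3 (a : 'cV[R]_n) (v : 'cV[C]_d) :
  rdot (iter 3 B (tens a v)) (tens a v) =
  - (n%:R - 1) * rdot (iter 2 B (tens a v)) (tens a v)
  + c / 2 * rdot (tens a v) (tens a v).
Proof.
have := moment1 a v; rewrite -[B _]/(iter 1 B _) => M1.
apply: (mulfI (x := 2)); rewrite ?pnatr_eq0 //.
have E0 : rdot (tens a v) (tens a v) =
    \sum_i \sum_j a i 0 * a j 0 * ((i == j)%:R * rdot v v).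
  rewrite rdot_col; apply: eq_bigr => i _.
  rewrite (bigD1 i) //= eqxx big1 ?addr0 => [|j]; last first.
    by rewrite eq_sym => /negPf ->; rewrite mul0r mulr0.
  by rewrite !col_tens rdotZl rdotZr mul1r mulrA.
rewrite {1}rdot_iter_tens sum_transpose.
transitivity (- (2 * n%:R - 2) * rdot (iter 2 B (tens a v)) (tens a v)
  - ((n%:R - 1) * (n%:R - 2)) * rdot (iter 1 B (tens a v)) (tens a v)
  + c * rdot (tens a v) (tens a v)); last first.
  by rewrite M1; field.
rewrite !rdot_iter_tens E0 !mulr_sumr -!(sumrN, big_split) /=; apply: eq_bigr => i _.
rewrite !mulr_sumr -!(sumrN, big_split) /=; apply: eq_bigr => j _.
rewrite (bpow_trans3 (D := D) Danti Dcomm Dcas i j).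
have nC (k : nat) : k%:R = (k%:R)%:C :> C by rewrite rmorph_nat.
rewrite !(mulmxDl, mulNmx, rdotDl, rdotNl) -!scalemxAl mul_scalar_mx.
rewrite (_ : (2 * n%:R - 2 : C) = (2 * n%:R - 2 : R)%:C); last first.
  by rewrite !(rmorphM, rmorphB, rmorph_nat).
rewrite (_ : ((n%:R - 1) * (n%:R - 2) : C) = ((n%:R - 1) * (n%:R - 2) : R)%:C); last first.
  by rewrite !(rmorphM, rmorphB, rmorph_nat, rmorph1).
rewrite nC !rdotZl.
move: (rdot (bpow D 3 i j *m v) v) (rdot (bpow D 2 i j *m v) v) (rdot (bpow D 1 i j *m v) v)
  (rdot v v) => x3 x2 x1 x0; ring.
Qed.

Variables w1 w2 w3 w4 : R.
Hypothesis hN : conformal_weights dl [:: w1; w2; w3; w4].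
Local Notation e1 := (w1 + w2 + w3 + w4).
Local Notation e2 := (w1*w2 + w1*w3 + w1*w4 + w2*w3 + w2*w4 + w3*w4).
Local Notation e3 := (w1*w2*w3 + w1*w2*w4 + w1*w3*w4 + w2*w3*w4).
Local Notation e4 := (w1*w2*w3*w4).

Lemma eigen_prod_weights T : eigen_prod dl [:: w1; w2; w3; w4] T = 0.
Proof.
apply: (eigen_prod0 Danti Dskew) => w S S0 ES; case: hN => _ hw.
by apply/hw; exists S.
Qed.

Lemma quartic_eq0 T : iter 4 B T + (- e1)%:C *: iter 3 B T + e2%:C *: iter 2 B T
  + (- e3)%:C *: iter 1 B T + e4%:C *: iter 0 B T = 0.
Proof.
rewrite !realCE -(quartic_expand (conf_op dl : {linear _ -> _})).
exact: eigen_prod_weights.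
Qed.

Lemma weights_uniq : uniq [:: w1; w2; w3; w4].
Proof.
by apply: (sorted_uniq (leT := >%O)) => //; [exact: rev_trans lt_trans|exact: ltxx|case: hN].
Qed.

Lemma col_iter_basis s i j (v : 'cV[C]_d) :
  col i (iter s B (tens (basis_vec R j) v)) = bpow D s i j *m v.
Proof.
rewrite col_iter_conf_op (bigD1 j) //= big1 ?addr0 => [|k kj]; rewrite col_tens mxE.
  by rewrite !eqxx scale1r.
by rewrite (negPf kj) scale0r mulmx0.
Qed.

Lemma bpow_quartic i j : bpow D 4 i j + (- e1)%:C *: bpow D 3 i j + e2%:C *: bpow D 2 i j
  + (- e3)%:C *: bpow D 1 i j + e4%:C *: bpow D 0 i j = 0.
Proof.
apply: mulmx_cV_eq0 => v; rewrite mul_comb5 -!col_iter_basis -col_comb5.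
by rewrite quartic_eq0 linear0.
Qed.

Lemma weight_relations : e1 = 2 - 3 * n%:R / 2 /\
  2 * e3 = c + (n%:R - 2) * (n%:R - 1) * (n%:R / 2 - 1) - (n%:R - 2) * e2.
Proof.
(* [a3], ..., [a0] are the coefficients of the transposed quartic given by [bpow_quartic_trans]. *)
pose N := n%:R : R.
pose a3 := 3 * N - 4 + e1.
pose a2 := (N - 1) * (3 * N - 4) + e1 * (2 * N - 2) + e2.
pose a1 := (N - 1) ^+ 2 * (N - 2) - c + e1 * (N - 1) * (N - 2) + e2 * (N - 2) + e3.
pose a0 := - (3 * N / 2 - 2) * c - e1 * c + e4.
have Q i j : bpow D 4 i j + a3%:C *: bpow D 3 i j + a2%:C *: bpow D 2 i j
    + a1%:C *: bpow D 1 i j + a0%:C *: bpow D 0 i j = 0.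
  have := bpow_quartic j i; rewrite !(realCN e1, realCN e3).
  move/(bpow_quartic_trans Danti Dcomm Dcas).
  by rewrite /a3 /a2 /a1 /a0 /N !realCE.
have H T : iter 4 B T + a3%:C *: iter 3 B T + a2%:C *: iter 2 B T
    + a1%:C *: iter 1 B T + a0%:C *: iter 0 B T = 0.
  apply: col_eqP => i; rewrite col_comb5 linear0.
  have gen (it : nat -> 'cV[C]_d) : (forall s, it s = \sum_j bpow D s i j *m col j T) ->
      it 4%N + a3%:C *: it 3%N + a2%:C *: it 2%N + a1%:C *: it 1%N + a0%:C *: it 0%N = 0.
    by move=> E; rewrite !E sum_comb5 big1 // => j _; rewrite Q mul0mx.
  exact: (gen (fun s => col i (iter s B T)) (fun s => col_iter_conf_op _ s T i)).
(* Both quartics vanish at each weight; the leading terms cancel in the difference, leaving a cubic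
   with four distinct roots. *)
have Hw w : w \in [:: w1; w2; w3; w4] ->
    (a3 + e1) * w ^+ 3 + (a2 - e2) * w ^+ 2 + (a1 + e3) * w + (a0 - e4) = 0.
  move=> wN; have [S S0 ES] := (hN.2 w).1 wN.
  have I s : iter s B S = (w ^+ s)%:C *: S.
    elim: s => [|s IH]; first by rewrite expr0 scale1r.
    by rewrite iterS IH conf_opZ ES scalerA -rmorphM -exprSr.
  have toR (x : R) : x%:C *: S = 0 -> x = 0.
    by move=> /eqP; rewrite scaler_eq0 (negPf S0) orbF => /eqP/(@complexI R).
  have gen (it : nat -> 'M[C]_(d, n)) b3 b2 b1 b0 :
      (forall s, it s = (w ^+ s)%:C *: S) ->
      it 4%N + b3%:C *: it 3%N + b2%:C *: it 2%N + b1%:C *: it 1%N + b0%:C *: it 0%N = 0 ->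
      w ^+ 4 + b3 * w ^+ 3 + b2 * w ^+ 2 + b1 * w ^+ 1 + b0 * w ^+ 0 = 0.
    by move=> E Eit; apply: toR; rewrite -Eit !E scale_comb5 !realCE.
  have H1 := gen (fun s => iter s B S) _ _ _ _ I (H S).
  have H2 := gen (fun s => iter s B S) _ _ _ _ I (quartic_eq0 S).
  rewrite -[RHS](subrr 0) -{1}H1 -H2; ring.
have [|A3 A2 A1 A0] := cubic_eq0 weights_uniq _ Hw => //.
have e1E : e1 = 2 - 3 * n%:R / 2 by move: A3; rewrite /a3 /N; lra.
split=> //; have -> : 2 * e3 = - (a1 - e3) + (a1 + e3) by ring.
by rewrite A1 addr0 /a1 e1E /N; field.
Qed.

End FourWeights.

Lemma sum_step (V : nmodType) (m p : nat) (x y : V) : (p <= m)%N ->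
  \sum_(a < m) (if (a < p)%N then x else y) = x *+ p + y *+ (m - p).
Proof.
move=> pm; rewrite -(big_mkord predT (fun a => if (a < p)%N then x else y)).
rewrite (@big_cat_nat _ _ _ p) //=; congr (_ + _).
  rewrite (eq_big_nat _ _ (F2 := fun=> x)) => [|i /andP[_ ->] //].
  by rewrite sumr_const_nat subn0.
rewrite (eq_big_nat _ _ (F2 := fun=> y)) => [|i /andP[pi _]]; first by rewrite sumr_const_nat.
by rewrite ltnNge pi.
Qed.

Lemma sum_affine (F : comNzRingType) (V : lmodType F) m p (k q : F) (X : nat -> V) (S Y : V) :
  (p <= m)%N ->
  \sum_(a < m | (a < p)%N) (k *: X a - S + q *: Y) =
  k *: (\sum_(a < m | (a < p)%N) X a) - p%:R *: S + (p%:R * q) *: Y.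
Proof.
move=> pm; have sc (Z : V) : \sum_(a < m | (a < p)%N) Z = Z *+ p.
  by rewrite big_mkcond sum_step ?mul0rn ?addr0.
by rewrite !big_split sumrN -scaler_sumr !sc -scalerA !scaler_nat.
Qed.

(** The identity concluding [conf_eigen_l], with [S] for [lowered_sum], [Y] for $v\otimes f_p$ and
    [q] for $p$. *)
Lemma lowered_combination (F : numFieldType) d n (k l q : F) (S Y : 'M[F]_(d, n)) :
  2^-1 *: (k *: S - q *: S + (q * (2 * (k - l))) *: Y) + (l - k) *: (2^-1 *: S + l *: Y) =
  (l - q) *: (2^-1 *: S + (l - k) *: Y).
Proof. by apply/matrixP => i j; rewrite !mxE; field. Qed.

(** * Eigenvectors built on the highest weight vector *)

Section Wedge.
Variables (R : realType) (n d : nat) (dl : 'M[R]_n -> 'M[R[i]]_d).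
Local Notation C := R[i].
Local Notation B := (conf_op dl).
Local Notation D := (basis_rep dl).
Local Notation W := (dl_wedge dl).
Implicit Types (x y z w : 'cV[C]_n) (u v : 'cV[C]_d).

Definition bform x y : C := \sum_i x i 0 * y i 0.

(** Multiplication by [y] contracts the $\mathbb R^n$ factor, so $B(v\otimes x)$ can be read off in
    any frame from the operators [W]. *)
Lemma conf_op_tens v x y : B (v *m x^T) *m y = W y x *m v.
Proof.
apply/colP => k; rewrite mxE /dl_wedge mulmx_suml summxE; apply: eq_bigr => i _.
have -> : B (v *m x^T) k i = col i (B (v *m x^T)) k 0 by rewrite mxE.
rewrite col_conf_op mulmx_suml !summxE mulr_suml; apply: eq_bigr => j _.
have -> : col j (v *m x^T) = x j 0 *: v.
  by apply/colP => t; rewrite !mxE big_ord1 !mxE mulrC.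
rewrite -scalemxAr -scalemxAl [LHS]mulrC !mxE.
by rewrite mulrA.
Qed.

Section Resolution.
Variables (m : nat) (f fb : nat -> 'cV[C]_n) (e : 'cV[C]_n).
Hypothesis resol : \sum_(a < m) 2^-1 *: (f a *m (fb a)^T + fb a *m (f a)^T) + e *m e^T = 1%:M.

Lemma resolution (V : lmodType C) (g : 'I_n -> 'I_n -> V) :
  \sum_i g i i = \sum_(a < m) 2^-1 *:
      (\sum_i \sum_j (f a i 0 * fb a j 0) *: g i j + \sum_i \sum_j (fb a i 0 * f a j 0) *: g i j)
    + \sum_i \sum_j (e i 0 * e j 0) *: g i j.
Proof.
transitivity (\sum_i \sum_j ((1%:M : 'M[C]_n) i j) *: g i j).
  apply: eq_bigr => i _; rewrite (bigD1 i) //= mxE eqxx scale1r big1 ?addr0 // => j.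
  by rewrite mxE eq_sym => /negPf ->; rewrite scale0r.
rewrite -resol.
transitivity (\sum_i \sum_j (\sum_(a < m) (2^-1 * (f a i 0 * fb a j 0 + fb a i 0 * f a j 0))
   + e i 0 * e j 0) *: g i j).
  apply: eq_bigr => i _; apply: eq_bigr => j _; congr (_ *: _).
  rewrite mxE summxE; congr (_ + _); last by rewrite mxE big_ord1 mxE.
  by apply: eq_bigr => a _; rewrite !mxE !big_ord1 !mxE.
under eq_bigr => i _ do under eq_bigr => j _ do rewrite scalerDl scaler_suml.
under eq_bigr => i _ do rewrite big_split /= exchange_big.
rewrite big_split /= exchange_big; congr (_ + _); apply: eq_bigr => a _.
rewrite -big_split scaler_sumr; apply: eq_bigr => i _.
rewrite -big_split scaler_sumr; apply: eq_bigr => j _ /=.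
by rewrite -scalerDl scalerA.
Qed.

End Resolution.

Hypothesis Danti : forall i j, D j i = - D i j.
Hypothesis Dskew : forall i j (u v : 'cV[C]_d), rdot (D i j *m u) v = - rdot u (D i j *m v).
Hypothesis Dcomm : forall i j k l,
  D i j *m D k l - D k l *m D i j =
  (i == k)%:R *: D j l - (j == k)%:R *: D i l
  + (i == l)%:R *: D k j - (j == l)%:R *: D k i.

Lemma W_anti x y : W y x = - W x y.
Proof.
rewrite /dl_wedge exchange_big -sumrN; apply: eq_bigr => i _.
rewrite -sumrN; apply: eq_bigr => j _.
by rewrite -[dl (wedge _ _)]/(D j i) Danti scalerN mulrC.
Qed.

Lemma W_skew x y u v :
  rdot (W x y *m u) v = - rdot u (W (map_mx conjc x) (map_mx conjc y) *m v).
Proof.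
rewrite /dl_wedge !mulmx_suml rdot_suml rdot_sumr -sumrN; apply: eq_bigr => i _.
rewrite !mulmx_suml rdot_suml rdot_sumr -sumrN; apply: eq_bigr => j _.
by rewrite -!scalemxAl rdotZC Dskew -scalemxAr !mxE rmorphM.
Qed.

Lemma bform_collapse x y (V : lmodType C) (g : V) :
  \sum_i \sum_k (x i 0 * y k 0) *: ((i == k)%:R *: g) = bform x y *: g.
Proof.
rewrite /bform scaler_suml; apply: eq_bigr => i _.
rewrite (bigD1 i) //= eqxx scale1r big1 ?addr0 // => k.
by rewrite eq_sym => /negPf ->; rewrite scale0r scaler0.
Qed.

Lemma W_comm x y z w : W x y *m W z w - W z w *m W x y =
  bform x z *: W y w - bform y z *: W x w + bform x w *: W z y - bform y w *: W z x.
Proof.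
(* [Q] extends a family of blocks multilinearly in the four vectors, which reduces the identity to
   [Dcomm] on basis vectors. *)
pose Q (g : 'I_n -> 'I_n -> 'I_n -> 'I_n -> 'M[C]_d) :=
  \sum_i \sum_j \sum_k \sum_l (x i 0 * y j 0 * (z k 0 * w l 0)) *: g i j k l.
have QD g h : Q (fun i j k l => g i j k l + h i j k l) = Q g + Q h.
  rewrite /Q -big_split; apply: eq_bigr => i _; rewrite -big_split; apply: eq_bigr => j _.
  rewrite -big_split; apply: eq_bigr => k _; rewrite -big_split; apply: eq_bigr => l _.
  by rewrite scalerDr.
have QN g : Q (fun i j k l => - g i j k l) = - Q g.
  rewrite /Q -sumrN; apply: eq_bigr => i _; rewrite -sumrN; apply: eq_bigr => j _.
  rewrite -sumrN; apply: eq_bigr => k _; rewrite -sumrN; apply: eq_bigr => l _.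
  by rewrite scalerN.
transitivity (Q (fun i j k l => D i j *m D k l - D k l *m D i j)).
  rewrite QD QN; congr (_ - _); rewrite /dl_wedge /Q.
    rewrite mulmx_suml; apply: eq_bigr => i _; rewrite mulmx_suml; apply: eq_bigr => j _.
    rewrite mulmx_sumr; apply: eq_bigr => k _; rewrite mulmx_sumr; apply: eq_bigr => l _.
    by rewrite -scalemxAl -scalemxAr scalerA.
  rewrite mulmx_sumr; apply: eq_bigr => i _; rewrite mulmx_sumr; apply: eq_bigr => j _.
  rewrite mulmx_suml; apply: eq_bigr => k _; rewrite mulmx_suml; apply: eq_bigr => l _.
  by rewrite -scalemxAl -scalemxAr scalerA mulrC.
transitivity (Q (fun i j k l => (i == k)%:R *: D j l - (j == k)%:R *: D i l
  + (i == l)%:R *: D k j - (j == l)%:R *: D k i)).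
  apply: eq_bigr => i _; apply: eq_bigr => j _; apply: eq_bigr => k _; apply: eq_bigr => l _.
  by rewrite Dcomm.
rewrite !QD !QN; congr (_ - _ + _ - _); rewrite /Q /dl_wedge.
- rewrite exchange_big scaler_sumr; apply: eq_bigr => j _ /=.
  under eq_bigr do rewrite exchange_big; rewrite exchange_big scaler_sumr /=.
  apply: eq_bigr => l _; rewrite -bform_collapse; apply: eq_bigr => i _; apply: eq_bigr => k _.
  by rewrite -[dl _]/(D j l) !scalerA; congr (_ *: _); ring.
- rewrite scaler_sumr; apply: eq_bigr => i _ /=.
  under eq_bigr do rewrite exchange_big; rewrite exchange_big scaler_sumr /=.
  apply: eq_bigr => l _; rewrite -bform_collapse; apply: eq_bigr => j _; apply: eq_bigr => k _.
  by rewrite -[dl _]/(D i l) !scalerA; congr (_ *: _); ring.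
- under eq_bigr do rewrite exchange_big; rewrite exchange_big scaler_sumr /=.
  apply: eq_bigr => k _; rewrite exchange_big scaler_sumr /=; apply: eq_bigr => j _.
  rewrite -bform_collapse; apply: eq_bigr => i _; apply: eq_bigr => l _.
  by rewrite -[dl _]/(D k j) !scalerA; congr (_ *: _); ring.
- under eq_bigr do rewrite exchange_big; rewrite exchange_big scaler_sumr /=.
  apply: eq_bigr => k _; rewrite scaler_sumr /=; apply: eq_bigr => i _.
  rewrite -bform_collapse; apply: eq_bigr => j _; apply: eq_bigr => l _.
  by rewrite -[dl _]/(D k i) !scalerA; congr (_ *: _); ring.
Qed.

(** Extends the blocks of $B^2$ bilinearly, as [dl_wedge] extends those of $B$. *)
Definition W2 x y := \sum_i \sum_j (x i 0 * y j 0) *: bpow D 2 i j.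

Lemma W2_trans x y : W2 y x = W2 x y + (n%:R - 2) *: W x y.
Proof.
rewrite /W2 exchange_big /dl_wedge scaler_sumr -big_split; apply: eq_bigr => i _.
rewrite scaler_sumr -big_split; apply: eq_bigr => j _ /=.
rewrite (bpow_trans2 Danti Dcomm) bpow1 scalerDr !scalerA [y j 0 * _]mulrC.
by rewrite [_ * (n%:R - 2)]mulrC.
Qed.

(* [f a], [fb a] are the conjugate isotropic vectors of the [a]-th coordinate
   plane (exchanged in the last plane when the last weight is [-l]); [e] is the
   remaining basis vector if [n] is odd and 0 if [n] is even, [o = odd n]. *)
Section HighestWeight.
Variables (m p : nat) (f fb : nat -> 'cV[C]_n) (e : 'cV[C]_n) (o : bool) (k l c : R).
Hypothesis resol : \sum_(a < m) 2^-1 *: (f a *m (fb a)^T + fb a *m (f a)^T) + e *m e^T = 1%:M.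
Hypothesis fK : forall a, (a < m)%N -> map_mx conjc (f a) = fb a.
Hypothesis fbK : forall a, (a < m)%N -> map_mx conjc (fb a) = f a.
Hypothesis bff : forall a b, (a < m)%N -> (b < m)%N -> bform (f a) (f b) = 0.
Hypothesis bfbfb : forall a b, (a < m)%N -> (b < m)%N -> bform (fb a) (fb b) = 0.
Hypothesis bffb : forall a b, (a < m)%N -> (b < m)%N -> bform (f a) (fb b) = 2 * (a == b)%:R.
Hypothesis bfe : forall a, (a < m)%N -> bform (f a) e = 0.
Hypothesis bfbe : forall a, (a < m)%N -> bform (fb a) e = 0.
Hypothesis bee : bform e e = o%:R.
Variable v : 'cV[C]_d.
Hypothesis v0 : v != 0.
Let mu a := if (a < p)%N then k else l.
Hypothesis pm : (0 < p < m)%N.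
Hypothesis kl : l < k.
Hypothesis Wdiag : forall a, (a < m)%N -> W (fb a) (f a) *m v = (2 * mu a)%:C *: v.
Hypothesis Wraise : forall a b, (a < b)%N -> (b < m)%N ->
  W (f a) (fb b) *m v = 0 /\ W (f a) (f b) *m v = 0.
Hypothesis Wraise_e : forall a, (a < m)%N -> W (f a) e *m v = 0.

Lemma bformC x y : bform x y = bform y x.
Proof. by apply: eq_bigr => i _; rewrite mulrC. Qed.

Lemma W_xx x : W x x = 0.
Proof.
have /eqP := W_anti x x; rewrite -addr_eq0 -mulr2n -scaler_nat scaler_eq0.
by rewrite pnatr_eq0 /= => /eqP.
Qed.

Lemma Wff a b : (a < m)%N -> (b < m)%N -> W (f a) (f b) *m v = 0.
Proof.
move=> am bm; case: (ltngtP a b) => [ab|ba|->].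
- by have [] := Wraise ab bm.
- by rewrite W_anti mulNmx; have [_ ->] := Wraise ba am; rewrite oppr0.
- by rewrite W_xx mul0mx.
Qed.

Lemma Wfbf_gt a b : (b < a)%N -> (a < m)%N -> W (fb a) (f b) *m v = 0.
Proof.
by move=> ba am; rewrite W_anti mulNmx; have [-> _] := Wraise ba am; rewrite oppr0.
Qed.

Lemma Wef a : (a < m)%N -> W e (f a) *m v = 0.
Proof. by move=> am; rewrite W_anti mulNmx Wraise_e ?oppr0. Qed.

Lemma Wcomm_v x y z w : W x y *m (W z w *m v) = W z w *m (W x y *m v) +
  (bform x z *: (W y w *m v) - bform y z *: (W x w *m v)
   + bform x w *: (W z y *m v) - bform y w *: (W z x *m v)).
Proof.
rewrite !scalemxAl -!mulNmx -!mulmxDl -W_comm mulmxBl !mulmxA.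
by rewrite addrC subrK.
Qed.

(* A lowering operator along a root orthogonal to the weight kills [v]: its
   image has norm 0, by the commutation relation with its adjoint. *)
Lemma Wfbf_lt a b : (a < b)%N -> (b < p)%N -> W (fb a) (f b) *m v = 0.
Proof.
move=> ab bp; have bm : (b < m)%N by case/andP: pm => _; exact: ltn_trans.
have am := ltn_trans ab bm; have ap := ltn_trans ab bp.
apply/eqP; rewrite -rdot_eq0 W_skew !(fK, fbK) // Wcomm_v.
have [-> _] := Wraise ab bm; rewrite mulmx0 add0r.
rewrite bffb // eqxx bfbfb // bff // [bform (fb b) _]bformC bffb // eqxx !mulr1.
rewrite !scale0r Wdiag // addr0 subr0 Wdiag // /mu ap bp subrr rdot0r oppr0.
by [].
Qed.

(** The inner summation index of $B^2$ runs over the isotropic frame instead of the orthonormal one,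
    which exposes raising operators acting first on $v$. *)
Lemma W2_resol x y : W2 x y =
  \sum_(a < m) 2^-1 *: (W x (f a) *m W (fb a) y + W x (fb a) *m W (f a) y)
  + W x e *m W e y.
Proof.
pose g i j := \sum_s \sum_t (x s 0 * y t 0) *: (D s i *m D j t).
have gE z w : \sum_i \sum_j (z i 0 * w j 0) *: g i j = W x z *m W w y.
  rewrite /dl_wedge mulmx_suml.
  under eq_bigr => i _ do under eq_bigr => j _ do rewrite scaler_sumr.
  under eq_bigr => i _ do rewrite exchange_big.
  rewrite exchange_big; apply: eq_bigr => s _; rewrite mulmx_suml.
  apply: eq_bigr => i _; rewrite mulmx_sumr; apply: eq_bigr => j _.
  rewrite scaler_sumr mulmx_sumr; apply: eq_bigr => t _.
  rewrite -!scalemxAl -!scalemxAr !scalerA -/(D s i) -/(D j t); congr (_ *: _); ring.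
rewrite -gE; under eq_bigr => a _ do rewrite -!gE.
rewrite -(resolution resol) /W2 /g [RHS]exchange_big; apply: eq_bigr => s _.
rewrite [RHS]exchange_big; apply: eq_bigr => t _ /=.
rewrite -scaler_sumr; congr (_ *: _); apply: eq_bigr => a _.
by rewrite -/(bpow D 1 a t) bpow1.
Qed.

Let fsum (x y : R) : \sum_(a < m) (if (a < p)%N then x else y) = x * p%:R + y * (m%:R - p%:R).
Proof.
have pm' : (p <= m)%N by case/andP: pm => _ /ltnW.
by rewrite sum_step // -natrB // !mulr_natr.
Qed.

(** In the frame sum the terms $b>a$ start with a raising operator and vanish on $v$. For $b<a$
    commuting leaves $2(\mu_b-\mu_a)$, nonzero only when $b<p\le a$, which happens for $p$ values of
    $b$. *)
Lemma W2_fbf (a : 'I_m) : W2 (fb a) (f a) *m v =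
  (if (a < p)%N then 2 * k ^+ 2 else 2 * l ^+ 2 + 2 * p%:R * (k - l))%:C *: v.
Proof.
rewrite W2_resol mulmxDl -mulmxA Wef // mulmx0 addr0 mulmx_suml.
transitivity (\sum_(b < m) ((if (b < a)%N then 2 * (mu b - mu a) else 0)
   + (if b == a then 2 * mu a ^+ 2 else 0))%:C *: v).
  apply: eq_bigr => b _; rewrite -scalemxAl mulmxDl -!mulmxA Wff // mulmx0 addr0.
  case: (ltngtP b a) => [ba|ab|/val_inj ->].
  - rewrite Wcomm_v Wfbf_gt // mulmx0 add0r bfbfb // bff // bffb // [bform (fb a) _]bformC bffb //.
    rewrite !eqxx !scale0r sub0r subr0 !Wdiag // -!scaleNr !scalerA -scalerDl.
    rewrite (_ : b == a = false) ?addr0; last by apply: ltn_eqF.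
    rewrite scalerA; congr (_ *: _).
    by rewrite !(rmorphM, rmorphB, rmorph_nat) /=; field.
  - rewrite Wfbf_gt // mulmx0 scaler0 (_ : b == a = false) ?addr0 ?scale0r //.
    by apply: gtn_eqF.
  - rewrite eqxx Wdiag // -scalemxAr Wdiag // !scalerA add0r; congr (_ *: _).
    by rewrite !(rmorphM, rmorphXn, rmorph_nat) /=; field.
rewrite -scaler_suml -rmorph_sum /=; congr (_%:C *: _).
rewrite big_split /= -[X in _ + X]big_mkcond big_pred1_eq /mu.
case: ifP => ap.
  rewrite big1 ?add0r // => b _; case: ifP => // ba.
  by rewrite (ltn_trans ba ap) subrr mulr0.
rewrite addrC; congr (_ + _).
rewrite (eq_bigr (fun b : 'I_m => if (b < p)%N then 2 * (k - l) else 0)); last first.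
  move=> b _; case: ifP => ba; case: ifP => bp //; first by rewrite subrr mulr0.
  by move: ba ap bp; rewrite !ltnNge => ? ? ?; lia.
by rewrite fsum; ring.
Qed.

Lemma W2_ee : W2 e e *m v = (o%:R * (k * p%:R + l * (m%:R - p%:R)))%:C *: v.
Proof.
rewrite W2_resol mulmxDl W_xx mul0mx mul0mx addr0 mulmx_suml -fsum mulr_sumr.
rewrite rmorph_sum scaler_suml; apply: eq_bigr => b _.
rewrite -scalemxAl mulmxDl -!mulmxA Wraise_e // mulmx0 addr0 Wcomm_v.
rewrite Wef // mulmx0 add0r bformC bfbe // bffb // bee eqxx bfe // W_xx mul0mx.
rewrite !scale0r scaler0 !subr0 add0r Wdiag // !scalerA; congr (_ *: _).
by rewrite /mu !(rmorphM, rmorph_nat) /=; field.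
Qed.

Hypothesis nE : n = (m.*2 + o)%N.

(** The Casimir is the block trace of $B^2$, evaluated on $v$ in the isotropic frame; [W2_trans]
    reduces [W2 (f a) (fb a)] to [W2 (fb a) (f a)]. *)
Lemma casimir_highest : \sum_i \sum_j D i j *m D j i = (c%:C)%:M ->
  c = 2 * (p%:R * k ^+ 2 + (m%:R - p%:R) * l ^+ 2) + 2 * p%:R * (m%:R - p%:R) * (k - l)
      + (n%:R - 2 + o%:R) * (p%:R * k + (m%:R - p%:R) * l).
Proof.
move=> Dcas; have : \sum_i bpow D 2 i i *m v = c%:C *: v.
  rewrite -mulmx_suml -mul_scalar_mx -Dcas; congr (_ *m _).
  apply: eq_bigr => i _; apply: eq_bigr => j _; by rewrite -/(bpow D 1 j i) bpow1.
pose q (a : nat) := if (a < p)%N then 2 * k ^+ 2 + (n%:R - 2) * k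
   else 2 * l ^+ 2 + 2 * p%:R * (k - l) + (n%:R - 2) * l.
have E (a : 'I_m) : (2^-1 *: (W2 (f a) (fb a) + W2 (fb a) (f a))) *m v = (q a)%:C *: v.
  rewrite -scalemxAl mulmxDl (W2_trans (fb a)) mulmxDl -scalemxAl W2_fbf Wdiag //.
  rewrite !scalerA -!scalerDl scalerA; congr (_ *: _).
  have NC : n%:R = (n%:R)%:C :> C by rewrite rmorph_nat.
  rewrite NC /q /mu; case: ifP => _.
    by rewrite !(rmorphM, rmorphD, rmorphB, rmorphXn, rmorph_nat) /=; field.
  by rewrite !(rmorphM, rmorphD, rmorphB, rmorphXn, rmorph_nat) /=; field.
rewrite -mulmx_suml (resolution resol) -/(W2 e e) mulmxDl W2_ee mulmx_suml.
rewrite (eq_bigr _ (fun a _ => E a)) -scaler_suml -rmorph_sum -scalerDl -rmorphD => /eqP.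
rewrite -subr_eq0 -scalerBl scaler_eq0 (negPf v0) orbF -rmorphB => /eqP/(@complexI R)/eqP.
rewrite subr_eq0 => /eqP <- /=.
by rewrite fsum; ring.
Qed.

Lemma conf_op_resol x u : B (u *m x^T) =
  \sum_(a < m) 2^-1 *: ((W (f a) x *m u) *m (fb a)^T + (W (fb a) x *m u) *m (f a)^T)
  + (W e x *m u) *m e^T.
Proof.
rewrite -[LHS]mulmx1 -resol mulmxDr mulmx_sumr mulmxA conf_op_tens; congr (_ + _).
by apply: eq_bigr => a _; rewrite -scalemxAr mulmxDr !mulmxA !conf_op_tens.
Qed.

Lemma mul_tens_bform u x y : u *m x^T *m y = bform x y *: u.
Proof.
rewrite -mulmxA; apply/colP => t; rewrite !mxE big_ord1 mulrC !mxE; congr (_ * _).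
by apply: eq_bigr => i _; rewrite mxE.
Qed.

(** $v\otimes f_0$ is a highest weight vector of weight $\lambda+\varepsilon_1$: in the frame
    expansion of its image all terms but $a=0$ are raising operators applied to $v$. *)
Lemma conf_eigen_k : v *m (f 0)^T != 0 /\ conf_eigen dl k (v *m (f 0)^T).
Proof.
have /andP[p0 pm'] := pm; have m0 : (0 < m)%N by apply: ltn_trans pm'.
split.
  apply: contraNneq v0 => E; have := mul_tens_bform v (f 0) (fb 0).
  rewrite E mul0mx bffb // eqxx mulr1 => /eqP.
  by rewrite eq_sym scaler_eq0 pnatr_eq0.
rewrite /conf_eigen conf_op_resol Wef // mul0mx addr0.
rewrite (bigD1 (Ordinal m0)) //= big1 ?addr0 => [|a a0].
  rewrite Wff // mul0mx add0r Wdiag // /mu p0 -scalemxAl scalerA; congr (_ *: _).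
  by rewrite !(rmorphM, rmorph_nat) /=; field.
rewrite Wff // Wfbf_gt //; first by rewrite !mul0mx addr0 scaler0.
by rewrite lt0n; apply: contra a0 => /eqP a0; apply/eqP/val_inj.
Qed.

(** Applying [W (fb b) (f p)] trades one unit of weight from $b$ to $p$, so each [lowered b]
    tensored with [f b] has the same weight as $v\otimes f_p$. *)
Let lowered (b : nat) := W (fb b) (f p) *m v.
Let lowered_sum := \sum_(b < m | (b < p)%N) lowered b *m (f b)^T.

Let WfbfE (a : nat) : (a < m)%N -> W (fb a) (f p) *m v =
  if (a < p)%N then lowered a else if a == p then (2 * l)%:C *: v else 0.
Proof.
have /andP[p0 pm'] := pm; move=> am; case: (ltngtP a p) => [//|pc|->].
  by rewrite Wfbf_gt.
by rewrite Wdiag // /mu ltnn.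
Qed.

Let conf_op_p : B (v *m (f p)^T) = 2^-1 *: lowered_sum + l%:C *: (v *m (f p)^T).
Proof.
have /andP[p0 pm'] := pm.
rewrite conf_op_resol Wef // mul0mx addr0 /lowered_sum [in RHS]big_mkcond scaler_sumr.
pose op := Ordinal pm'.
have -> : l%:C *: (v *m (f p)^T) =
    \sum_(a < m) if a == op then l%:C *: (v *m (f a)^T) else 0.
  by rewrite -big_mkcond big_pred1_eq.
rewrite -big_split; apply: eq_bigr => a _ /=.
rewrite Wff // mul0mx add0r WfbfE // -val_eqE /=.
case: (ltngtP a p) => _; rewrite ?addr0 // ?mul0mx ?scaler0 // add0r.
rewrite -scalemxAl scalerA; congr (_ *: _).
by rewrite !(rmorphM, rmorph_nat) /=; field.
Qed.

Let conf_op_lowered b : (b < p)%N -> B (lowered b *m (f b)^T) =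
  k%:C *: (lowered b *m (f b)^T) - lowered_sum + (2 * (k - l))%:C *: (v *m (f p)^T).
Proof.
have /andP[p0 pm'] := pm; move=> bp; have bm := ltn_trans bp pm'.
pose op := Ordinal pm'; pose ob := Ordinal bm.
have bpF : b == p = false by apply: ltn_eqF.
have pbF : p == b = false by rewrite eq_sym.
rewrite conf_op_resol {1 2 3}/lowered Wcomm_v.
rewrite Wef // mulmx0 add0r [bform e _]bformC bfbe // bffb // eqxx [bform e _]bformC bfe // Wef // bff //.
rewrite !scale0r scaler0 !subr0 !addr0 mul0mx addr0.
have -> : k%:C *: (lowered b *m (f b)^T) =
    \sum_(a < m) if a == ob then k%:C *: (lowered a *m (f a)^T) else 0.
  by rewrite -big_mkcond big_pred1_eq.
have -> : (2 * (k - l))%:C *: (v *m (f p)^T) =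
    \sum_(a < m) if a == op then (2 * (k - l))%:C *: (v *m (f a)^T) else 0.
  by rewrite -big_mkcond big_pred1_eq.
rewrite /lowered_sum [X in _ - X + _]big_mkcond -sumrN -!big_split; apply: eq_bigr => a _ /=.
have -> : W (f a) (f b) *m (W (fb b) (f p) *m v) = 0.
  rewrite Wcomm_v Wff // mulmx0 add0r !Wff // bff // [bform (f b) (f p)]bff //.
  by rewrite !scaler0 !scale0r subr0 addr0 subr0.
rewrite mul0mx add0r Wcomm_v bfbfb // bffb // eqxx mulr1 [bform (f b) (f p)]bff //.
rewrite !scale0r sub0r subr0 [bform (fb a) _]bformC bffb // [W (fb b) (f b) *m v]Wdiag //.
rewrite /mu bp [W (fb a) (f p) *m v]WfbfE // -!val_eqE /=.
(* Below $p$ all weights equal $k$, so by [Wfbf_lt] the lowering operators ($a<b$) vanish on $v$ as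
   well as the raising ones. *)
have -> : W (fb a) (f b) *m v = if a == b :> nat then (2 * k)%:C *: v else 0.
  case: (ltngtP a b) => [ab|ba|->]; [exact: Wfbf_lt|exact: Wfbf_gt|].
  by rewrite Wdiag // /mu bp.
rewrite (eq_sym p).
case: (ltngtP a p) => [ap|pa|pa].
- case: eqP => [ab|_].
    rewrite -ab -scalemxAr -/(lowered a); move: (lowered a) => X.
    by rewrite mulr0 !scale0r !addr0; apply/matrixP => i j;
       rewrite !(mxE, big_ord1) !(rmorphM, rmorph_nat) /=; field.
  rewrite mulmx0 mulr0 scale0r addr0 !add0r addr0; move: (lowered a) => X.
  by apply/matrixP => i j; rewrite !(mxE, big_ord1); field.
- rewrite gtn_eqF; last by apply: ltn_trans pa.
  by rewrite mulmx0 mulr0 !(scale0r, scaler0, oppr0, addr0, mul0mx).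
- rewrite pa pbF mulmx0 mulr1 add0r subr0 add0r.
  by apply/matrixP => i j; rewrite !(mxE, big_ord1) !(rmorphM, rmorphB, rmorph_nat) /=; field.
Qed.

(** On $Y=v\otimes f_p$ and $S$ = [lowered_sum], $B$ acts by a $2\times2$ matrix of trace $k+l-p$
    and determinant $k(l-p)$, so its eigenvalues are $k$ and $l-p$. The witness is $(B-k)Y$, which
    is killed by $B-(l-p)$; contracting it with [fb p] leaves $2(l-k)v\ne0$. *)
Lemma conf_eigen_l : exists2 T, T != 0 & conf_eigen dl (l - p%:R) T.
Proof.
have /andP[p0 pm'] := pm.
exists (2^-1 *: lowered_sum + (l - k)%:C *: (v *m (f p)^T)).
  apply: contraNneq v0 => E.
  have : (2^-1 *: lowered_sum + (l - k)%:C *: (v *m (f p)^T)) *m fb p = 0.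
    by rewrite E mul0mx.
  rewrite mulmxDl -!scalemxAl mul_tens_bform bffb // eqxx mulr1 mulmx_suml big1; last first.
    move=> a ap; rewrite mul_tens_bform bffb // (ltn_eqF ap) mulr0 scale0r //.
  rewrite scaler0 add0r scalerA => /eqP; rewrite scaler_eq0 mulf_eq0 pnatr_eq0 orbF.
  by rewrite (fmorph_eq0 (real_complex R)) subr_eq0 lt_eqF.
have BS : B lowered_sum = k%:C *: lowered_sum - p%:R *: lowered_sum
    + (p%:R * (2 * (k - l))%:C) *: (v *m (f p)^T).
  rewrite -(sum_affine k%:C _ (fun b => lowered b *m (f b)^T) _ _ (ltnW pm')).
  rewrite /lowered_sum linear_sum; apply: eq_bigr => a ap.
  exact: conf_op_lowered.
rewrite /conf_eigen conf_opD !conf_opZ conf_op_p BS !realCE.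
exact: lowered_combination.
Qed.

End HighestWeight.
End Wedge.

(** * One-parameter subgroups of SO(n) and Spin(n) *)

Section CurveDerivatives.
Variable R : realType.
Local Notation C := R[i].
Local Notation isd f df := (is_derive (0 : R) (1 : R) (f : R -> R) (df : R)).

Lemma isd_sum (n : nat) (f : 'I_n -> R -> R) (df : 'I_n -> R) :
  (forall i, isd (f i) (df i)) -> isd (fun t => \sum_i f i t) (\sum_i df i).
Proof.
move=> H; rewrite (_ : (fun t => _) = \sum_i f i); last by rewrite fct_sumE.
exact: is_derive_sum.
Qed.

Lemma isd_scale (c : R) f df : isd f df -> isd (fun t => c * f t) (c * df).
Proof. by move=> H; apply: is_deriveZ. Qed.

Lemma isd_mul f df g dg : isd f df -> isd g dg ->
  isd (fun t => f t * g t) (df * g 0 + f 0 * dg).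
Proof.
move=> Hf Hg; apply: (is_derive_eq (is_deriveM Hf Hg)).
by rewrite /GRing.scale /=; ring.
Qed.

Lemma isd_add f df g dg : isd f df -> isd g dg -> isd (fun t => f t + g t) (df + dg).
Proof. by move=> Hf Hg; apply: is_deriveD. Qed.

Lemma isd_sub f df g dg : isd f df -> isd g dg -> isd (fun t => f t - g t) (df - dg).
Proof. by move=> Hf Hg; apply: is_deriveB. Qed.

Lemma isd_uniq f df dg : isd f df -> isd f dg -> df = dg.
Proof. by move=> Hf Hg; rewrite -(@derive_val _ _ _ _ _ _ _ Hf) (@derive_val _ _ _ _ _ _ _ Hg). Qed.

Definition complex_curve_derive (p q : nat) (c : R -> 'M[C]_(p, q)) (X : 'M[C]_(p, q)) : Prop :=
  curve_derive (fun t => map_mx (@complex.Re R) (c t)) (map_mx (@complex.Re R) X) /\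
  curve_derive (fun t => map_mx (@complex.Im R) (c t)) (map_mx (@complex.Im R) X).

Lemma complex_curve_deriveP (p q : nat) (c : R -> 'M[C]_(p, q)) (X : 'M[C]_(p, q)) :
  complex_curve_derive c X <-> forall i j,
    isd (fun t => complex.Re (c t i j)) (complex.Re (X i j)) /\
    isd (fun t => complex.Im (c t i j)) (complex.Im (X i j)).
Proof.
split=> [[H1 H2] i j|H].
  have := H1 i j; have := H2 i j; rewrite !mxE => I2 I1; split.
    by apply: (eq_ind _ (fun f => isd f _) I1); apply/funext => t; rewrite mxE.
  by apply: (eq_ind _ (fun f => isd f _) I2); apply/funext => t; rewrite mxE.
split=> i j; rewrite mxE.
  apply: (eq_ind _ (fun f => isd f _) (H i j).1); apply/funext => t; by rewrite mxE.
apply: (eq_ind _ (fun f => isd f _) (H i j).2); apply/funext => t; by rewrite mxE.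
Qed.

Lemma Re_sum n (F : 'I_n -> C) : complex.Re (\sum_i F i) = \sum_i complex.Re (F i).
Proof. by apply: (big_morph (@complex.Re R)) => // -[? ?] [? ?]. Qed.

Lemma Im_sum n (F : 'I_n -> C) : complex.Im (\sum_i F i) = \sum_i complex.Im (F i).
Proof. by apply: (big_morph (@complex.Im R)) => // -[? ?] [? ?]. Qed.

Lemma ReM (x y : C) : complex.Re (x * y) =
  complex.Re x * complex.Re y - complex.Im x * complex.Im y.
Proof. by case: x y => a b [x y]. Qed.

Lemma ImM (x y : C) : complex.Im (x * y) =
  complex.Re x * complex.Im y + complex.Im x * complex.Re y.
Proof. by case: x y => a b [x y]. Qed.

Lemma complex_curve_derive_mull (m p q : nat) (A : 'M[C]_(m, p)) c (X : 'M[C]_(p, q)) :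
  complex_curve_derive c X -> complex_curve_derive (fun t => A *m c t) (A *m X).
Proof.
move=> /complex_curve_deriveP H; apply/complex_curve_deriveP => i j; split.
  rewrite mxE Re_sum (_ : (fun t => _) = fun t => \sum_k (complex.Re (A i k) *
      complex.Re (c t k j) - complex.Im (A i k) * complex.Im (c t k j))); last first.
    by apply/funext => t; rewrite mxE Re_sum; apply: eq_bigr => k _; rewrite ReM.
  apply: isd_sum => k; rewrite ReM; apply: isd_sub; apply: isd_scale; by case: (H k j).
rewrite mxE Im_sum (_ : (fun t => _) = fun t => \sum_k (complex.Re (A i k) *
    complex.Im (c t k j) + complex.Im (A i k) * complex.Re (c t k j))); last first.
  by apply/funext => t; rewrite mxE Im_sum; apply: eq_bigr => k _; rewrite ImM.
by apply: isd_sum => k; rewrite ImM; apply: isd_add; apply: isd_scale; case: (H k j).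
Qed.

Lemma complex_curve_derive_tr (p q : nat) c (X : 'M[C]_(p, q)) :
  complex_curve_derive c X -> complex_curve_derive (fun t => (c t)^T) X^T.
Proof.
move=> /complex_curve_deriveP H; apply/complex_curve_deriveP => i j; rewrite mxE.
have [H1 H2] := H j i; split.
  by apply: (eq_ind _ (fun f => isd f _) H1); apply/funext => t; rewrite mxE.
by apply: (eq_ind _ (fun f => isd f _) H2); apply/funext => t; rewrite mxE.
Qed.

Lemma complex_curve_derive_mulr (m p q : nat) (A : 'M[C]_(q, m)) c (X : 'M[C]_(p, q)) :
  complex_curve_derive c X -> complex_curve_derive (fun t => c t *m A) (X *m A).
Proof.
move=> /complex_curve_derive_tr/(complex_curve_derive_mull A^T)/complex_curve_derive_tr.
rewrite trmx_mul !trmxK; congr complex_curve_derive; apply/funext => t.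
by rewrite trmx_mul !trmxK.
Qed.

Lemma complex_curve_derive_uniq (p q : nat) c (X Y : 'M[C]_(p, q)) :
  complex_curve_derive c X -> complex_curve_derive c Y -> X = Y.
Proof.
move=> /complex_curve_deriveP HX /complex_curve_deriveP HY; apply/matrixP => i j.
have [X1 X2] := HX i j; have [Y1 Y2] := HY i j.
by apply/eqP; rewrite eq_complex (isd_uniq X1 Y1) (isd_uniq X2 Y2) !eqxx.
Qed.

Lemma rdot_derive (p q : nat) (c c' : R -> 'M[C]_(p, q)) (X X' : 'M[C]_(p, q)) :
  complex_curve_derive c X -> complex_curve_derive c' X' ->
  isd (fun t => rdot (c t) (c' t)) (rdot X (c' 0) + rdot (c 0) X').
Proof.
move=> /complex_curve_deriveP HX /complex_curve_deriveP HX'.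
rewrite /rdot -big_split; apply: isd_sum => i.
rewrite -big_split; apply: isd_sum => j /=.
have [X1 X2] := HX i j; have [Y1 Y2] := HX' i j.
apply: (is_derive_eq (isd_add (isd_mul X1 Y1) (isd_mul X2 Y2))); ring.
Qed.

(** Degree 2 in $\cos t,\sin t$ covers both groups: the rotations are quadratic, the Clifford
    products linear. *)
Lemma curve_derive_trig (p q : nat) (K0 K1 K2 K3 K4 K5 : 'M[R]_(p, q)) :
  curve_derive (fun t => K0 + cos t *: K1 + sin t *: K2 + cos t ^+ 2 *: K3
     + (cos t * sin t) *: K4 + sin t ^+ 2 *: K5) (K2 + K4).
Proof.
move=> i j.
rewrite (_ : (fun t => _) = fun t => K0 i j + K1 i j * cos t + K2 i j * sin t +
    K3 i j * (cos t * cos t) + K4 i j * (cos t * sin t) + K5 i j * (sin t * sin t)); last first.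
  by apply/funext => t; rewrite !mxE; ring.
have c' : isd cos 0 by apply: (is_derive_eq (is_derive_cos 0)); rewrite sin0 oppr0.
have s' : isd sin 1 by apply: (is_derive_eq (is_derive_sin 0)); rewrite cos0.
have k' : isd (cst (K0 i j)) 0 by apply: is_derive_cst.
apply: (is_derive_eq (isd_add (isd_add (isd_add (isd_add (isd_add k'
  (isd_scale (K1 i j) c')) (isd_scale (K2 i j) s'))
  (isd_scale (K3 i j) (isd_mul c' c'))) (isd_scale (K4 i j) (isd_mul c' s')))
  (isd_scale (K5 i j) (isd_mul s' s')))).
by rewrite !mxE cos0 sin0; ring.
Qed.

End CurveDerivatives.

Section Reflections.
Variables (R : realType) (n : nat).
Implicit Types a b v : 'cV[R]_n.

Definition dotp a b : R := (a^T *m b) 0 0.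

Lemma dotpE a b : dotp a b = \sum_i a i 0 * b i 0.
Proof. by rewrite /dotp mxE; apply: eq_bigr => i _; rewrite mxE. Qed.

Lemma trmulE a b : a^T *m b = (dotp a b)%:M.
Proof. by apply/matrixP => i j; rewrite !ord1 [RHS]mxE. Qed.

Lemma dotpC a b : dotp a b = dotp b a.
Proof. by rewrite !dotpE; apply: eq_bigr => i _; rewrite mulrC. Qed.

Lemma dotpDr a b v : dotp v (a + b) = dotp v a + dotp v b.
Proof. by rewrite /dotp mulmxDr mxE. Qed.

Lemma dotpZr (c : R) a v : dotp v (c *: a) = c * dotp v a.
Proof. by rewrite /dotp -scalemxAr mxE. Qed.

Lemma dotpDl a b v : dotp (a + b) v = dotp a v + dotp b v.
Proof. by rewrite dotpC dotpDr !(dotpC v). Qed.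

Lemma dotpZl (c : R) a v : dotp (c *: a) v = c * dotp a v.
Proof. by rewrite dotpC dotpZr dotpC. Qed.

Lemma euclid_norm1 a : euclid_norm a = 1 <-> dotp a a = 1.
Proof.
have E : \sum_i a i 0 ^+ 2 = dotp a a by rewrite dotpE; apply: eq_bigr => i _.
rewrite /euclid_norm E; split => [H|->]; last by rewrite sqrtr1.
have a0 : 0 <= dotp a a by rewrite -E; apply: sumr_ge0 => i _; rewrite sqr_ge0.
by rewrite -(sqr_sqrtr a0) H expr1n.
Qed.

Definition refl a : 'M[R]_n := 1%:M - 2 *: (a *m a^T).

Lemma reflE a v : refl a *m v = v - (2 * dotp a v) *: a.
Proof.
by rewrite /refl mulmxBl mul1mx -scalemxAl -mulmxA trmulE mul_mx_scalar scalerA.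
Qed.

Lemma trmx_refl a : (refl a)^T = refl a.
Proof. by rewrite /refl linearB linearZ /= trmx1 trmx_mul trmxK. Qed.

Lemma refl_mul a : dotp a a = 1 -> refl a *m refl a = 1%:M.
Proof.
move=> a1; rewrite {2}/refl mulmxBr mulmx1 -scalemxAr mulmxA reflE a1.
rewrite mulr1 /refl mulmxBl -scalemxAl.
by apply/matrixP => i j; rewrite !(mxE, big_ord1); ring.
Qed.

(** Two triangular factorizations of one bordered matrix compare $\det(1-2aa^T)$ with the scalar
    $1-2|a|^2=-1$. *)
Lemma det_refl a : dotp a a = 1 -> \det (refl a) = - 1.
Proof.
move=> a1; pose b := 2 *: a.
have E1 : block_mx 1%:M b a^T 1%:M =
    block_mx 1%:M b 0 1%:M *m block_mx (refl a) 0 a^T 1%:M :> 'M[R]_(n + 1).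
  rewrite mulmx_block !mul1mx !mul0mx !mulmx1 !add0r.
  by rewrite /refl /b scalemxAl subrK.
have E2 : block_mx 1%:M b a^T 1%:M =
    block_mx 1%:M 0 a^T 1%:M *m block_mx 1%:M b 0 (-1)%:M :> 'M[R]_(n + 1).
  rewrite mulmx_block !mul1mx !mul0mx !mulmx1 !addr0 /b -scalemxAr trmulE a1.
  congr block_mx; apply/matrixP => i j; rewrite !ord1 !mxE /=; ring.
have := congr1 determinant E1; rewrite E2 !det_mulmx !det_ublock !det_lblock.
by rewrite !det1 !mul1r det_scalar1 mulr1.
Qed.

Lemma reflM_SO a b : dotp a a = 1 -> dotp b b = 1 -> SO_mem (refl a *m refl b).
Proof.
move=> a1 b1; split; last by rewrite det_mulmx !det_refl // mulrNN mulr1.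
by rewrite trmx_mul !trmx_refl mulmxA -(mulmxA (refl a)) refl_mul // mulmx1 refl_mul.
Qed.

(* [refl a *m refl (turn a b t)] is the rotation of angle [2 t] in the plane of
   the orthonormal pair [(a, b)]. *)
Definition turn a b (t : R) : 'cV[R]_n := (- cos t) *: a + sin t *: b.
Definition rot a b (t : R) : 'M[R]_n := refl a *m refl (turn a b t).

Lemma dotp_turn a b t : dotp a a = 1 -> dotp b b = 1 -> dotp a b = 0 ->
  dotp (turn a b t) (turn a b t) = 1.
Proof.
move=> a1 b1 ab; rewrite !(dotpDr, dotpDl, dotpZr, dotpZl) (dotpC b a) a1 b1 ab.
by rewrite -[RHS](cos2Dsin2 t); ring.
Qed.

(** The minus sign serves $\mathrm{Spin}(n)$: in the Clifford algebra $a(-a)=1$ whereas $aa=-1$, so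
    the lifted curve also starts at the identity. *)
Lemma turn0 a b : turn a b 0 = - a.
Proof. by rewrite /turn cos0 sin0 scale0r addr0 scaleN1r. Qed.

Lemma rot0 a b : dotp a a = 1 -> rot a b 0 = 1%:M.
Proof.
move=> a1; rewrite /rot turn0 (_ : refl (- a) = refl a) ?refl_mul //.
by rewrite /refl linearN mulNmx mulmxN opprK.
Qed.

Lemma rot_derive a b : dotp a a = 1 -> dotp b b = 1 -> dotp a b = 0 ->
  curve_derive (rot a b) (2 *: wedge a b).
Proof.
move=> a1 b1 ab.
have -> : rot a b = fun t => refl a + cos t *: 0 + sin t *: 0
    + cos t ^+ 2 *: (- 2 *: (refl a *m (a *m a^T)))
    + (cos t * sin t) *: (2 *: (refl a *m (a *m b^T + b *m a^T)))
    + sin t ^+ 2 *: (- 2 *: (refl a *m (b *m b^T))).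
  apply/funext => t; rewrite /rot [refl (turn _ _ _)]/refl.
  have -> : turn a b t *m (turn a b t)^T = cos t ^+ 2 *: (a *m a^T)
      - (cos t * sin t) *: (a *m b^T + b *m a^T) + sin t ^+ 2 *: (b *m b^T).
    by apply/matrixP => i j; rewrite !(mxE, big_ord1); ring.
  rewrite mulmxBr mulmx1 -scalemxAr !(mulmxDr, mulmxBr, mulmxN) -!scalemxAr !mulmxDr.
  move: (refl a *m (a *m a^T)) (refl a *m (a *m b^T)) (refl a *m (b *m a^T))
    (refl a *m (b *m b^T)) (refl a) => X Y Z T U.
  by apply/matrixP => i j; rewrite !mxE; ring.
have -> : 2 *: wedge a b = 0 + 2 *: (refl a *m (a *m b^T + b *m a^T)).
  rewrite add0r; congr (_ *: _); rewrite mulmxDr !mulmxA !reflE a1 ab mulr0 scale0r subr0.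
  rewrite mulr1 /wedge; apply/matrixP => i j; rewrite !(mxE, big_ord1); ring.
exact: curve_derive_trig.
Qed.

Lemma orthogonal_refl (A : 'M[R]_n) a : A^T *m A = 1%:M -> A *m refl a = refl (A *m a) *m A.
Proof.
move=> AA; rewrite /refl mulmxBr mulmxBl mulmx1 mul1mx; congr (_ - _).
by rewrite -scalemxAr -scalemxAl trmx_mul -!mulmxA AA mulmx1.
Qed.

End Reflections.

Section Clifford.
Variables (R : realType) (n : nat).
Implicit Types (i j k : 'I_n) (S : {set 'I_n}).

(** Symmetric difference with $\{i\}$: the index set of $e_ie_S$ up to sign. *)
Definition flip i S : {set 'I_n} := if i \in S then (S :\ i)%SET else (i |: S)%SET.

Lemma in_flip i k S : (k \in flip i S) = (k \in S) (+) (k == i).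
Proof.
rewrite /flip; case: ifP => iS; rewrite !inE; case: eqP => [->|_] //=; rewrite ?iS //.
  by rewrite addbF.
by rewrite addbF.
Qed.

Lemma flipC i j S : flip i (flip j S) = flip j (flip i S).
Proof. by apply/setP => k; rewrite !in_flip addbAC. Qed.

Lemma flipK i S : flip i (flip i S) = S.
Proof. by apply/setP => k; rewrite !in_flip addbK. Qed.

Definition below k S := [set j in S | (j < k)%N]%SET.

(** Parity of the exponent in [clifford_gen]: one sign for each smaller generator that $e_i$ passes,
    and one from $e_i^2=-1$ when $i\in S$. *)
Definition clifford_sign i S : bool := odd #|below i S| (+) (i \in S).

Lemma odd_below_flip i k S :
  odd #|below k (flip i S)| = odd #|below k S| (+) (i < k)%N.
Proof.
rewrite (cardsD1 i (below k (flip i S))) (cardsD1 i (below k S)) !oddD.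
have -> : (below k (flip i S) :\ i = below k S :\ i)%SET.
  by apply/setP => j; rewrite !inE in_flip; case: eqP; rewrite /= ?addbF.
rewrite !inE in_flip eqxx addbT !oddb.
by case: (i \in S); case: (i < k)%N; case: (odd _).
Qed.

Lemma clifford_sign_flip i j S : clifford_sign i (flip j S) =
  clifford_sign i S (+) (j < i)%N (+) (i == j).
Proof.
rewrite /clifford_sign odd_below_flip in_flip.
by case: (odd _); case: (i \in S); case: (j < i)%N; case: (i == j).
Qed.

Lemma clifford_genE i (a b : 'I_(clifford_dim n)) :
  clifford_gen R i a b = (enum_val a == flip i (enum_val b))%:R
    * (-1) ^+ (clifford_sign i (enum_val b)).
Proof.
rewrite mxE /= -/(flip i _) -/(below i _); case: eqP => _; rewrite ?mul0r // mul1r.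
rewrite -signr_odd oddD /clifford_sign; congr (_ ^+ _).
by case: (i \in _).
Qed.

Lemma clifford_genM i j (a b : 'I_(clifford_dim n)) :
  (clifford_gen R i *m clifford_gen R j) a b =
  (enum_val a == flip i (flip j (enum_val b)))%:R
    * (-1) ^+ (clifford_sign i (flip j (enum_val b)) (+) clifford_sign j (enum_val b)).
Proof.
rewrite mxE (bigD1 (enum_rank (flip j (enum_val b)))) //= big1 => [|c cb].
  by rewrite addr0 !clifford_genE enum_rankK eqxx mul1r signr_addb mulrA.
rewrite (clifford_genE j) (_ : enum_val c == _ = false) ?mul0r ?mulr0 //.
by apply: contraNF cb => /eqP <-; rewrite enum_valK.
Qed.

(** For $i\ne j$ both products reach the same basis vector, and their signs differ because exactly
    one of $i<j$ and $j<i$ holds. *)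
Lemma clifford_gen_anticomm i j :
  clifford_gen R i *m clifford_gen R j + clifford_gen R j *m clifford_gen R i =
  (- 2 * (i == j)%:R)%:M.
Proof.
apply/matrixP => a b; rewrite mxE !clifford_genM !clifford_sign_flip flipC.
rewrite [RHS]mxE; have [->|ij] := eqVneq i j.
  rewrite flipK ltnn (inj_eq enum_val_inj) -[- 2 * _ *+ _]mulr_natr.
  by case: (a == b); case: (clifford_sign j _) => /=; ring.
rewrite mulr0 mul0rn !addbF -mulrDr.
have -> : (j < i)%N = ~~ (i < j)%N.
  by case: (ltngtP j i) => // /val_inj E; rewrite E eqxx in ij.
case: (i < j)%N; case: (clifford_sign i _); case: (clifford_sign j _) => /=; ring.
Qed.

Lemma clifford_vec_anticomm (v w : 'cV[R]_n) :
  clifford_vec v *m clifford_vec w + clifford_vec w *m clifford_vec v = (- 2 * dotp v w)%:M.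
Proof.
have E x y : clifford_vec x *m clifford_vec y =
    \sum_i \sum_j (x i 0 * y j 0) *: (clifford_gen R i *m clifford_gen R j).
  rewrite /clifford_vec mulmx_suml; apply: eq_bigr => i _; rewrite mulmx_sumr.
  by apply: eq_bigr => j _; rewrite -scalemxAl -scalemxAr scalerA.
rewrite !E [X in _ + X]exchange_big -big_split dotpE mulr_sumr raddf_sum; apply: eq_bigr => i _.
rewrite -big_split (bigD1 i) //= big1 ?addr0 => [|j ji];
  rewrite [w _ 0 * v _ 0]mulrC -scalerDr clifford_gen_anticomm.
  by rewrite eqxx scale_scalar_mx mulr1 mulrC mulrA.
by rewrite eq_sym (negPf ji) mulr0 raddf0 scaler0.
Qed.

Lemma clifford_vecD (v w : 'cV[R]_n) : clifford_vec (v + w) = clifford_vec v + clifford_vec w.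
Proof.
by rewrite /clifford_vec -big_split; apply: eq_bigr => i _; rewrite mxE scalerDl.
Qed.

Lemma clifford_vecZ c (v : 'cV[R]_n) : clifford_vec (c *: v) = c *: clifford_vec v.
Proof.
by rewrite /clifford_vec scaler_sumr; apply: eq_bigr => i _; rewrite mxE scalerA.
Qed.

Lemma clifford_vec_sqr (a : 'cV[R]_n) : dotp a a = 1 -> clifford_vec a *m clifford_vec a = - 1%:M.
Proof.
move=> a1; apply: (scalerI (a := 2)); first by rewrite pnatr_eq0.
rewrite scaler_nat mulr2n clifford_vec_anticomm a1 mulr1.
by apply/matrixP => i j; rewrite !mxE; ring.
Qed.

(** Conjugation by a unit vector is minus the reflection; the signs cancel for a pair of vectors,
    which is what covers a rotation. *)
Lemma clifford_refl (a v : 'cV[R]_n) : dotp a a = 1 ->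
  clifford_vec a *m clifford_vec v = - (clifford_vec (refl a *m v) *m clifford_vec a).
Proof.
move=> a1; rewrite reflE clifford_vecD -scaleNr clifford_vecZ mulmxDl -scalemxAl clifford_vec_sqr //.
have -> : clifford_vec a *m clifford_vec v = (-2 * dotp a v)%:M - clifford_vec v *m clifford_vec a.
  by rewrite -(clifford_vec_anticomm a v) addrK.
by rewrite -[(_)%:M]scalemx1; apply/matrixP => i j; rewrite !mxE; ring.
Qed.

Lemma clifford_refl2 (a b v : 'cV[R]_n) : dotp a a = 1 -> dotp b b = 1 ->
  clifford_vec a *m clifford_vec b *m clifford_vec v =
  clifford_vec (refl a *m refl b *m v) *m (clifford_vec a *m clifford_vec b).
Proof.
move=> a1 b1; rewrite -mulmxA (clifford_refl v b1) mulmxN (mulmxA (clifford_vec a)) (clifford_refl _ a1).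
by rewrite mulNmx opprK !mulmxA.
Qed.

Lemma SO_memM (A B : 'M[R]_n) : SO_mem A -> SO_mem B -> SO_mem (A *m B).
Proof.
move=> [A1 A2] [B1 B2]; split; last by rewrite det_mulmx A2 B2 mulr1.
by rewrite trmx_mul mulmxA -(mulmxA A) B1 mulmx1.
Qed.

Lemma Spin_cover (g : 'M[R]_(clifford_dim n)) : Spin_mem g ->
  exists2 A : 'M[R]_n, SO_mem A & forall v, g *m clifford_vec v = clifford_vec (A *m v) *m g.
Proof.
case=> s [+ ->]; elim: s => [|[a b] s IHs] H.
  exists 1%:M => [|v]; last by rewrite /= !mul1mx mulmx1.
  by split; rewrite ?det1 // trmx1 mulmx1.
have [|A SA HA] := IHs; first by move=> q qs; apply: H; rewrite inE qs orbT.
have [/euclid_norm1 a1 /euclid_norm1 b1] := H (a, b) (mem_head _ _).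
exists (refl a *m refl b *m A) => [|v]; first by apply: SO_memM => //; apply: reflM_SO.
by rewrite /= -mulmxA HA mulmxA clifford_refl2 // !mulmxA.
Qed.

(* A family of one-parameter subgroups through the identity, indexed by the
   orthonormal pairs and permuted by conjugation. *)
Lemma group_curves (G : struct_group R n) : G = SO_group R n \/ G = Spin_group R n ->
  exists gc : 'cV[R]_n -> 'cV[R]_n -> R -> 'M[R]_(gdim G),
  (forall a b, dotp a a = 1 -> dotp b b = 1 -> dotp a b = 0 ->
    [/\ forall t, gmem (gc a b t), forall t, gcover (gc a b t) (rot a b t),
        gc a b 0 = 1%:M & exists Y, curve_derive (gc a b) Y]) /\
  forall h, gmem h -> exists2 A : 'M[R]_n, A^T *m A = 1%:M &
    forall a b t, h *m gc a b t = gc (A *m a) (A *m b) t *m h.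
Proof.
have turnA (A : 'M[R]_n) a b t : A *m turn a b t = turn (A *m a) (A *m b) t.
  by rewrite mulmxDr -!scalemxAr.
case=> ->.
  exists (@rot R n); split=> [a b a1 b1 ab|A [AA _]].
    have S t : SO_mem (rot a b t) by apply: reflM_SO => //; exact: dotp_turn.
    by split=> //; [exact: rot0|exists (2 *: wedge a b); exact: rot_derive].
  have AA' := mulmx1C AA.
  exists A => // a b t; rewrite /rot (mulmxA A) (orthogonal_refl a AA').
  by rewrite -(mulmxA _ A) (orthogonal_refl _ AA') turnA mulmxA.
exists (fun a b t => clifford_vec a *m clifford_vec (turn a b t)).
split=> [a b a1 b1 ab|g /Spin_cover[A [AA dA] HA]].
  split.
  - move=> t; exists [:: (a, turn a b t)]; split; last by rewrite /= mulmx1.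
    by move=> q; rewrite inE => /eqP -> /=; split; apply/euclid_norm1 => //; exact: dotp_turn.
  - move=> t; split; first by apply: reflM_SO => //; exact: dotp_turn.
    by move=> v; apply: clifford_refl2 => //; exact: dotp_turn.
  - by rewrite turn0 -scaleN1r clifford_vecZ -scalemxAr clifford_vec_sqr // scaleN1r opprK.
  (* The [+ 0] matches the derivative [K2 + K4] of [curve_derive_trig]. *)
  exists (clifford_vec a *m clifford_vec b + 0).
  have -> : (fun t => clifford_vec a *m clifford_vec (turn a b t)) = fun t =>
     0 + cos t *: 1%:M + sin t *: (clifford_vec a *m clifford_vec b) + cos t ^+ 2 *: 0
     + (cos t * sin t) *: 0 + sin t ^+ 2 *: 0.
    apply/funext => t; rewrite /turn clifford_vecD !clifford_vecZ mulmxDr -!scalemxAr.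
    by rewrite clifford_vec_sqr // scaleNr scalerN opprK !scaler0 !addr0 add0r.
  exact: curve_derive_trig.
have AA' := mulmx1C AA; exists A => // a b t.
by rewrite mulmxA HA -mulmxA HA turnA mulmxA.
Qed.

End Clifford.

(** * Skewness, equivariance and Casimir operator of the induced representation *)

Section WedgeAlgebra.
Variables (R : realType) (n : nat).
Implicit Types a b c d : 'cV[R]_n.

Lemma so_mem_wedge a b : so_mem (wedge a b).
Proof. by rewrite /so_mem /wedge linearB /= !trmx_mul !trmxK opprB. Qed.

Lemma so_memD (X Y : 'M[R]_n) : so_mem X -> so_mem Y -> so_mem (X + Y).
Proof. by rewrite /so_mem linearD /= opprD => -> ->. Qed.

Lemma so_memZ (x : R) (X : 'M[R]_n) : so_mem X -> so_mem (x *: X).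
Proof. by rewrite /so_mem linearZ /= => ->; rewrite scalerN. Qed.

Lemma so_mem0 : so_mem (0 : 'M[R]_n).
Proof. by rewrite /so_mem linear0 oppr0. Qed.

Lemma so_mem_sum (I : finType) (F : I -> 'M[R]_n) :
  (forall i, so_mem (F i)) -> so_mem (\sum_i F i).
Proof. by move=> H; apply: big_ind => // [|X Y]; [exact: so_mem0|exact: so_memD]. Qed.

Lemma wedgeC a b : wedge b a = - wedge a b.
Proof. by rewrite /wedge opprB. Qed.

Lemma wedge_comm a b c d : wedge a b *m wedge c d - wedge c d *m wedge a b =
  dotp a c *: wedge b d - dotp b c *: wedge a d + dotp a d *: wedge c b - dotp b d *: wedge c a.
Proof.
have M x y z w : (x *m y^T) *m (z *m w^T) = dotp y z *: (x *m w^T).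
  by rewrite mulmxA -(mulmxA x) trmulE mul_mx_scalar scalemxAl.
rewrite /wedge !(mulmxBl, mulmxBr) !M (dotpC d) (dotpC d) (dotpC c) (dotpC c).
rewrite !(dotpC b) !(dotpC a).
by apply/matrixP => i j; rewrite !(mxE, big_ord1); ring.
Qed.

Lemma dotp_basis i j : dotp (basis_vec R i) (basis_vec R j) = (i == j :> 'I_n)%:R.
Proof.
rewrite dotpE (bigD1 i) //= big1 ?addr0 => [|k ki]; rewrite !mxE eqxx ?andbT.
  by rewrite mul1r.
by rewrite (negPf ki) mul0r.
Qed.

Lemma wedge_basis a b : wedge a b =
  \sum_i \sum_j (a i 0 * b j 0) *: wedge (basis_vec R i) (basis_vec R j).
Proof.
have O (x y : 'cV[R]_n) : x *m y^T =
    \sum_i \sum_j (x i 0 * y j 0) *: (basis_vec R i *m (basis_vec R j)^T).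
  rewrite [LHS]matrix_sum_delta; apply: eq_bigr => i _; apply: eq_bigr => j _.
  by rewrite mxE big_ord1 mxE /basis_vec trmx_delta mul_delta_mx.
rewrite /wedge (O b) (O a) exchange_big -sumrB; apply: eq_bigr => i _.
rewrite -sumrB; apply: eq_bigr => j _.
by rewrite scalerBr [b j 0 * _]mulrC.
Qed.

End WedgeAlgebra.

Section RepresentationOperators.
Variables (R : realType) (n : nat) (K : rep_kind) (G : struct_group R n).
Hypothesis hG : G = SO_group R n \/ G = Spin_group R n.
Variables (d : nat) (rho : 'M[R]_(gdim G) -> 'M[R[i]]_d) (dl : 'M[R]_n -> 'M[R[i]]_d).
Hypothesis hrho : is_representation K rho dl.
Local Notation C := R[i].
Local Notation D := (basis_rep dl).

Lemma drepN X : so_mem X -> dl (- X) = - dl X.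
Proof.
by move=> sX; rewrite -scaleN1r (drepZ hrho _ sX) rmorphN rmorph1 scaleN1r.
Qed.

Lemma drep0 : dl 0 = 0.
Proof. by rewrite -(scale0r 0) (drepZ hrho _ (@so_mem0 R n)) rmorph0 scale0r. Qed.

Lemma drep_sum (I : finType) (F : I -> 'M[R]_n) :
  (forall i, so_mem (F i)) -> dl (\sum_i F i) = \sum_i dl (F i).
Proof.
move=> H; suff [] : so_mem (\sum_i F i) /\ dl (\sum_i F i) = \sum_i dl (F i) by [].
elim/big_ind2 : _ => // [|X1 Y1 X2 Y2 [S1 E1] [S2 E2]].
  by split; [exact: so_mem0|exact: drep0].
by split; [exact: so_memD|rewrite (drepD hrho S1 S2) E1 E2].
Qed.

Lemma basis_rep_anti i j : D j i = - D i j.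
Proof. by rewrite /basis_rep wedgeC drepN //; exact: so_mem_wedge. Qed.

Lemma basis_rep_comm i j k l : D i j *m D k l - D k l *m D i j =
  (i == k)%:R *: D j l - (j == k)%:R *: D i l
  + (i == l)%:R *: D k j - (j == l)%:R *: D k i.
Proof.
have S x y := @so_mem_wedge R n x y.
have SZ (x : R) y z := so_memZ x (S y z).
have SB X Y : so_mem X -> so_mem Y -> so_mem (X - Y :> 'M[R]_n).
  by move=> sX sY; rewrite -scaleN1r; apply: so_memD => //; exact: so_memZ.
have dB X Y : so_mem X -> so_mem Y -> dl (X - Y) = dl X - dl Y.
  move=> sX sY; rewrite (drepD hrho) ?drepN //.
  by rewrite -scaleN1r; exact: so_memZ.
have dE x y z t X Y Z T : so_mem X -> so_mem Y -> so_mem Z -> so_mem T ->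
    dl (x *: X - y *: Y + z *: Z - t *: T) =
    x%:C *: dl X - y%:C *: dl Y + z%:C *: dl Z - t%:C *: dl T.
  move=> sX sY sZ sT.
  have sx := so_memZ x sX; have sy := so_memZ y sY.
  have sz := so_memZ z sZ; have st := so_memZ t sT.
  have sxy := SB _ _ sx sy.
  have s3 := so_memD sxy sz.
  by rewrite (dB _ _ s3 st) (drepD hrho sxy sz) (dB _ _ sx sy) !(drepZ hrho).
rewrite /basis_rep -(drep_bracket hrho) // wedge_comm !dotp_basis dE //.
by rewrite !rmorph_nat.
Qed.

Lemma dl_wedge_real (x y : 'cV[R]_n) :
  dl_wedge dl (map_mx (real_complex R) x) (map_mx (real_complex R) y) = dl (wedge x y).
Proof.
have S a b := @so_mem_wedge R n a b.
rewrite wedge_basis drep_sum => [|i]; last first.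
  by apply: so_mem_sum => j; apply: so_memZ.
apply: eq_bigr => i _; rewrite drep_sum => [|j]; last exact: so_memZ.
by apply: eq_bigr => j _; rewrite !mxE -rmorphM (drepZ hrho).
Qed.

Lemma rep_curve_derive (gc : R -> 'M[R]_(gdim G)) (a b : 'cV[R]_n) :
  dotp a a = 1 -> dotp b b = 1 -> dotp a b = 0 ->
  [/\ forall t, gmem (gc t), forall t, gcover (gc t) (rot a b t),
        gc 0 = 1%:M & exists Y, curve_derive gc Y] ->
  complex_curve_derive (fun t => rho (gc t)) (2 *: dl (wedge a b)).
Proof.
move=> a1 b1 ab [H1 H2 H3 [Y HY]].
have -> : 2 *: dl (wedge a b) = dl (2 *: wedge a b).
  by rewrite (drepZ hrho) ?rmorph_nat //; exact: so_mem_wedge.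
exact: (rep_derive hrho H1 H2 H3 HY (rot_derive a1 b1 ab)).
Qed.

(** For $i\ne j$ this is the derivative at 0 of the constant $\langle\rho(g_t)u,\rho(g_t)v\rangle$
    along the curve of the plane $(e_i,e_j)$. *)
Lemma basis_rep_skew i j (u v : 'cV[C]_d) : rdot (D i j *m u) v = - rdot u (D i j *m v).
Proof.
have [->|ij] := eqVneq i j.
  have -> : D j j = 0.
    have /eqP := basis_rep_anti j j; rewrite -addr_eq0 -mulr2n -scaler_nat scaler_eq0.
    by rewrite pnatr_eq0 /= => /eqP.
  by rewrite !mul0mx rdot0l rdot0r oppr0.
have [gc [Hgc _]] := group_curves hG.
have e1 (k : 'I_n) : dotp (basis_vec R k) (basis_vec R k) = 1 by rewrite dotp_basis eqxx.
have e0 : dotp (basis_vec R i) (basis_vec R j) = 0 by rewrite dotp_basis (negPf ij).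
have H := Hgc _ _ (e1 i) (e1 j) e0.
have dgc := rep_curve_derive (e1 i) (e1 j) e0 H.
have := rdot_derive (complex_curve_derive_mulr u dgc) (complex_curve_derive_mulr v dgc).
case: H => H1 _ -> _; rewrite (rep1 hrho) !mul1mx.
rewrite (_ : (fun t => rdot _ _) = cst (rdot u v)); last first.
  by apply/funext => t; rewrite (rep_dot hrho).
move=> /isd_uniq/(_ (is_derive_cst _ _ _)).
have -> : 2 = (2 : R)%:C :> C by rewrite rmorph_nat.
rewrite -!scalemxAl rdotZl rdotZr -mulrDr -/(D i j) => /eqP.
by rewrite mulf_eq0 pnatr_eq0 /= addr_eq0 => /eqP.
Qed.

(** Differentiates $\rho(h)\rho(g_t)=\rho(g'_t)\rho(h)$, where $g'$ is the curve attached to the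
    image of the orthonormal pair. *)
Lemma rep_equivariant h : gmem h -> exists2 A : 'M[R]_n, A *m A^T = 1%:M &
  forall i j, rho h *m D i j = dl (wedge (col i A) (col j A)) *m rho h.
Proof.
move=> hh; have [gc [Hgc Hh]] := group_curves hG.
have [A AA HA] := Hh _ hh.
exists A => [|i j]; first exact: mulmx1C.
have [->|ij] := eqVneq i j.
  by rewrite /basis_rep /wedge !subrr drep0 mulmx0 mul0mx.
have dA x y : dotp (A *m x) (A *m y) = dotp x y.
  by rewrite /dotp trmx_mul -mulmxA (mulmxA A^T) AA mul1mx.
have e1 (k : 'I_n) : dotp (basis_vec R k) (basis_vec R k) = 1 by rewrite dotp_basis eqxx.
have e0 : dotp (basis_vec R i) (basis_vec R j) = 0 by rewrite dotp_basis (negPf ij).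
have H := Hgc _ _ (e1 i) (e1 j) e0.
have a1 (k : 'I_n) : dotp (A *m basis_vec R k) (A *m basis_vec R k) = 1 by rewrite dA.
have a0 : dotp (A *m basis_vec R i) (A *m basis_vec R j) = 0 by rewrite dA.
have H' := Hgc _ _ (a1 i) (a1 j) a0.
have L := complex_curve_derive_mull (rho h) (rep_curve_derive (e1 i) (e1 j) e0 H).
have L' := complex_curve_derive_mulr (rho h) (rep_curve_derive (a1 i) (a1 j) a0 H').
have [H1 _ _ _] := H; have [H1' _ _ _] := H'.
have E : (fun t => rho h *m rho (gc (basis_vec R i) (basis_vec R j) t)) =
    fun t => rho (gc (A *m basis_vec R i) (A *m basis_vec R j) t) *m rho h.
  by apply/funext => t; rewrite -!(repM hrho) // HA.
rewrite E in L; have := complex_curve_derive_uniq L L'.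
rewrite -scalemxAr -scalemxAl => /scalerI; rewrite !colE; apply.
by rewrite pnatr_eq0.
Qed.

Definition casimir := \sum_i \sum_j D i j *m D j i.

(** Moving $\rho(h)$ across replaces $(e_i)$ by the columns of an orthogonal [A], and the Casimir
    does not depend on the orthonormal basis. [F1] and [F2] have one index transformed, so that
    orthogonality ([orth]) is applied to one index at a time. *)
Lemma casimir_comm h : gmem h -> rho h *m casimir = casimir *m rho h.
Proof.
move=> /rep_equivariant[A AA HA].
pose E i j := dl (wedge (col i A) (col j A)).
have orth (g : 'I_n -> 'I_n -> 'M[C]_d) :
    \sum_i \sum_a \sum_b (A a i * A b i)%:C *: g a b = \sum_a g a a.
  rewrite exchange_big; apply: eq_bigr => a _; rewrite exchange_big.
  rewrite -(sum_delta a (fun b => g a b)); apply: eq_bigr => b _.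
  rewrite -scaler_suml -rmorph_sum /=; congr (_ *: _).
  have /matrixP/(_ a b) := AA; rewrite !mxE => H.
  by rewrite -[RHS](realC_nat R) -H; congr (_%:C); apply: eq_bigr => i _; rewrite mxE.
pose F1 i b := \sum_a (A a i)%:C *: D a b.
pose F2 b i := \sum_a (A a i)%:C *: D b a.
have E1 i j : E i j = \sum_b (A b j)%:C *: F1 i b.
  rewrite /E -dl_wedge_real /dl_wedge exchange_big; apply: eq_bigr => b _.
  rewrite scaler_sumr; apply: eq_bigr => a _.
  by rewrite scalerA !mxE mulrC.
have E2 i j : E j i = \sum_b (A b j)%:C *: F2 b i.
  rewrite /E -dl_wedge_real /dl_wedge; apply: eq_bigr => b _.
  by rewrite scaler_sumr; apply: eq_bigr => a _; rewrite scalerA !mxE.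
have key : \sum_i \sum_j E i j *m E j i = casimir.
  transitivity (\sum_i \sum_b F1 i b *m F2 b i).
    apply: eq_bigr => i _; rewrite -(orth (fun b c => F1 i b *m F2 c i)).
    apply: eq_bigr => j _; rewrite E1 E2 mulmx_suml; apply: eq_bigr => b _.
    rewrite mulmx_sumr; apply: eq_bigr => c _.
    by rewrite -scalemxAl -scalemxAr scalerA rmorphM.
  rewrite exchange_big /casimir [RHS]exchange_big; apply: eq_bigr => b _.
  rewrite -(orth (fun a a' => D a b *m D b a')); apply: eq_bigr => i _.
  rewrite mulmx_suml; apply: eq_bigr => a _; rewrite mulmx_sumr; apply: eq_bigr => a' _.
  by rewrite -scalemxAl -scalemxAr scalerA rmorphM.
rewrite -[in RHS]key /casimir mulmx_sumr mulmx_suml; apply: eq_bigr => i _.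
rewrite mulmx_sumr mulmx_suml; apply: eq_bigr => j _.
by rewrite mulmxA HA -mulmxA HA mulmxA.
Qed.

Hypothesis hirr : complex_irreducible rho.

(** Schur's lemma for an eigenspace of the transpose, since subspaces are encoded as row spaces in
    [complex_irreducible]. *)
Lemma casimir_scalar : exists c : R, casimir = (c%:C)%:M.
Proof.
have [d0 irr] := hirr.
have [a aE] := eigenvalue_closed casimir^T d0.
have [U [U0 UE Umax]] : exists U : 'M[C]_d, [/\ U != 0, U *m casimir^T = a *: U
    & forall W : 'M[C]_d, W *m casimir^T = a *: W -> (W <= U)%MS].
  exists (eigenspace casimir^T a); split=> //; first exact/eigenspaceP.
  by move=> W /eigenspaceP.
have /irr[UZ|] : forall g, gmem g -> (U *m (rho g)^T <= U)%MS.
- move=> g gG; apply: Umax.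
  by rewrite -mulmxA -trmx_mul -casimir_comm // trmx_mul mulmxA UE scalemxAl.
- by rewrite UZ eqxx in U0.
rewrite row_full_unit => Uu.
have Ca : casimir = a%:M.
  apply: trmx_inj; rewrite tr_scalar_mx -[LHS](mulKmx Uu) UE -scalemxAr mulVmx //.
  by rewrite scalemx1.
exists (complex.Re a); rewrite Ca; congr (_ %:M).
rewrite [LHS]complexE; suff -> : complex.Im a = 0 by rewrite mulr0 addr0.
(* Any nonzero vector tests the scalar: by skewness each term of $\langle\mathrm{Cas}\,u,iu\rangle$
   becomes $\langle D_{ij}u,iD_{ij}u\rangle=0$. *)
pose u : 'cV[C]_d := const_mx 1.
have u0 : u != 0.
  by apply/eqP => /colP/(_ (Ordinal d0)); rewrite !mxE => /eqP; rewrite oner_eq0.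
have /eqP : complex.Im a * rdot u u = 0.
  rewrite -rdotZ_i -mul_scalar_mx -Ca /casimir mulmx_suml rdot_suml.
  apply: big1 => i _; rewrite mulmx_suml rdot_suml; apply: big1 => j _.
  rewrite -mulmxA basis_rep_skew -scalemxAr (basis_rep_anti j i) mulNmx.
  by rewrite scalerN rdotNr opprK rdotC rdotiS.
by rewrite mulf_eq0 rdot_eq0 (negPf u0) orbF => /eqP.
Qed.

End RepresentationOperators.

(** * The isotropic frame adapted to the highest weight *)

Lemma sum_pairs (V : nmodType) (m : nat) (F : nat -> V) :
  \sum_(0 <= j < m.*2) F j = \sum_(0 <= a < m) (F a.*2 + F a.*2.+1).
Proof.
elim: m => [|m IHm]; first by rewrite !big_nil.
by rewrite doubleS !big_nat_recr //= IHm addrA.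
Qed.

Lemma isotropic_outer (F : numFieldType) n (s : F) (x y : 'cV[F]_n) : s * s = -1 ->
  2^-1 *: ((x + - s *: y) *m (x + s *: y)^T + (x + s *: y) *m (x + - s *: y)^T)
  = x *m x^T + y *m y^T.
Proof.
move=> ss; apply/matrixP => i j; rewrite !(mxE, big_ord1).
transitivity (x i 0 * x j 0 - (s * s) * (y i 0 * y j 0)); first by field.
by rewrite ss; ring.
Qed.

Section WeightVectors.
Variables (R : realType) (n : nat).
Local Notation C := R[i].
Implicit Types (x y z : 'cV[C]_n).

Definition cvec (a : nat) : 'cV[C]_n := map_mx (real_complex R) (nat_vec R n a).

Lemma cvecE a (i : 'I_n) : cvec a i 0 = (val i == a)%:R.
Proof. by rewrite !mxE rmorph_nat. Qed.

Lemma bformDl x y z : bform (x + y) z = bform x z + bform y z.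
Proof. by rewrite /bform -big_split; apply: eq_bigr => i _; rewrite mxE mulrDl. Qed.

Lemma bformZl (c : C) x y : bform (c *: x) y = c * bform x y.
Proof. by rewrite /bform mulr_sumr; apply: eq_bigr => i _; rewrite mxE mulrA. Qed.

Lemma bformDr x y z : bform z (x + y) = bform z x + bform z y.
Proof. by rewrite /bform -big_split; apply: eq_bigr => i _; rewrite mxE mulrDr. Qed.

Lemma bformZr (c : C) x y : bform x (c *: y) = c * bform x y.
Proof. by rewrite /bform mulr_sumr; apply: eq_bigr => i _; rewrite mxE mulrCA. Qed.

Lemma bform_cvec a b : (a < n)%N -> bform (cvec a) (cvec b) = (a == b)%:R.
Proof.
move=> an; rewrite /bform (bigD1 (Ordinal an)) //= big1 ?addr0 => [|i ia].
  by rewrite !cvecE eqxx mul1r.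
by rewrite !cvecE (_ : val i == a = false) ?mul0r // -(negPf ia) -val_eqE.
Qed.

Lemma zvecE a : zvec R n a = cvec a.*2 + - 'i%C *: cvec a.*2.+1.
Proof. by rewrite scaleNr. Qed.

Lemma zbarE a : zbar R n a = cvec a.*2 + 'i%C *: cvec a.*2.+1.
Proof. by []. Qed.

Lemma conj_cvec a : map_mx conjc (cvec a) = cvec a.
Proof. by apply/colP => i; rewrite mxE cvecE conjc_nat. Qed.

Lemma conj_comb (s : C) x y :
  map_mx conjc (x + s *: y) = map_mx conjc x + s^* *: map_mx conjc y.
Proof. by apply/colP => i; rewrite !mxE rmorphD rmorphM. Qed.

Lemma conj_zvec a : map_mx conjc (zvec R n a) = zbar R n a.
Proof.
rewrite zvecE zbarE conj_comb !conj_cvec; congr (_ + _ *: _).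
by apply/eqP; rewrite eq_complex /= opprK oppr0 !eqxx.
Qed.

Lemma conj_zbar a : map_mx conjc (zbar R n a) = zvec R n a.
Proof.
apply/colP => i; rewrite -conj_zvec !mxE.
exact: conjcK.
Qed.

Lemma bform_z a b (s t : C) : (a.*2.+1 < n)%N ->
  bform (cvec a.*2 + s *: cvec a.*2.+1) (cvec b.*2 + t *: cvec b.*2.+1)
  = (1 + s * t) * (a == b)%:R.
Proof.
move=> an; have an' := ltnW an.
rewrite !(bformDl, bformDr, bformZl, bformZr) !bform_cvec // eqSS !(inj_eq double_inj).
have -> : (a.*2 == b.*2.+1) = false by apply/eqP; lia.
have -> : (a.*2.+1 == b.*2) = false by apply/eqP; lia.
by rewrite !mulr0n; move: (a == b)%:R => z; ring.
Qed.

Lemma sum_cvec : \sum_(0 <= j < n) cvec j *m (cvec j)^T = 1%:M.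
Proof.
rewrite big_mkord; apply/matrixP => x y; rewrite summxE [RHS]mxE.
rewrite (bigD1 x) //= big1 ?addr0 => [|j jx]; rewrite mxE big_ord1 [_^T _ _]mxE !cvecE.
  by rewrite eqxx mul1r val_eqE eq_sym.
by rewrite (_ : val x == val j = false) ?mul0r //; apply: contraNF jx => /eqP/val_inj ->.
Qed.

Lemma zvec_outer a : 2^-1 *: (zvec R n a *m (zbar R n a)^T + zbar R n a *m (zvec R n a)^T)
  = cvec a.*2 *m (cvec a.*2)^T + cvec a.*2.+1 *m (cvec a.*2.+1)^T.
Proof.
by rewrite zvecE zbarE isotropic_outer // -expr2 sqr_i.
Qed.

End WeightVectors.

Section Frame.
Variables (R : realType) (n d : nat) (dl : 'M[R]_n -> 'M[R[i]]_d).
Local Notation C := R[i].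
Local Notation D := (basis_rep dl).
Local Notation W := (dl_wedge dl).
Implicit Types (x y z : 'cV[C]_n).

Hypothesis Danti : forall i j, D j i = - D i j.
Hypothesis Dskew : forall i j (u v : 'cV[C]_d), rdot (D i j *m u) v = - rdot u (D i j *m v).
Hypothesis Dcomm : forall i j k l,
  D i j *m D k l - D k l *m D i j =
  (i == k)%:R *: D j l - (j == k)%:R *: D i l
  + (i == l)%:R *: D k j - (j == l)%:R *: D k i.
Hypothesis W_real : forall a b : 'cV[R]_n,
  W (map_mx (real_complex R) a) (map_mx (real_complex R) b) = dl (wedge a b).

Lemma W_combl s x y z : W (x + s *: y) z = W x z + s *: W y z.
Proof.
rewrite /dl_wedge scaler_sumr -big_split; apply: eq_bigr => i _.
rewrite scaler_sumr -big_split; apply: eq_bigr => j _ /=.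
by rewrite scalerA -scalerDl !mxE mulrDl mulrA.
Qed.

Lemma W_combr s x y z : W z (x + s *: y) = W z x + s *: W z y.
Proof. by rewrite W_anti // W_combl opprD -scalerN -!(W_anti Danti). Qed.

Lemma W_zbar_zvec a : W (zbar R n a) (zvec R n a) = (- 2 * 'i%C) *: dl (cartan R n a).
Proof.
rewrite /cartan -W_real -!/(cvec _ _ _) zvecE zbarE W_combl !W_combr.
rewrite !(W_xx Danti) [W (cvec R n a.*2.+1) _](W_anti Danti).
move: (W _ _) => X; apply/matrixP => i j; rewrite !mxE.
by move: (X i j) => t; ring.
Qed.

Variables (m p : nat) (k l c : R) (mu : nat -> R).
Hypothesis Dcas : \sum_i \sum_j D i j *m D j i = (c%:C)%:M.
Hypothesis hmu : is_highest_weight dl mu.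

(* [s] records the sign of the last weight when [n] is even; exchanging
   [z_(m-1)] and its conjugate makes that weight positive. *)
Lemma highest_weight_data (s : bool) : n = (m.*2 + odd n)%N -> (s ==> ~~ odd n) ->
  (0 < p < m)%N -> l < k ->
  (forall j, (j < m)%N -> mu j = if (j < p)%N then k
     else if s && (j == m.-1) then - l else l) ->
  [/\ c = 2 * (p%:R * k ^+ 2 + (m%:R - p%:R) * l ^+ 2) + 2 * p%:R * (m%:R - p%:R) * (k - l)
      + (n%:R - 2 + (odd n)%:R) * (p%:R * k + (m%:R - p%:R) * l),
      exists2 T : 'M[C]_(d, n), T != 0 & conf_eigen dl k T
    & exists2 T : 'M[C]_(d, n), T != 0 & conf_eigen dl (l - p%:R) T].
Proof.
move=> nE so pm kl muE; have [v [v0 [H1 H2 H3]]] := hmu.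
have n2 : n./2 = m by lia.
pose sw j := s && (j == m.-1).
pose f j := if sw j then zbar R n j else zvec R n j.
pose fb j := if sw j then zvec R n j else zbar R n j.
pose e := if odd n then cvec R n n.-1 else 0 : 'cV[C]_n.
have ltn2 j : (j < m)%N -> (j.*2.+1 < n)%N by lia.
have ii : 'i%C * 'i%C = -1 :> C by rewrite -expr2 sqr_i.
have swE a b : (a == b) -> sw a = sw b by move=> /eqP ->.
have fz a : f a = cvec R n a.*2 + (if sw a then 'i%C else - 'i%C) *: cvec R n a.*2.+1.
  by rewrite /f; case: ifP => _; rewrite ?zvecE ?zbarE.
have fbz a : fb a = cvec R n a.*2 + (if sw a then - 'i%C else 'i%C) *: cvec R n a.*2.+1.
  by rewrite /fb; case: ifP => _; rewrite ?zvecE ?zbarE.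
have resol : \sum_(a < m) 2^-1 *: (f a *m (fb a)^T + fb a *m (f a)^T) + e *m e^T = 1%:M.
  rewrite -(sum_cvec R n) -(big_mkord predT (fun a => 2^-1 *: (f a *m (fb a)^T + fb a *m (f a)^T))).
  have -> : \sum_(0 <= j < n) cvec R n j *m (cvec R n j)^T =
      \sum_(0 <= j < m.*2 + odd n) cvec R n j *m (cvec R n j)^T by rewrite -nE.
  have -> : \sum_(0 <= a < m) 2^-1 *: (f a *m (fb a)^T + fb a *m (f a)^T) =
      \sum_(0 <= j < m.*2) cvec R n j *m (cvec R n j)^T.
    rewrite sum_pairs; apply: eq_bigr => a _; rewrite -zvec_outer /f /fb.
    by case: ifP => _ //; rewrite addrC.
  rewrite /e; case: ifP => on; last by rewrite mul0mx addr0 addn0.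
  rewrite addn1 big_nat_recr //=; congr (_ + cvec R n _ *m (cvec R n _)^T); lia.
have fK a : (a < m)%N -> map_mx conjc (f a) = fb a.
  by rewrite /f /fb; case: ifP => _; rewrite ?conj_zvec ?conj_zbar.
have fbK a : (a < m)%N -> map_mx conjc (fb a) = f a.
  by rewrite /f /fb; case: ifP => _; rewrite ?conj_zvec ?conj_zbar.
have bff a b : (a < m)%N -> (b < m)%N -> bform (f a) (f b) = 0.
  move=> am bm; rewrite !fz bform_z ?ltn2 //.
  case: (eqVneq a b) => [->|_]; last by rewrite mulr0.
  by case: ifP => _; rewrite ?mulrNN ii subrr mul0r.
have bfbfb a b : (a < m)%N -> (b < m)%N -> bform (fb a) (fb b) = 0.
  move=> am bm; rewrite !fbz bform_z ?ltn2 //.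
  case: (eqVneq a b) => [->|_]; last by rewrite mulr0.
  by case: ifP => _; rewrite ?mulrNN ii subrr mul0r.
have bffb a b : (a < m)%N -> (b < m)%N -> bform (f a) (fb b) = 2 * (a == b)%:R.
  move=> am bm; rewrite fz fbz bform_z ?ltn2 //.
  case: (eqVneq a b) => [->|_]; last by rewrite !mulr0.
  by case: ifP => _; rewrite ?mulrN ?mulNr ii opprK.
have cze a (t : C) : (a < m)%N -> bform (cvec R n a.*2 + t *: cvec R n a.*2.+1) e = 0.
  move=> am; have an := ltn2 _ am; rewrite /e; case: ifP => on; last first.
    by rewrite /bform big1 // => i _; rewrite [X in _ * X]mxE mulr0.
  rewrite bformDl bformZl !bform_cvec // ?(ltnW an) //.
  have -> : (a.*2 == n.-1) = false by apply/eqP; lia.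
  have -> : (a.*2.+1 == n.-1) = false by apply/eqP; lia.
  by rewrite mulr0 addr0.
have bfe a : (a < m)%N -> bform (f a) e = 0 by move=> am; rewrite fz cze.
have bfbe a : (a < m)%N -> bform (fb a) e = 0 by move=> am; rewrite fbz cze.
have bee : bform e e = (odd n)%:R.
  rewrite /e; case: ifP => on; last by rewrite /bform big1 // => i _; rewrite [X in _ * X]mxE mulr0.
  by rewrite bform_cvec ?eqxx //; lia.
have Wdiag a : (a < m)%N -> W (fb a) (f a) *m v = (2 * (if (a < p)%N then k else l))%:C *: v.
  move=> am; have := H1 a; rewrite n2 => /(_ am) Ha.
  have E : W (zbar R n a) (zvec R n a) *m v = (2 * mu a)%:C *: v.
    rewrite W_zbar_zvec -scalemxAl Ha scalerA !realCE; congr (_ *: _).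
    transitivity (- 2 * ('i%C * 'i%C) * (mu a)%:C); first by move: ('i%C : C) ((mu a)%:C) => x y; ring.
    by rewrite ii; ring.
  move: E; rewrite muE // /f /fb -/(sw a); case: ifP => ap.
    have -> : sw a = false by rewrite /sw; apply/negP => /andP[_ /eqP]; lia.
    by [].
  (* In the exchanged plane the weight is $-l$ and the arguments of [W] are reversed; the two signs
     cancel. *)
  case: ifP => // sa; rewrite W_anti // mulNmx => E.
  by rewrite -[LHS]opprK E mulrN realCN scaleNr opprK.
have sw_lt a b : (a < b)%N -> (b < m)%N -> sw a = false.
  by move=> ab bm; rewrite /sw; apply/negP => /andP[_ /eqP]; lia.
have Wraise a b : (a < b)%N -> (b < m)%N ->
    W (f a) (fb b) *m v = 0 /\ W (f a) (f b) *m v = 0.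
  move=> ab bm; have := H2 a b ab; rewrite n2 => /(_ bm) [E1 E2].
  (* Only the larger index can be the exchanged one, and exchanging it just swaps the two raising
     equations. *)
  by rewrite /f /fb (sw_lt a b) //; case: ifP.
have Wraise_e a : (a < m)%N -> W (f a) e *m v = 0.
  move=> am; rewrite /e; case: ifP => on.
    have -> : f a = zvec R n a.
      by rewrite /f /sw; move: so; rewrite on; case: (s).
    by apply: H3 => //; rewrite n2.
  rewrite (_ : W (f a) 0 = 0) ?mul0mx // /dl_wedge big1 // => i _; rewrite big1 // => j _.
  by rewrite [X in _ * X]mxE mulr0 scale0r.
split.
- eapply casimir_highest; eassumption.
- exists (v *m (f 0)^T); eapply conf_eigen_k; eassumption.
- eapply conf_eigen_l; eassumption.
Qed.

End Frame.

(** * Arithmetic of the conformal weights and of the masses *)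

Section WeightValues.
Variable R : realFieldType.

(** The monic quartics with roots $w_j$ and with the four announced roots satisfy the same two
    relations, so they differ by $d_2(x^2+\frac{N-2}2x)+d_4$. This vanishes at $k$ and $l-p$, and
    $k+(l-p)+\frac{N-2}2>0$ forces $d_2=0$, then $d_4=0$. *)
Lemma weight_values (N m p k l c w1 w2 w3 w4 : R) (o : bool) :
  N = 2 * m + o%:R -> (o -> l = 2^-1) -> 1 <= p -> p + 1 <= m -> 0 < l -> l < k ->
  sorted >%O [:: w1; w2; w3; w4] ->
  k \in [:: w1; w2; w3; w4] -> l - p \in [:: w1; w2; w3; w4] ->
  c = 2 * (p * k ^+ 2 + (m - p) * l ^+ 2) + 2 * p * (m - p) * (k - l)
      + (N - 2 + o%:R) * (p * k + (m - p) * l) ->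
  w1 + w2 + w3 + w4 = 2 - 3 * N / 2 ->
  2 * (w1*w2*w3 + w1*w2*w4 + w1*w3*w4 + w2*w3*w4) = c + (N - 2) * (N - 1) * (N / 2 - 1)
    - (N - 2) * (w1*w2 + w1*w3 + w1*w4 + w2*w3 + w2*w4 + w3*w4) ->
  [/\ w1 = k, w2 = l - p, w3 = 1 - N / 2 - l & w4 = - k + p + 1 - N].
Proof.
move=> NE lo p1 pm l0 lk srt kin lin cE e1E e3E.
have N0 : 2 * m <= N by rewrite NE lerDl; case: (o).
set c2 := l - p; set c3 := 1 - N / 2 - l; set c4 := - k + p + 1 - N.
rewrite -/c2 in lin.
have f1E : k + c2 + c3 + c4 = 2 - 3 * N / 2 by rewrite /c2 /c3 /c4; field.
have f3E : 2 * (k*c2*c3 + k*c2*c4 + k*c3*c4 + c2*c3*c4) = c + (N - 2) * (N - 1) * (N / 2 - 1)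
    - (N - 2) * (k*c2 + k*c3 + k*c4 + c2*c3 + c2*c4 + c3*c4).
  (* In odd dimension the announced roots are checked with $l=\frac12$ substituted. *)
  have [oE|[oE lE]] : o%:R = 0 :> R \/ o%:R = 1 :> R /\ l = 2^-1.
  - by case: (o) lo => lo; [right; rewrite lo|left].
  - by rewrite cE /c2 /c3 /c4 NE oE; field.
  - by rewrite cE /c2 /c3 /c4 NE oE lE; field.
pose d2 := (w1*w2 + w1*w3 + w1*w4 + w2*w3 + w2*w4 + w3*w4) -
  (k*c2 + k*c3 + k*c4 + c2*c3 + c2*c4 + c3*c4).
pose d4 := w1 * w2 * w3 * w4 - k * c2 * c3 * c4.
have PQ x : (x - w1) * (x - w2) * (x - w3) * (x - w4) =
    (x - k) * (x - c2) * (x - c3) * (x - c4) + d2 * x ^+ 2 + (N - 2) / 2 * d2 * x + d4.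
  transitivity ((x - k) * (x - c2) * (x - c3) * (x - c4) + d2 * x ^+ 2
     - ((w1*w2*w3 + w1*w2*w4 + w1*w3*w4 + w2*w3*w4)
        - (k*c2*c3 + k*c2*c4 + k*c3*c4 + c2*c3*c4)) * x + d4
     - (w1 + w2 + w3 + w4 - (k + c2 + c3 + c4)) * x ^+ 3).
    by rewrite /d2 /d4; ring.
  rewrite e1E f1E subrr mul0r subr0.
  have -> : (w1*w2*w3 + w1*w2*w4 + w1*w3*w4 + w2*w3*w4)
        - (k*c2*c3 + k*c2*c4 + k*c3*c4 + c2*c3*c4) = - ((N - 2) / 2 * d2).
    by apply: (mulfI (x := 2)); rewrite ?pnatr_eq0 // mulrBr e3E f3E /d2; field.
  by ring.
have P0 x : x \in [:: w1; w2; w3; w4] -> (x - w1) * (x - w2) * (x - w3) * (x - w4) = 0.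
  by rewrite !inE => /or4P[]/eqP ->; rewrite subrr ?(mulr0, mul0r).
have k0 : d2 * k ^+ 2 + (N - 2) / 2 * d2 * k + d4 = 0.
  by have := PQ k; rewrite P0 // subrr !mul0r add0r.
have c20 : d2 * c2 ^+ 2 + (N - 2) / 2 * d2 * c2 + d4 = 0.
  by have := PQ c2; rewrite P0 // subrr mulr0 !mul0r add0r.
have d20 : d2 = 0.
  have : d2 * ((k - c2) * (k + c2 + (N - 2) / 2)) = 0.
    by rewrite -[RHS](subrr 0) -{1}k0 -c20; field.
  have c20' : 0 < (k - c2) * (k + c2 + (N - 2) / 2).
    by apply: mulr_gt0; rewrite /c2; lra.
  by move=> /eqP; rewrite mulf_eq0 (gt_eqF c20') orbF => /eqP.
have d40 : d4 = 0 by move: k0; rewrite d20 !(mul0r, mulr0, add0r).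
have in34 x : (x - c3) * (x - c4) = 0 -> x \in [:: w1; w2; w3; w4].
  move=> x34; have /eqP : (x - w1) * (x - w2) * (x - w3) * (x - w4) = 0.
    by rewrite PQ d20 d40 -(mulrA _ (x - c3)) x34 !(mul0r, mulr0, addr0).
  by rewrite !mulf_eq0 !subr_eq0 !inE -!orbA.
have c3in : c3 \in [:: w1; w2; w3; w4] by apply: in34; rewrite subrr mul0r.
have c4in : c4 \in [:: w1; w2; w3; w4] by apply: in34; rewrite subrr mulr0.
have srt' : sorted >%O [:: k; c2; c3; c4].
  by rewrite /= andbT /c2 /c3 /c4; apply/and3P; split; lra.
have us : uniq [:: k; c2; c3; c4].
  by apply: (sorted_uniq (leT := >%O)) srt' => //; [exact: rev_trans lt_trans|exact: ltxx].
have sub : {subset [:: k; c2; c3; c4] <= [:: w1; w2; w3; w4]}.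
  by apply/allP; rewrite /= kin lin c3in c4in.
have [_ eqi] := uniq_min_size us sub (leqnn 4).
by have [-> -> -> ->] := irr_sorted_eq (rev_trans lt_trans) (@ltxx _ _) srt' srt eqi.
Qed.

(* The polynomial [(x - wa) (x - wb) (x + n - 1 + wa + wb)] has no free second
   moment, so that its mean only involves the two masses [qi] and [qj]. *)
Lemma two_weights (N c wi wj wa wb qi qj qa qb Q0 : R) :
  wi + wj + wa + wb = 2 - 3 * N / 2 ->
  2 * (wi*wj*wa + wi*wj*wb + wi*wa*wb + wj*wa*wb) = c + (N - 2) * (N - 1) * (N / 2 - 1)
    - (N - 2) * (wi*wj + wi*wa + wi*wb + wj*wa + wj*wb + wa*wb) ->
  qi + qj + qa + qb = Q0 ->
  wi * qi + wj * qj + wa * qa + wb * qb = 0 ->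
  wi ^+ 3 * qi + wj ^+ 3 * qj + wa ^+ 3 * qa + wb ^+ 3 * qb =
    - (N - 1) * (wi ^+ 2 * qi + wj ^+ 2 * qj + wa ^+ 2 * qa + wb ^+ 2 * qb) + c / 2 * Q0 ->
  (wi - wa) * (wi - wb) * (wj + (N - 2) / 2) * qi
  + (wj - wa) * (wj - wb) * (wi + (N - 2) / 2) * qj =
  (wi + (N - 2) / 2) * (wj + (N - 2) / 2) * (wi + wj + N - 1) * Q0.
Proof.
move=> e1E e3E m0 m1 m3.
have wbE : wb = 2 - 3 * N / 2 - wi - wj - wa by lra.
have cE : c = 2 * (wi*wj*wa + wi*wj*wb + wi*wa*wb + wj*wa*wb)
    - (N - 2) * (N - 1) * (N / 2 - 1)
    + (N - 2) * (wi*wj + wi*wa + wi*wb + wj*wa + wj*wb + wa*wb) by lra.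
have qbE : qb = Q0 - qi - qj - qa by lra.
(* Minus the third root of the cubic, whose square term then has the coefficient $N-1$ of the third
   moment. By the sum of the weights, $-(w_i+t)=w_j+\frac{N-2}2$. *)
pose t := N - 1 + wa + wb.
transitivity (- ((wi ^+ 3 * qi + wj ^+ 3 * qj + wa ^+ 3 * qa + wb ^+ 3 * qb)
   + (N - 1) * (wi ^+ 2 * qi + wj ^+ 2 * qj + wa ^+ 2 * qa + wb ^+ 2 * qb)
   + (wa * wb - (wa + wb) * t) * (wi * qi + wj * qj + wa * qa + wb * qb)
   + wa * wb * t * (qi + qj + qa + qb))).
  by rewrite /t wbE; field.
by rewrite m3 m1 m0 cE /t wbE; field.
Qed.

(** The pairs follow the operators: for $P_1$ the mass [q1] is expressed through [q4], for $P_3$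
    [q3] through [q2], and for $P_2+P_4$ the two vanishing components are tied together. *)
Lemma weight_identities (N c w1 w2 w3 w4 q1 q2 q3 q4 Q0 : R) :
  w1 + w2 + w3 + w4 = 2 - 3 * N / 2 ->
  2 * (w1*w2*w3 + w1*w2*w4 + w1*w3*w4 + w2*w3*w4) = c + (N - 2) * (N - 1) * (N / 2 - 1)
    - (N - 2) * (w1*w2 + w1*w3 + w1*w4 + w2*w3 + w2*w4 + w3*w4) ->
  q1 + q2 + q3 + q4 = Q0 ->
  w1 * q1 + w2 * q2 + w3 * q3 + w4 * q4 = 0 ->
  w1 ^+ 3 * q1 + w2 ^+ 3 * q2 + w3 ^+ 3 * q3 + w4 ^+ 3 * q4 =
    - (N - 1) * (w1 ^+ 2 * q1 + w2 ^+ 2 * q2 + w3 ^+ 2 * q3 + w4 ^+ 2 * q4) + c / 2 * Q0 ->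
  let x w := w + (N - 2) / 2 in
  [/\ (w1 - w2) * (w1 - w3) * x w4 * q1 + (w4 - w2) * (w4 - w3) * x w1 * q4
        = x w1 * x w4 * (w1 + w4 + N - 1) * Q0,
      (w3 - w4) * (w3 - w1) * x w2 * q3 + (w2 - w4) * (w2 - w1) * x w3 * q2
        = x w3 * x w2 * (w3 + w2 + N - 1) * Q0
    & (w4 - w1) * (w4 - w3) * x w2 * q4 + (w2 - w1) * (w2 - w3) * x w4 * q2
        = x w4 * x w2 * (w2 + w4 + N - 1) * Q0].
Proof.
move=> e1E e3E m0 m1 m3 x; split.
- apply: (@two_weights N c w1 w4 w2 w3 q1 q4 q2 q3); lra.
- apply: (@two_weights N c w3 w2 w4 w1 q3 q2 q4 q1); lra.
- rewrite (addrC w2 w4); apply: (@two_weights N c w4 w2 w1 w3 q4 q2 q1 q3); lra.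
Qed.

Lemma solve_weight (X Y x y z q r Q0 : R) : X != 0 -> y != 0 ->
  X * y * q + Y * x * r = x * y * z * Q0 ->
  q = x * z / X * Q0 + - (Y * x / (X * y)) * r.
Proof.
move=> X0 y0 E; apply: (mulfI (mulf_neq0 X0 y0)).
have -> : X * y * q = x * y * z * Q0 - Y * x * r by rewrite -E addrK.
by field; rewrite X0 y0.
Qed.

Lemma opp_div_gt0 (u v : R) : 0 < u -> v < 0 -> 0 < - (u / v).
Proof. by move=> u0 v0; rewrite oppr_gt0 pmulr_rlt0 // invr_lt0. Qed.

Lemma weights_signs (N k l p : R) (p1 : 1 <= p) (pN : 2 * (p + 1) <= N) (l0 : 0 < l) (lk : l < k) :
  let w1 := k in let w2 := l - p in let w3 := 1 - N / 2 - l in let w4 := - k + p + 1 - N in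
  [/\ 0 < w1 - w2, 0 < w2 - w3 & 0 < w3 - w4] /\
  [/\ 0 < w1 + (N - 2) / 2, 0 < w2 + (N - 2) / 2, w3 + (N - 2) / 2 < 0
    & w4 + (N - 2) / 2 < 0].
Proof. by move=> w1 w2 w3 w4; rewrite /w1 /w2 /w3 /w4; split; split; lra. Qed.

Lemma kato_constant1 (N k l p : R) (p1 : 1 <= p) (pN : 2 * (p + 1) <= N) (l0 : 0 < l) (lk : l < k) :
  let w1 := k in let w2 := l - p in let w3 := 1 - N / 2 - l in let w4 := - k + p + 1 - N in
  let q := ((k + (N - 2) / 2) * (k - l) + l * (k - l + p))
           / ((k - l + p) * (k + l + (N - 2) / 2)) in
  0 < q /\ q = 1 - (w1 + (N - 2) / 2) * (w1 + w4 + N - 1) / ((w1 - w2) * (w1 - w3)).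
Proof.
move=> w1 w2 w3 w4 q.
have y1 : 0 < k + (N - 2) / 2 by lra.
have y2 : 0 < k - l by lra.
have y3 : 0 < k - l + p by lra.
have y4 : 0 < k + l + (N - 2) / 2 by lra.
split; first by apply: divr_gt0; [apply: addr_gt0|]; exact: mulr_gt0.
rewrite /q /w1 /w2 /w3 /w4; field.
by do !(apply/andP; split); rewrite gt_eqF //; lra.
Qed.

Lemma kato_constant3 (N k l p : R) (p1 : 1 <= p) (pN : 2 * (p + 1) <= N) (l0 : 0 < l) (lk : l < k) :
  let w1 := k in let w2 := l - p in let w3 := 1 - N / 2 - l in let w4 := - k + p + 1 - N in
  let q := 1 - l * (N / 2 - p) / ((k - l + N / 2 - p) * (k + l + (N - 2) / 2)) in
  0 < q /\ q = 1 - (w3 + (N - 2) / 2) * (w3 + w2 + N - 1) / ((w3 - w4) * (w3 - w1)).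
Proof.
move=> w1 w2 w3 w4 q.
have y1 : 0 < k - l + N / 2 - p by lra.
have y2 : 0 < k + l + (N - 2) / 2 by lra.
split.
  rewrite subr_gt0 ltr_pdivrMr ?mulr_gt0 // mul1r mulrC.
  by apply: ltr_pM; lra.
rewrite /q /w1 /w2 /w3 /w4; field.
by do !(apply/andP; split); rewrite neq_lt; apply/orP; first [left; lra|right; lra].
Qed.

(** [t4 < 1] is enough for $1-\min$ to be positive, and positivity of both terms allows division by
    either one. *)
Lemma kato_constant24 (N k l p : R) (p1 : 1 <= p) (pN : 2 * (p + 1) <= N) (l0 : 0 < l) (lk : l < k) :
  let w1 := k in let w2 := l - p in let w3 := 1 - N / 2 - l in let w4 := - k + p + 1 - N in
  let t4 := (w4 + (N - 2) / 2) * (w2 + w4 + N - 1) / ((w4 - w1) * (w4 - w3)) in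
  let t2 := (w2 + (N - 2) / 2) * (w2 + w4 + N - 1) / ((w2 - w1) * (w2 - w3)) in
  [/\ t4 = (k + N / 2 - p) * (k - l) / ((2 * k + N - p - 1) * (k - l + N / 2 - p)),
      t2 = (l + N / 2 - p - 1) * (k - l) / ((k - l + p) * (2 * l + N / 2 - p - 1)),
      0 < t4, 0 < t2 & t4 < 1].
Proof.
move=> w1 w2 w3 w4 t4 t2.
have y1 : 0 < k + N / 2 - p by lra.
have y2 : 0 < k - l by lra.
have y3 : 0 < 2 * k + N - p - 1 by lra.
have y4 : 0 < k - l + N / 2 - p by lra.
have y5 : 0 < l + N / 2 - p - 1 by lra.
have y6 : 0 < k - l + p by lra.
have y7 : 0 < 2 * l + N / 2 - p - 1 by lra.
have t4E : t4 = (k + N / 2 - p) * (k - l) / ((2 * k + N - p - 1) * (k - l + N / 2 - p)).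
  rewrite /t4 /w1 /w2 /w3 /w4; field.
  by do !(apply/andP; split); rewrite neq_lt; apply/orP; first [left; lra|right; lra].
have t2E : t2 = (l + N / 2 - p - 1) * (k - l) / ((k - l + p) * (2 * l + N / 2 - p - 1)).
  rewrite /t2 /w1 /w2 /w3 /w4; field.
  by do !(apply/andP; split); rewrite neq_lt; apply/orP; first [left; lra|right; lra].
split=> //; rewrite ?t4E ?t2E ?divr_gt0 ?mulr_gt0 //.
by rewrite ltr_pdivrMr ?mulr_gt0 // mul1r; apply: ltr_pM; lra.
Qed.

End WeightValues.

(** * Kato constants *)

Section Projections.
Variables (R : realType) (n d : nat) (dl : 'M[R]_n -> 'M[R[i]]_d).
Local Notation C := R[i].
Local Notation B := (conf_op dl).
Local Notation D := (basis_rep dl).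
Local Notation Pi := (conf_proj dl).
Implicit Types S T U : 'M[C]_(d, n).

Hypothesis Danti : forall i j, D j i = - D i j.
Hypothesis Dskew : forall i j (u v : 'cV[C]_d), rdot (D i j *m u) v = - rdot u (D i j *m v).
Hypothesis Dcomm : forall i j k l,
  D i j *m D k l - D k l *m D i j =
  (i == k)%:R *: D j l - (j == k)%:R *: D i l
  + (i == l)%:R *: D k j - (j == l)%:R *: D k i.
Variable c : R.
Hypothesis Dcas : \sum_i \sum_j D i j *m D j i = (c%:C)%:M.
Variables w1 w2 w3 w4 : R.
Hypothesis hN : conformal_weights dl [:: w1; w2; w3; w4].

Let ws := [:: w1; w2; w3; w4].

Lemma conf_proj_spec w T : w \in ws -> conf_eigen dl w (Pi w T) /\
  forall U, conf_eigen dl w U -> rdot (T - Pi w T) U = 0.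
Proof.
move=> wws.
have [f Ef TE] := eigen_decomposition (weights_uniq hN) (eigen_prod_weights Danti Dskew hN T).
suff H : forall U, conf_eigen dl w U -> rdot (T - f w) U = 0.
  by rewrite (conf_projE (Ef _ wws) H); split => //; exact: Ef.
move=> U EU; rewrite TE (bigD1_seq w) ?(weights_uniq hN) //= addrAC subrr add0r.
rewrite big_seq_cond; elim/big_ind : _ => [|x y Hx Hy|w' /andP[w'ws w'w]]; first exact: rdot0l.
  by rewrite rdotDl Hx Hy addr0.
by apply: (eigen_ortho Danti Dskew w'w) => //; exact: Ef.
Qed.

Lemma conf_proj_eigen w T : w \in ws -> conf_eigen dl w (Pi w T).
Proof. by move=> /(conf_proj_spec T)[]. Qed.

Lemma conf_proj_sum T : T = Pi w1 T + Pi w2 T + Pi w3 T + Pi w4 T.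
Proof.
have [f Ef TE] := eigen_decomposition (weights_uniq hN) (eigen_prod_weights Danti Dskew hN T).
have E w : w \in ws -> Pi w T = f w.
  move=> wws; apply: conf_projE; first exact: Ef.
  move=> U EU; rewrite TE (bigD1_seq w) ?(weights_uniq hN) //= addrAC subrr add0r.
  rewrite big_seq_cond; elim/big_ind : _ => [|x y Hx Hy|w' /andP[w'ws w'w]]; first exact: rdot0l.
    by rewrite rdotDl Hx Hy addr0.
  by apply: (eigen_ortho Danti Dskew w'w) => //; exact: Ef.
by rewrite !E ?inE ?eqxx ?orbT // {1}TE !big_cons big_nil addr0 !addrA.
Qed.

Lemma conf_proj_ortho w w' S T : w \in ws -> w' \in ws -> w != w' ->
  rdot (Pi w S) (Pi w' T) = 0.
Proof.
by move=> ws0 ws1 ww; apply: (eigen_ortho Danti Dskew ww); exact: conf_proj_eigen.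
Qed.

Lemma rdot_conf_projl w S T : w \in ws -> rdot (Pi w S) T = rdot (Pi w S) (Pi w T).
Proof.
move=> wws; have [_ /(_ _ (conf_proj_eigen S wws)) H] := conf_proj_spec T wws.
move: H; rewrite rdotDl rdotNl => /eqP; rewrite subr_eq0 => /eqP E.
by rewrite rdotC E rdotC.
Qed.

Lemma conf_projZ w (s : R) T : w \in ws -> Pi w (s%:C *: T) = s%:C *: Pi w T.
Proof.
move=> wws; have [E H] := conf_proj_spec T wws.
apply: conf_projE => [|U EU]; first by rewrite /conf_eigen conf_opZ E !scalerA mulrC.
by rewrite -scalerBr rdotZl (H _ EU) mulr0.
Qed.

Lemma iter_conf_eigen s w S : conf_eigen dl w S -> iter s B S = (w ^+ s)%:C *: S.
Proof.
move=> ES; elim: s => [|s IH]; first by rewrite expr0 scale1r.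
by rewrite iterS IH conf_opZ ES scalerA -rmorphM -exprSr.
Qed.

Lemma iter_conf_opD s S T : iter s B (S + T) = iter s B S + iter s B T.
Proof. by elim: s => //= s ->; rewrite conf_opD. Qed.

Lemma rdot_iter_conf_op s T : rdot (iter s B T) T =
  w1 ^+ s * rdot (Pi w1 T) (Pi w1 T) + w2 ^+ s * rdot (Pi w2 T) (Pi w2 T)
  + w3 ^+ s * rdot (Pi w3 T) (Pi w3 T) + w4 ^+ s * rdot (Pi w4 T) (Pi w4 T).
Proof.
have i1 : w1 \in ws by rewrite !inE eqxx.
have i2 : w2 \in ws by rewrite !inE eqxx orbT.
have i3 : w3 \in ws by rewrite !inE eqxx !orbT.
have i4 : w4 \in ws by rewrite !inE eqxx !orbT.
have E w : w \in ws -> rdot (iter s B (Pi w T)) T = w ^+ s * rdot (Pi w T) (Pi w T).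
  by move=> wws; rewrite (iter_conf_eigen s (conf_proj_eigen T wws)) rdotZl rdot_conf_projl.
by rewrite -!E // -!rdotDl -!iter_conf_opD -conf_proj_sum.
Qed.

Lemma tens_moments (a : 'cV[R]_n) (v : 'cV[C]_d) :
  let q w := rdot (Pi w (tens a v)) (Pi w (tens a v)) in
  [/\ q w1 + q w2 + q w3 + q w4 = rdot (tens a v) (tens a v),
      w1 * q w1 + w2 * q w2 + w3 * q w3 + w4 * q w4 = 0
    & w1 ^+ 3 * q w1 + w2 ^+ 3 * q w2 + w3 ^+ 3 * q w3 + w4 ^+ 3 * q w4 =
      - (n%:R - 1) * (w1 ^+ 2 * q w1 + w2 ^+ 2 * q w2 + w3 ^+ 2 * q w3 + w4 ^+ 2 * q w4)
      + c / 2 * rdot (tens a v) (tens a v)].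
Proof.
split.
- by have := rdot_iter_conf_op 0 (tens a v); rewrite !expr0 !mul1r => <-.
- by have := rdot_iter_conf_op 1 (tens a v); rewrite !expr1 => <-; exact: moment1.
- by rewrite -!rdot_iter_conf_op; exact: (moment3 Danti Dcomm Dcas).
Qed.

End Projections.

Section Kato.
Variables (R : realType) (n d : nat).
Local Notation C := R[i].

Lemma rdot_tens (S : 'M[C]_(d, n)) (a : 'cV[R]_n) (v : 'cV[C]_d) :
  rdot S (tens a v) = \sum_i a i 0 * rdot (col i S) v.
Proof. by rewrite rdot_col; apply: eq_bigr => i _; rewrite col_tens rdotZr. Qed.

Lemma rdot_tens_tens (a : 'cV[R]_n) (v : 'cV[C]_d) :
  rdot (tens a v) (tens a v) = (\sum_i a i 0 ^+ 2) * rdot v v.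
Proof.
by rewrite rdot_tens mulr_suml; apply: eq_bigr => i _; rewrite col_tens rdotZl mulrA.
Qed.

Lemma tensZ (s : R) a (v : 'cV[C]_d) : tens (s *: a) v = s%:C *: tens a v :> 'M[C]_(d, n).
Proof. by apply: col_eqP => i; rewrite linearZ /= !col_tens mxE rmorphM scalerA. Qed.

Lemma mul_sqrtr (k y : R) : 0 <= k -> k * Num.sqrt y = Num.sqrt (k ^+ 2 * y).
Proof. by move=> k0; rewrite sqrtrM ?sqr_ge0 // sqrtr_sqr ger0_norm. Qed.

(* Cauchy-Schwarz for [S = Q S] and the tensor of [b = d|v|] with [v]; [S] and
   [b] stand for the covariant derivative and the differential of the norm at a
   point. *)
Lemma refined_kato (S : 'M[C]_(d, n)) (v : 'cV[C]_d) (b : 'cV[R]_n)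
    (Q : 'M[C]_(d, n) -> 'M[C]_(d, n)) (g : 'cV[R]_n -> R) (k : R) :
  v != 0 -> 0 < k ->
  (forall i, b i 0 = rdot (col i S) v / rnorm v) ->
  (forall T, rdot S T = rdot S (Q T)) ->
  (forall T, rdot (Q T) T = rdot (Q T) (Q T)) ->
  (forall (s : R) T, Q (s%:C *: T) = s%:C *: Q T) ->
  (forall a, 0 <= g a) -> (forall (s : R) a, g (s *: a) = s ^+ 2 * g a) ->
  (forall a, rdot (Q (tens a v)) (Q (tens a v)) =
     k ^+ 2 * rdot (tens a v) (tens a v) - g a) ->
  euclid_norm b <= k * rnorm S /\
  (euclid_norm b = k * rnorm S <-> exists a, S = Q (tens a v) /\ g a = 0).
Proof.
move=> v0 k0 bE QS QQ QZ g0 gZ Qg.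
pose V := rdot v v; have V0 : 0 < V by exact: rdot_gt0.
pose nv := rnorm v; have nv2 : nv ^+ 2 = V by rewrite /nv /rnorm sqr_sqrtr // ltW.
have nv0 : 0 < nv by rewrite /nv /rnorm sqrtr_gt0.
pose b2 := \sum_i b i 0 ^+ 2.
have b20 : 0 <= b2 by apply: sumr_ge0 => i _; rewrite sqr_ge0.
pose s2 := rdot S S; have s20 : 0 <= s2 by exact: rdot_ge0.
have colE' i : rdot (col i S) v = nv * b i 0.
  by rewrite bE -/nv mulrC divfK // gt_eqF.
have Sa a : rdot S (tens a v) = nv * \sum_i a i 0 * b i 0.
  by rewrite rdot_tens mulr_sumr; apply: eq_bigr => i _; rewrite colE' mulrCA.
have Sb : rdot S (tens b v) = nv * b2.
  by rewrite Sa; congr (_ * _); apply: eq_bigr => i _; rewrite expr2.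
have Tb : rdot (tens b v) (tens b v) = b2 * V by rewrite rdot_tens_tens.
have kk : 0 < k ^+ 2 by rewrite exprn_gt0.
(* $\langle S,b\otimes v\rangle=|v||b|^2$ involves only $Q(b\otimes v)$, whose squared norm falls
   short of $k^2|b|^2|v|^2$ by $g(b)$. *)
have CS : (nv * b2) ^+ 2 <= s2 * (k ^+ 2 * (b2 * V) - g b).
  by rewrite -Sb QS -Tb -Qg; exact: rdot_CauchySchwarz.
have CS' : b2 * b2 * V <= s2 * (k ^+ 2 * (b2 * V) - g b).
  by apply: le_trans CS; rewrite le_eqVlt -nv2; apply/orP; left; apply/eqP; ring.
have le2 : b2 <= k ^+ 2 * s2.
  have [->|b0] := eqVneq b2 0; first by rewrite mulr_ge0 // ltW.
  have bV : 0 < b2 * V by rewrite mulr_gt0 // lt0r b0.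
  rewrite -(ler_pM2l bV); apply: (@le_trans _ _ (b2 * b2 * V)).
    by rewrite le_eqVlt; apply/orP; left; apply/eqP; ring.
  apply: le_trans CS' _; rewrite mulrBr lerBlDr.
  rewrite (_ : s2 * (k ^+ 2 * (b2 * V)) = b2 * V * (k ^+ 2 * s2)); last by ring.
  by rewrite lerDl mulr_ge0.
have le1 : euclid_norm b <= k * rnorm S by rewrite mul_sqrtr ?ler_wsqrtr // ltW.
split=> //; split=> [eqn|[a [SE ga]]]; last first.
  apply/eqP; rewrite eq_le le1 /=.
  (* Here [a] need not be a multiple of [b] a priori: $|S|^2$ equals both $k^2|a|^2|v|^2$ and
     $|v|\langle a,b\rangle$, and Cauchy-Schwarz in $\mathbb R^n$ gives the reverse inequality. *)
  pose a2 := \sum_i a i 0 ^+ 2.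
  have s2E : s2 = k ^+ 2 * (a2 * V).
    by rewrite /s2 SE Qg ga subr0 rdot_tens_tens.
  have s2E' : s2 = nv * \sum_i a i 0 * b i 0.
    by rewrite -Sa /s2 {2}SE -QS.
  have CSr : (\sum_i a i 0 * b i 0) ^+ 2 <= a2 * b2.
    have := rdot_CauchySchwarz (tens a v) (tens b v).
    rewrite rdot_tens !rdot_tens_tens -/V -/a2 -/b2.
    under eq_bigr => i _ do rewrite col_tens rdotZl -/V mulrCA mulrA.
    rewrite -mulr_suml exprMn.
    rewrite (_ : a2 * V * (b2 * V) = a2 * b2 * V ^+ 2); last by ring.
    by rewrite ler_pM2r // exprn_gt0.
  rewrite /euclid_norm /rnorm -/s2 -/b2 mul_sqrtr ?(ltW k0) // ler_wsqrtr //.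
  have [->|s0] := eqVneq s2 0; first by rewrite mulr0.
  have s0' : 0 < s2 by rewrite lt0r s0.
  rewrite -(ler_pM2l s0').
  apply: (@le_trans _ _ (k ^+ 2 * (V * (\sum_i a i 0 * b i 0) ^+ 2))).
    by rewrite le_eqVlt; apply/orP; left; apply/eqP; rewrite -nv2 -exprMn -s2E'; ring.
  rewrite {1}s2E (_ : k ^+ 2 * (a2 * V) * b2 = k ^+ 2 * (V * (a2 * b2))); last by ring.
  by rewrite ler_pM2l // ler_pM2l.
have eq2 : b2 = k ^+ 2 * s2.
  have := congr1 (fun x => x ^+ 2) eqn.
  by rewrite exprMn /euclid_norm /rnorm !sqr_sqrtr.
(* If $b=0$, equality forces $S=0$ and $a=0$ is a witness. *)
have [b0|b0] := eqVneq b2 0.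
  exists 0; rewrite -(scale0r (0 : 'cV[R]_n)) gZ expr0n mul0r tensZ QZ scale0r; split=> //.
  apply/eqP; rewrite -rdot_eq0 -/s2; move: eq2; rewrite b0 => /esym/eqP.
  by rewrite mulf_eq0 (gt_eqF kk).
have s0 : 0 < s2.
  rewrite lt0r s20 andbT; apply: contra b0 => /eqP s0; by rewrite eq2 s0 mulr0.
have gb : g b = 0.
  apply/eqP; rewrite eq_le g0 andbT -(ler_pM2l s0) mulr0.
  move: CS'; rewrite mulrBr lerBrDr addrC -lerBrDr.
  rewrite (_ : _ - _ = 0) // eq2; ring.
pose q2 := rdot (Q (tens b v)) (Q (tens b v)).
have q2E : q2 = k ^+ 2 * (b2 * V) by rewrite /q2 Qg gb subr0 Tb.
have q0 : 0 < q2 by rewrite q2E !mulr_gt0 // lt0r b0.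
(* The coefficient of the orthogonal projection of $S$ on $Q(b\otimes v)$; equality in
   Cauchy-Schwarz makes the remainder vanish. *)
pose s := nv * b2 / q2.
exists (s *: b); rewrite gZ gb mulr0 tensZ QZ; split=> //.
apply/eqP; rewrite -subr_eq0 -rdot_eq0.
rewrite !(rdotDl, rdotDr, rdotNl, rdotNr, rdotZl, rdotZr) (rdotC (Q _) S) -QS Sb -/s2 -/q2.
have sq : s * q2 = nv * b2 by rewrite /s divfK // gt_eqF.
apply/eqP; transitivity (s2 - s * (nv * b2) - s * (nv * b2 - s * q2)); first by ring.
rewrite sq subrr mulr0 subr0.
apply/eqP; rewrite subr_eq0; apply/eqP/(mulfI (x := q2)); first by rewrite gt_eqF.
by rewrite (mulrA q2 s) (mulrC q2 s) sq q2E -nv2 eq2; ring.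
Qed.

End Kato.

Section KatoWeights.
Variables (R : realType) (n d : nat) (dl : 'M[R]_n -> 'M[R[i]]_d).
Local Notation C := R[i].
Local Notation D := (basis_rep dl).
Local Notation Pi := (conf_proj dl).

Hypothesis Danti : forall i j, D j i = - D i j.
Hypothesis Dskew : forall i j (u v : 'cV[C]_d), rdot (D i j *m u) v = - rdot u (D i j *m v).
Variables w1 w2 w3 w4 : R.
Hypothesis hN : conformal_weights dl [:: w1; w2; w3; w4].
Let ws := [:: w1; w2; w3; w4].

Lemma rdot_conf_proj S T : rdot S T = \sum_(w <- ws) rdot (Pi w S) (Pi w T).
Proof.
have E w : w \in ws -> rdot (Pi w S) T = rdot (Pi w S) (Pi w T).
  exact: (rdot_conf_projl Danti Dskew hN).
rewrite {1}(conf_proj_sum Danti Dskew hN S) !rdotDl /ws !big_cons big_nil addr0 !addrA.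
by rewrite !E ?inE ?eqxx ?orbT.
Qed.

Lemma rdot_conf_projr w S T : w \in ws -> rdot S (Pi w T) = rdot (Pi w S) (Pi w T).
Proof.
by move=> wws; rewrite rdotC (rdot_conf_projl Danti Dskew hN) // rdotC.
Qed.

(** [J] lists the components that may survive in $\nabla\xi$, and [w0] carries the mass left free by
    the linear relations. When [A = 0] the mass no longer depends on [w0], and equality imposes no
    further condition. *)
Lemma kato_weights (J : seq R) (S : 'M[C]_(d, n)) (v : 'cV[C]_d) (b : 'cV[R]_n) (k A w0 : R) :
  uniq J -> {subset J <= ws} -> (forall w, w \in ws -> w \notin J -> Pi w S = 0) ->
  v != 0 -> 0 < k -> (forall i, b i 0 = rdot (col i S) v / rnorm v) ->
  w0 \in ws -> 0 <= A ->
  (forall a, \sum_(w <- J) rdot (Pi w (tens a v)) (Pi w (tens a v)) =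
     k ^+ 2 * rdot (tens a v) (tens a v)
     - A * rdot (Pi w0 (tens a v)) (Pi w0 (tens a v))) ->
  euclid_norm b <= k * rnorm S /\
  (euclid_norm b = k * rnorm S <->
   exists a, S = \sum_(w <- J) Pi w (tens a v) /\ (A = 0 \/ Pi w0 (tens a v) = 0)).
Proof.
move=> uJ sJ SJ v0 k0 bE w0ws A0 H.
pose Q T := \sum_(w <- J) Pi w T.
pose g a := A * rdot (Pi w0 (tens a v)) (Pi w0 (tens a v)).
have rQ X T : rdot X (Q T) = \sum_(w <- J) rdot (Pi w X) (Pi w T).
  rewrite /Q big_seq [RHS]big_seq.
  elim/big_ind2 : _ => [|x1 x2 y1 y2 <- <-|w wJ]; first exact: rdot0r.
    exact: rdotDr.
  by rewrite rdot_conf_projr // sJ.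
have PQ w T : w \in J -> Pi w (Q T) = Pi w T.
  move=> wJ; have wws := sJ _ wJ.
  apply: conf_projE => [|U EU]; first exact: (conf_proj_eigen Danti Dskew hN).
  rewrite /Q (bigD1_seq w) //= addrAC subrr add0r big_seq_cond.
  elim/big_ind : _ => [|x y Hx Hy|w' /andP[w'J w'w]]; first exact: rdot0l.
    by rewrite rdotDl Hx Hy addr0.
  apply: (eigen_ortho Danti Dskew w'w) => //.
  by apply: (conf_proj_eigen Danti Dskew hN); exact: sJ.
have QQ T : rdot (Q T) (Q T) = \sum_(w <- J) rdot (Pi w T) (Pi w T).
  by rewrite rQ big_seq [RHS]big_seq; apply: eq_bigr => w wJ; rewrite PQ.
have gE a : g a = 0 <-> A = 0 \/ Pi w0 (tens a v) = 0.
  split=> [/eqP|[|] E]; rewrite /g ?E ?mul0r ?rdot0l ?mulr0 //.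
  by rewrite mulf_eq0 rdot_eq0 => /orP[]/eqP; [left|right].
have SQ T : rdot S T = rdot S (Q T).
  rewrite rdot_conf_proj rQ (bigID (fun w => w \in J)) /= [X in _ + X]big1_seq ?addr0; last first.
    by move=> w /andP[wJ wws]; rewrite SJ // rdot0l.
  rewrite -big_filter; apply: perm_big; apply: uniq_perm => //.
    by rewrite filter_uniq // (weights_uniq hN).
  by move=> w; rewrite mem_filter; case wJ : (w \in J) => //=; apply: sJ.
have QT T : rdot (Q T) T = rdot (Q T) (Q T) by rewrite QQ rdotC rQ.
have QZ (s : R) T : Q (s%:C *: T) = s%:C *: Q T.
  rewrite /Q scaler_sumr big_seq [RHS]big_seq; apply: eq_bigr => w wJ.
  by rewrite (conf_projZ Danti Dskew hN) // sJ.
have g0 a : 0 <= g a by rewrite mulr_ge0 // rdot_ge0.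
have gZ (s : R) a : g (s *: a) = s ^+ 2 * g a.
  rewrite /g tensZ (conf_projZ Danti Dskew hN) // rdotZl rdotZr; ring.
have Qg a : rdot (Q (tens a v)) (Q (tens a v)) =
    k ^+ 2 * rdot (tens a v) (tens a v) - g a by rewrite QQ H.
have [le eqn] := refined_kato v0 k0 bE SQ QT QZ g0 gZ Qg.
split=> //; rewrite eqn; split=> -[a [Sa ga]]; exists a; split=> //; exact/gE.
Qed.

End KatoWeights.

(** * The differential of the norm of a section *)

Section NormDerivative.
Variables (R : realType) (n : nat).

Lemma derive_sqrt_comp (g : 'cV[R]_n -> R) (y v : 'cV[R]_n) :
  differentiable g y -> 0 < g y ->
  'D_v (fun z => Num.sqrt (g z)) y = 'D_v g y / (2 * Num.sqrt (g y)).
Proof.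
move=> dg g0; have ds := is_derive1_sqrt g0.
have dS : differentiable (@Num.sqrt R) (g y).
  by apply/derivable1_diffP; exact: ex_derive.
rewrite deriveE; last exact: (differentiable_comp dg dS).
rewrite (diff_comp dg dS) /= deriv1E; last exact: ex_derive.
by rewrite derive1E derive_val deriveE.
Qed.

Lemma differentiable_rdot (p q : nat) (f : 'cV[R]_n -> 'M[R[i]]_(p, q)) (y : 'cV[R]_n) :
  (forall i j, differentiable (fun z => complex.Re (f z i j)) y) ->
  (forall i j, differentiable (fun z => complex.Im (f z i j)) y) ->
  differentiable (fun z => rdot (f z) (f z)) y.
Proof.
move=> dR dI.
rewrite (_ : (fun z => _) = \sum_i \sum_j (fun z => complex.Re (f z i j) * complex.Re (f z i j)
   + complex.Im (f z i j) * complex.Im (f z i j))); last first.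
  apply/funext => z; rewrite fct_sumE; apply: eq_bigr => i _.
  by rewrite fct_sumE.
apply: differentiable_sum => i; apply: differentiable_sum => j.
by apply: differentiableD; apply: differentiableM.
Qed.

Variables (G : struct_group R n) (M : riem_manifold R n) (F : frame_structure G M).
Variables (K : rep_kind) (d : nat) (rho : 'M[R]_(gdim G) -> 'M[R[i]]_d).

(** Where $\xi\ne0$ the square root is differentiable at $|\xi|^2$, and metric compatibility gives
    $d|\xi|^2=2\langle\nabla\xi,\xi\rangle$. *)
Lemma dnorm_section (nab : local_sections M d -> local_tsections M d) (xi : local_sections M d) a x i :
  metric_connection F K rho nab -> is_section F K rho xi -> dom a x -> xi a x != 0 ->
  diff_in F a (fun y => rnorm (xi a y)) x i 0 =
  rdot (col i (nab xi a x)) (xi a x) / rnorm (xi a x).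
Proof.
move=> hnab hxi ax x0; have [_ _ sm] := hxi.
pose g := fun y => rdot (xi a (chart_inv a y)) (xi a (chart_inv a y)).
have cK : chart_inv a (chart a x) = x by exact: chartK.
have dg : differentiable g (chart a x).
  have im : (chart a @` dom a) (chart a x) by exists x.
  apply: differentiable_rdot => s t.
    by have [/(_ 1%N)[H _] _] := sm a s t; exact: H.
  by have [_ /(_ 1%N)[H _]] := sm a s t; exact: H.
have g0 : 0 < g (chart a x) by rewrite /g cK; exact: rdot_gt0.
have := conn_metric hnab hxi hxi ax i; rewrite !mxE => E.
rewrite -[LHS]/('D_(col i (frame F a x)) (fun z => Num.sqrt (g z)) (chart a x)).
rewrite derive_sqrt_comp // {2}/g cK -/(rnorm (xi a x)).
have -> : 'D_(col i (frame F a x)) g (chart a x) = 2 * rdot (col i (nab xi a x)) (xi a x).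
  rewrite mulr_natl mulr2n [X in _ = _ + X]rdotC; exact: E.
by rewrite -mulf_div divff ?mul1r // pnatr_eq0.
Qed.

End NormDerivative.

(* The three Kato inequalities *)
Local Close Scope complex_scope.

Theorem theorem7p2 (R : realType) (n m p d : nat) (k l w1 w2 w3 w4 : R)
    (mu : nat -> R) (K : rep_kind)
    (G : struct_group R n) (hG : G = SO_group R n \/ G = Spin_group R n)
    (rho : 'M[R]_(gdim G) -> 'M[R[i]]_d) (dl : 'M[R]_n -> 'M[R[i]]_d)
    (hrho : is_representation K rho dl)
    (hirr : complex_irreducible rho)
    (hmu : is_highest_weight dl mu)
    (hcase : weight_even n m p k l mu \/ weight_odd n m p k l mu)
    (hN : conformal_weights dl [:: w1; w2; w3; w4])
    (M : riem_manifold R n) (F : frame_structure G M)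
    (nab : local_sections M d -> local_tsections M d)
    (hnab : metric_connection F K rho nab)
    (xi : local_sections M d)
    (hxi : is_section F K rho xi)
    (hxi0 : nonvanishing xi) :
  let N2 : R := n%:R / 2 in
  let P w := conf_diff dl nab w xi in
  let Pi w := conf_proj dl w in
  [/\ [/\ w1 = k, w2 = l - p%:R, w3 = 1 - N2 - l & w4 = - k + p%:R + 1 - n%:R],
      (* (i) *)
      exists k1 : R,
      [/\ 0 <= k1,
          k1 ^+ 2 = 1 - (w1 + (n%:R - 2) / 2) * (w1 + w4 + n%:R - 1)
                        / ((w1 - w2) * (w1 - w3)),
          k1 ^+ 2 = ((k + (n%:R - 2) / 2) * (k - l) + l * (k - l + p%:R))
                    / ((k - l + p%:R) * (k + l + (n%:R - 2) / 2))
        & (forall a x, dom a x -> P w1 a x = 0) ->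
          forall a x, dom a x ->
            norm_dnorm F xi a x <= k1 * norm_nab nab xi a x /\
            (norm_dnorm F xi a x = k1 * norm_nab nab xi a x <->
             exists al : 'cV[R]_n,
               nab xi a x = Pi w2 (tens al (xi a x)) + Pi w3 (tens al (xi a x)) /\
               Pi w4 (tens al (xi a x)) = 0)],
      (* (ii) *)
      exists k3 : R,
      [/\ 0 <= k3,
          k3 ^+ 2 = 1 - (w3 + (n%:R - 2) / 2) * (w3 + w2 + n%:R - 1)
                        / ((w3 - w4) * (w3 - w1)),
          k3 ^+ 2 = 1 - l * (N2 - p%:R)
                        / ((k - l + N2 - p%:R) * (k + l + (n%:R - 2) / 2))
        & (forall a x, dom a x -> P w3 a x = 0) ->
          forall a x, dom a x ->
            norm_dnorm F xi a x <= k3 * norm_nab nab xi a x /\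
            (norm_dnorm F xi a x = k3 * norm_nab nab xi a x <->
             exists al : 'cV[R]_n,
               nab xi a x = Pi w1 (tens al (xi a x)) + Pi w4 (tens al (xi a x)) /\
               Pi w2 (tens al (xi a x)) = 0)]
    & (* (iii) *)
      let t4 := (w4 + (n%:R - 2) / 2) * (w2 + w4 + n%:R - 1)
                / ((w4 - w1) * (w4 - w3)) in
      let t2 := (w2 + (n%:R - 2) / 2) * (w2 + w4 + n%:R - 1)
                / ((w2 - w1) * (w2 - w3)) in
      exists k24 : R,
      [/\ 0 <= k24,
          k24 ^+ 2 = 1 - Num.min t4 t2,
          k24 ^+ 2 = 1 - Num.min
            ((k + N2 - p%:R) * (k - l)
             / ((2 * k + n%:R - p%:R - 1) * (k - l + N2 - p%:R)))
            ((l + N2 - p%:R - 1) * (k - l)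
             / ((k - l + p%:R) * (2 * l + N2 - p%:R - 1)))
        & (forall a x, dom a x -> P w2 a x + P w4 a x = 0) ->
          forall a x, dom a x ->
            let eq13 al :=
              nab xi a x = Pi w1 (tens al (xi a x)) + Pi w3 (tens al (xi a x)) in
            let equality := norm_dnorm F xi a x = k24 * norm_nab nab xi a x in
            [/\ norm_dnorm F xi a x <= k24 * norm_nab nab xi a x,
                t4 < t2 ->
                  (equality <->
                   exists al : 'cV[R]_n, eq13 al /\ Pi w2 (tens al (xi a x)) = 0),
                t2 < t4 ->
                  (equality <->
                   exists al : 'cV[R]_n, eq13 al /\ Pi w4 (tens al (xi a x)) = 0)
              & t4 = t2 -> (equality <-> exists al : 'cV[R]_n, eq13 al)]]].
Proof.
move=> N2 P Pi.
have Danti := basis_rep_anti hrho; have Dskew := basis_rep_skew hG hrho.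
have Dcomm := basis_rep_comm hrho; have Wreal := dl_wedge_real hrho.
have [c Dcas] := casimir_scalar hG hrho hirr; rewrite /casimir in Dcas.
(* Both families in one shape: [s] is the sign of the last weight, and is false in odd dimension. *)
have [s [nE so pm lk muE]] : exists s : bool, [/\ n = (m.*2 + odd n)%N, s ==> ~~ odd n,
    (0 < p < m)%N, 0 < l < k & forall j, (j < m)%N -> mu j = if (j < p)%N then k
     else if s && (j == m.-1) then - l else l].
  case: hcase => [[nE pm lk _ [s muE]]|[nE pm [lE lk] _ muE]].
    exists s; split=> //; first by lia.
      by rewrite nE odd_double implybT.
    move=> j jm; rewrite muE //; case: ifP => // _; case: eqP => _; last by rewrite andbF.
    by rewrite andbT; case: (s); rewrite ?expr0 ?mul1r // expr1 mulN1r.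
  exists false; split=> //; first by lia.
  by rewrite lk andbT lE invr_gt0 ltr0n.
have lo : odd n -> l = 2^-1.
  by case: hcase => [[nE' _ _ _ _]|[_ _ [-> _] _ _]] //; rewrite nE' odd_double.
have /andP[l0 kl] := lk.
have [cE kT lT] := highest_weight_data Danti Dskew Dcomm Wreal Dcas hmu nE so pm kl muE.
have [e1E e3E] := weight_relations Danti Dskew Dcomm Dcas hN.
have kin : k \in [:: w1; w2; w3; w4] by apply/(hN.2).
have lin : l - p%:R \in [:: w1; w2; w3; w4] by apply/(hN.2).
have NE : n%:R = 2 * m%:R + (odd n)%:R :> R by rewrite {1}nE natrD -muln2 natrM mulrC.
have p1 : 1 <= p%:R :> R by rewrite ler1n; case/andP: pm.
have pm1 : p%:R + 1 <= m%:R :> R by rewrite natr1 ler_nat; case/andP: pm.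
have [E1 E2 E3 E4] := weight_values NE lo p1 pm1 l0 kl hN.1 kin lin cE e1E e3E.
have N0 : 2 * m%:R <= n%:R :> R by rewrite NE lerDl ler0n.
have i1 : w1 \in [:: w1; w2; w3; w4] by rewrite !inE eqxx.
have i2 : w2 \in [:: w1; w2; w3; w4] by rewrite !inE eqxx orbT.
have i3 : w3 \in [:: w1; w2; w3; w4] by rewrite !inE eqxx !orbT.
have i4 : w4 \in [:: w1; w2; w3; w4] by rewrite !inE eqxx !orbT.
have uw := weights_uniq hN.
have bE a x : dom a x -> forall i, diff_in F a (fun y => rnorm (xi a y)) x i 0 =
    rdot (col i (nab xi a x)) (xi a x) / rnorm (xi a x).
  by move=> ax i; apply: (dnorm_section i hnab hxi ax); exact: hxi0.
have kato a x (J : seq R) kk A w0 : dom a x -> uniq J -> {subset J <= [:: w1; w2; w3; w4]} ->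
    (forall w, w \in [:: w1; w2; w3; w4] -> w \notin J -> P w a x = 0) ->
    0 < kk -> w0 \in [:: w1; w2; w3; w4] -> 0 <= A ->
    (forall al, let q w := rdot (Pi w (tens al (xi a x))) (Pi w (tens al (xi a x))) in
       \sum_(w <- J) q w = kk ^+ 2 * rdot (tens al (xi a x)) (tens al (xi a x)) - A * q w0) ->
    norm_dnorm F xi a x <= kk * norm_nab nab xi a x /\
    (norm_dnorm F xi a x = kk * norm_nab nab xi a x <-> exists al : 'cV[R]_n,
      nab xi a x = \sum_(w <- J) Pi w (tens al (xi a x)) /\
      (A = 0 \/ Pi w0 (tens al (xi a x)) = 0)).
  move=> ax uJ sJ SJ kk0 w0ws A0 H.
  by apply: (kato_weights Danti Dskew hN uJ sJ SJ (hxi0 _ _ ax) kk0 (bE _ _ ax) w0ws A0 H).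
have usort (J : seq R) : sorted >%O J -> uniq J.
  by apply: sorted_uniq; [exact: rev_trans lt_trans|exact: ltxx].
have pN : 2 * (p%:R + 1) <= n%:R :> R by apply: le_trans N0; rewrite ler_pM2l // ltr0n.
have signs := weights_signs p1 pN l0 kl; rewrite /= -E4 -E3 -E2 -E1 in signs.
have [[h12 h23 h34] [x1 x2 x3 x4]] := signs.
have h13 : 0 < w1 - w3 by rewrite -(subrK w2 w1) -addrA addr_gt0.
have h24 : 0 < w2 - w4 by rewrite -(subrK w3 w2) -addrA addr_gt0.
have h14 : 0 < w1 - w4 by rewrite -(subrK w2 w1) -addrA addr_gt0.
have hN' x y : 0 < x - y -> y - x < 0 :> R by rewrite -oppr_lt0 opprB.
split; first by [].
- have X1 : 0 < (w1 - w2) * (w1 - w3) by exact: mulr_gt0.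
  have X4 : 0 < (w4 - w2) * (w4 - w3) by rewrite nmulr_rgt0 hN'.
  have [ka0] := kato_constant1 p1 pN l0 kl; set ka := (X in 0 < X) in ka0 * => kaE0.
  have kaE : ka = 1 - (w1 + (n%:R - 2) / 2) * (w1 + w4 + n%:R - 1) / ((w1 - w2) * (w1 - w3)).
    by rewrite E1 E2 E3 E4.
  (* By [solve_weight], $q_1=(1-k_1^2)Q_0+Aq_4$, so the other masses add up to $k_1^2Q_0-Aq_4$ with
     $A>0$. *)
  pose A := - ((w4 - w2) * (w4 - w3) * (w1 + (n%:R - 2) / 2) /
       ((w1 - w2) * (w1 - w3) * (w4 + (n%:R - 2) / 2))).
  have A0 : 0 < A.
    apply: opp_div_gt0; first exact: mulr_gt0.
    by rewrite pmulr_rlt0.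
  exists (Num.sqrt ka); rewrite sqr_sqrtr ?(ltW ka0) // sqrtr_ge0; split=> //.
  move=> P1 a x ax.
  have [||w||||al q|le eqn] := kato a x [:: w2; w3; w4] (Num.sqrt ka) A w4 ax.
  + by case/andP: uw.
  + by apply/allP; rewrite /= i2 i3 i4.
  + by rewrite inE => /orP[/eqP -> _|wJ]; [exact: P1|rewrite wJ].
  + by rewrite sqrtr_gt0.
  + exact: i4.
  + exact: ltW.
  + have [m0 m1 m3] := tens_moments Danti Dskew Dcomm Dcas hN al (xi a x).
    have [id14 _ _] := weight_identities e1E e3E m0 m1 m3.
    have q1E := solve_weight (lt0r_neq0 X1) (ltr0_neq0 x4) id14.
    rewrite !big_cons big_nil addr0 sqr_sqrtr ?(ltW ka0) // kaE /A.
    move: m0 q1E; rewrite -!/(q _); move: (rdot (tens _ _) _) (q w1) (q w2) (q w3) (q w4).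
    move=> Q0 q1 q2 q3 q4 m0 /= q1E.
    have -> : q2 + (q3 + q4) = Q0 - q1 by rewrite -m0; ring.
    by rewrite q1E; ring.
  + split=> //; rewrite eqn; split=> -[al].
      rewrite !big_cons big_nil addr0 => -[-> [A00|p4]]; first by rewrite A00 ltxx in A0.
      by exists al; rewrite p4 addr0.
    by case=> -> p4; exists al; rewrite !big_cons big_nil p4 !addr0; split=> //; right.
- have X3 : (w3 - w4) * (w3 - w1) < 0 by rewrite pmulr_rlt0 // hN'.
  have X2 : (w2 - w4) * (w2 - w1) < 0 by rewrite pmulr_rlt0 // hN'.
  have [ka0] := kato_constant3 p1 pN l0 kl; set ka := (X in 0 < X) in ka0 * => kaE0.
  have kaE : ka = 1 - (w3 + (n%:R - 2) / 2) * (w3 + w2 + n%:R - 1) / ((w3 - w4) * (w3 - w1)).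
    by rewrite E1 E2 E3 E4.
  (* Likewise $q_3=(1-k_3^2)Q_0+Aq_2$, again with $A>0$. *)
  pose A := - ((w2 - w4) * (w2 - w1) * (w3 + (n%:R - 2) / 2) /
       ((w3 - w4) * (w3 - w1) * (w2 + (n%:R - 2) / 2))).
  have A0 : 0 < A.
    apply: opp_div_gt0; first by rewrite nmulr_rgt0.
    by rewrite nmulr_rlt0.
  exists (Num.sqrt ka); rewrite sqr_sqrtr ?(ltW ka0) // sqrtr_ge0; split=> //.
  move=> P3 a x ax.
  have [||w||||al q|le eqn] := kato a x [:: w1; w2; w4] (Num.sqrt ka) A w2 ax.
  + by apply: usort; rewrite /= -subr_gt0 h12 -subr_gt0 h24.
  + by apply/allP; rewrite /= i1 i2 i4.
  + by rewrite !inE => /or4P[] /eqP ->; rewrite ?eqxx ?orbT // => _; exact: P3.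
  + by rewrite sqrtr_gt0.
  + exact: i2.
  + exact: ltW.
  + have [m0 m1 m3] := tens_moments Danti Dskew Dcomm Dcas hN al (xi a x).
    have [_ id32 _] := weight_identities e1E e3E m0 m1 m3.
    have q3E := solve_weight (ltr0_neq0 X3) (lt0r_neq0 x2) id32.
    rewrite !big_cons big_nil addr0 sqr_sqrtr ?(ltW ka0) // kaE /A.
    move: m0 q3E; rewrite -!/(q _); move: (rdot (tens _ _) _) (q w1) (q w2) (q w3) (q w4).
    move=> Q0 q1 q2 q3 q4 m0 /= q3E.
    have -> : q1 + (q2 + q4) = Q0 - q3 by rewrite -m0; ring.
    by rewrite q3E; ring.
  + split=> //; rewrite eqn; split=> -[al].
      rewrite !big_cons big_nil addr0 => -[-> [A00|p2]]; first by rewrite A00 ltxx in A0.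
      by exists al; rewrite p2 add0r.
    by case=> -> p2; exists al; rewrite !big_cons big_nil p2 add0r addr0; split=> //; right.
move=> t4 t2.
have X4 : 0 < (w4 - w1) * (w4 - w3) by rewrite nmulr_rgt0 hN'.
have X2 : (w2 - w1) * (w2 - w3) < 0 by rewrite nmulr_rlt0 // hN'.
have [t4E t2E t40 t20 t41] : [/\ t4 = (k + N2 - p%:R) * (k - l)
        / ((2 * k + n%:R - p%:R - 1) * (k - l + N2 - p%:R)),
      t2 = (l + N2 - p%:R - 1) * (k - l) / ((k - l + p%:R) * (2 * l + N2 - p%:R - 1)),
      0 < t4, 0 < t2 & t4 < 1].
  by rewrite /t4 /t2 E1 E2 E3 E4; exact: kato_constant24.
have ka0 : 0 < 1 - Num.min t4 t2 by rewrite subr_gt0 gt_min t41.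
exists (Num.sqrt (1 - Num.min t4 t2)).
rewrite -t4E -t2E sqr_sqrtr ?(ltW ka0) // sqrtr_ge0.
split=> // P24 a x ax eq13 equality.
have n42 : w4 != w2 by rewrite lt_eqF // -subr_gt0.
(* The two components are orthogonal, so a vanishing sum kills each of them. *)
have P2 : P w2 a x = 0.
  apply/eqP; rewrite -rdot_eq0; have := congr1 (fun T => rdot T (P w2 a x)) (P24 a x ax).
  rewrite rdotDl rdot0l [X in _ + X](conf_proj_ortho Danti Dskew hN _ _ i4 i2 n42).
  by rewrite addr0 => ->.
have P4 : P w4 a x = 0 by have := P24 a x ax; rewrite P2 add0r.
(* The third identity reads $q_4/t_4+q_2/t_2=Q_0$. With $q_2,q_4\ge0$ this bounds $q_2+q_4$ below by
   its value at an end of a segment, where $q_2=0$ if $t_4<t_2$ and $q_4=0$ if $t_2<t_4$. *)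
have key al : let q w := rdot (Pi w (tens al (xi a x))) (Pi w (tens al (xi a x))) in
    q w1 + q w2 + q w3 + q w4 = rdot (tens al (xi a x)) (tens al (xi a x)) /\
    t2 * q w4 + t4 * q w2 = t4 * t2 * rdot (tens al (xi a x)) (tens al (xi a x)).
  move=> q; have [m0 m1 m3] := tens_moments Danti Dskew Dcomm Dcas hN al (xi a x).
  split=> //; have [_ _ id42] := weight_identities e1E e3E m0 m1 m3.
  apply: (mulfI (mulf_neq0 (lt0r_neq0 X4) (ltr0_neq0 X2))).
  set X := (w4 - w1) * _ in X4 id42 *; set Y := (w2 - w1) * _ in X2 id42 *.
  have t4X : t4 * X = (w4 + (n%:R - 2) / 2) * (w2 + w4 + n%:R - 1).
    by rewrite /t4 divfK // lt0r_neq0.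
  have t2Y : t2 * Y = (w2 + (n%:R - 2) / 2) * (w2 + w4 + n%:R - 1).
    by rewrite /t2 divfK // ltr0_neq0.
  move: id42; rewrite /= -!/(q _); move: (rdot (tens _ _) _) (q w4) (q w2) => Q0 q4 q2 id42.
  transitivity (X * q4 * (t2 * Y) + Y * q2 * (t4 * X)); first by ring.
  rewrite t2Y t4X.
  transitivity ((w2 + w4 + n%:R - 1) * (X * (w2 + (n%:R - 2) / 2) * q4
    + Y * (w4 + (n%:R - 2) / 2) * q2)); first by ring.
  rewrite id42; transitivity ((t4 * X) * (t2 * Y) * Q0); last by ring.
  by rewrite t4X t2Y; ring.
have ineq A w0 : w0 \in [:: w1; w2; w3; w4] -> 0 <= A ->
    (forall al, let q w := rdot (Pi w (tens al (xi a x))) (Pi w (tens al (xi a x))) in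
      q w2 + q w4 = Num.min t4 t2 * rdot (tens al (xi a x)) (tens al (xi a x)) + A * q w0) ->
    norm_dnorm F xi a x <= Num.sqrt (1 - Num.min t4 t2) * norm_nab nab xi a x /\
    (equality <-> exists al : 'cV[R]_n, eq13 al /\ (A = 0 \/ Pi w0 (tens al (xi a x)) = 0)).
  move=> w0ws A0 H.
  have [||w||al q|le eqn] :=
    kato a x [:: w1; w3] (Num.sqrt (1 - Num.min t4 t2)) A w0 ax _ _ _ _ w0ws A0.
  + by apply: usort; rewrite /= -subr_gt0 h13.
  + by apply/allP; rewrite /= i1 i3.
  + by rewrite !inE => /or4P[] /eqP ->; rewrite ?eqxx ?orbT // => _.
  + by rewrite sqrtr_gt0.
  + rewrite !big_cons big_nil addr0 sqr_sqrtr ?(ltW ka0) //.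
    have [m0 _] := key al; have := H al; move: m0; rewrite /= -!/(q _) => <- H2.
    have -> : q w1 + q w3 = q w1 + q w2 + q w3 + q w4 - (q w2 + q w4) by ring.
    by rewrite H2; ring.
  split=> //; rewrite /equality eqn; split=> -[al].
    by rewrite !big_cons big_nil addr0 => H'; exists al.
  by move=> H'; exists al; rewrite !big_cons big_nil addr0.
have lt42 : t4 < t2 -> norm_dnorm F xi a x <= Num.sqrt (1 - Num.min t4 t2) * norm_nab nab xi a x /\
    (equality <-> exists al : 'cV[R]_n, eq13 al /\ Pi w2 (tens al (xi a x)) = 0).
  move=> lt; have A0 : 0 < 1 - t4 / t2 by rewrite subr_gt0 ltr_pdivrMr // mul1r.
  (* Substituting $q_4=t_4Q_0-(t_4/t_2)q_2$ leaves the excess $(1-t_4/t_2)q_2$ over the minimum. *)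
  have [al q|le eqn] := ineq (1 - t4 / t2) w2 i2 (ltW A0).
    have [_ qE] := key al; move: qE; rewrite /= -!/(q _) (min_l (ltW lt)).
    move: (rdot (tens _ _) _) (q w4) (q w2) => Q0 q4 q2 qE.
    apply: (mulfI (lt0r_neq0 t20)); rewrite mulrDr.
    have -> : t2 * q4 = t4 * t2 * Q0 - t4 * q2 by rewrite -qE addrK.
    by field; exact: lt0r_neq0.
  split=> //; rewrite eqn; split=> -[al [e H]]; exists al; split=> //; last by right.
  by case: H => // A00; rewrite A00 ltxx in A0.
have lt24 : t2 < t4 -> norm_dnorm F xi a x <= Num.sqrt (1 - Num.min t4 t2) * norm_nab nab xi a x /\
    (equality <-> exists al : 'cV[R]_n, eq13 al /\ Pi w4 (tens al (xi a x)) = 0).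
  move=> lt; have A0 : 0 < 1 - t2 / t4 by rewrite subr_gt0 ltr_pdivrMr // mul1r.
  have [al q|le eqn] := ineq (1 - t2 / t4) w4 i4 (ltW A0).
    have [_ qE] := key al; move: qE; rewrite /= -!/(q _) (min_r (ltW lt)).
    move: (rdot (tens _ _) _) (q w4) (q w2) => Q0 q4 q2 qE.
    apply: (mulfI (lt0r_neq0 t40)); rewrite mulrDr.
    have -> : t4 * q2 = t4 * t2 * Q0 - t2 * q4 by rewrite -qE addrC addKr.
    by field; exact: lt0r_neq0.
  split=> //; rewrite eqn; split=> -[al [e H]]; exists al; split=> //; last by right.
  by case: H => // A00; rewrite A00 ltxx in A0.
have eq42 : t4 = t2 -> norm_dnorm F xi a x <= Num.sqrt (1 - Num.min t4 t2) * norm_nab nab xi a x /\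
    (equality <-> exists al : 'cV[R]_n, eq13 al).
  (* The sum $q_2+q_4$ is constant here; with coefficient 0, [w2] is only a placeholder. *)
  move=> e; have [al q|le eqn] := ineq 0 w2 i2 (lexx 0).
    have [_ qE] := key al; move: qE; rewrite /= -!/(q _) e minxx mul0r addr0.
    move: (rdot (tens _ _) _) (q w4) (q w2) => Q0 q4 q2 qE.
    by apply: (mulfI (lt0r_neq0 t20)); rewrite mulrA -qE; ring.
  split=> //; rewrite eqn; split=> -[al H]; exists al; first by case: H.
  by split=> //; left.
split=> [||lt|e]; [|by move=> /lt42[]|by case: (lt24 lt)|by case: (eq42 e)].
have [lt|lt|e] : [\/ t4 < t2, t2 < t4 | t4 = t2].
  by case: (ltgtP t4 t2) => ?; [constructor 1|constructor 2|constructor 3].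
- by case: (lt42 lt).
- by case: (lt24 lt).
- by case: (eq42 e).
Qed.
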